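(* Fix $\epsilon\in(0,1)$ and $k\in\mathbb{N}$, $k\ge 1$, and let $\beta=\beta(n)>-1$ and $N=N(n)>n$ be arbitrary sequences of real and natural numbers, respectively. Then $$\lim_{n\to\infty}\frac{\mathbb{E}\,V_k(P_{N,n}^\beta)}{V_k(B_2^n)}=\begin{cases}1 & \text{if } N\ge \exp\left(\exp\left((1+\epsilon)\log\left(\beta+\frac{n-k}{2}\right)\right)\right)\text{ for all sufficiently large } n,\\ 0 & \text{if } N\le \exp\left(\exp\left((1-\epsilon)\log\left(\beta+\frac{n-k}{2}\right)\right)\right)\text{ for all sufficiently large } n.\end{cases}$$
   Context: $B_2^n$ is the closed Euclidean unit ball in $\mathbb{R}^n$ and $V_n$ is $n$-dimensional Lebesgue measure. For a compact convex set $K\subset\mathbb{R}^n$, the intrinsic volumes $V_0(K),\ldots,V_n(K)$ are the non-negative coefficients defined by Steiner's formula $V_n(K+tB_2^n)=\sum_{j=0}^n t^{n-j}V_{n-j}(B_2^{n-j})V_j(K)$ for all $t\ge 0$ (where $V_0(B_2^0)=1$). For $\beta>-1$, $\nu_\beta$ is the beta distribution, i.e. the probability measure on $B_2^n$ with density proportional to $(1-\|x\|^2)^\beta$, $x\in B_2^n$. For $N>n$, $P_{N,n}^\beta=\mathrm{conv}\{X_1,\ldots,X_N\}$, where $X_1,\ldots,X_N$ are independent random points in $\mathbb{R}^n$ with distribution $\nu_\beta$. *)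

(* Defs.v *)
From HB Require Import structures.
From mathcomp Require Import all_boot all_order all_algebra.
From mathcomp Require Import all_classical all_reals all_analysis.

Set Implicit Arguments.
Unset Strict Implicit.
Unset Printing Implicit Defensive.

Import Order.TTheory GRing.Theory Num.Theory.
Import numFieldNormedType.Exports.

Local Open Scope classical_set_scope.
Local Open Scope ring_scope.

(* R^n is 'rV[R]_n, with the sigma-algebra generated by the n coordinates,
   i.e. the Borel sigma-algebra (same construction as for n.-tuple R). *)
Section row_measurable.
Context {R : realType} {n : nat}.

Let coor : 'I_n -> 'rV[R]_n -> R := fun i x => x ord0 i.

Let row_set0 : g_sigma_preimage coor set0.
Proof. exact: sigma_algebra0. Qed.

Let row_setC A : g_sigma_preimage coor A -> g_sigma_preimage coor (~` A).
Proof. exact: sigma_algebraC. Qed.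

Let row_bigcup (F : (set 'rV[R]_n)^nat) :
  (forall i, g_sigma_preimage coor (F i)) ->
  g_sigma_preimage coor (\bigcup_i (F i)).
Proof. exact: sigma_algebra_bigcup. Qed.

HB.instance Definition _ := @isMeasurable.Build default_measure_display
  'rV[R]_n (g_sigma_preimage coor) row_set0 row_setC row_bigcup.

Lemma measurable_coor (i : 'I_n) :
  measurable_fun [set: 'rV[R]_n] (fun x : 'rV[R]_n => x ord0 i).
Proof.
move=> _ Y mY; rewrite setTI; apply: sub_sigma_algebra => /=.
rewrite -bigcup_seq/=; exists i => /=; first by rewrite mem_index_enum.
by exists Y => //; rewrite setTI.
Qed.

Lemma measurable_fun_rowP d (T : measurableType d) (f : T -> 'rV[R]_n) :
  (forall i, measurable_fun [set: T] (fun t => f t ord0 i)) ->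
  measurable_fun [set: T] f.
Proof.
move=> mf _ Y mY; rewrite setTI.
suff: measurable `<=` [set Y : set 'rV[R]_n | measurable (f @^-1` Y)] by apply.
apply: smallest_sub => /=.
  split => /=.
  - by rewrite preimage_set0; exact: measurable0.
  - by move=> A mA; rewrite setTD preimage_setC; exact: measurableC.
  - by move=> F mF; rewrite preimage_bigcup; exact: bigcupT_measurable.
rewrite -bigcup_seq => A [i _] [B mB <-] /=.
by rewrite setTI -[X in measurable X]setTI; exact: mf.
Qed.

End row_measurable.

Section lebesgue_row.
Context {R : realType}.

Definition row_cons n (p : R * 'rV[R]_n) : 'rV[R]_n.+1 :=
  \row_i (if unlift ord0 i is Some j then p.2 ord0 j else p.1).

Lemma row_cons0 n (p : R * 'rV[R]_n) : row_cons p ord0 ord0 = p.1.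
Proof. by rewrite mxE unlift_none. Qed.

Lemma row_consS n (p : R * 'rV[R]_n) (i : 'I_n) :
  row_cons p ord0 (lift ord0 i) = p.2 ord0 i.
Proof. by rewrite mxE liftK. Qed.

Lemma measurable_row_cons n :
  measurable_fun [set: R * 'rV[R]_n] (@row_cons n).
Proof.
apply: measurable_fun_rowP => i; have [j ->|->] := unliftP ord0 i.
- rewrite (_ : (fun _ => _) = (fun x : 'rV[R]_n => x ord0 j) \o snd).
    by apply: measurableT_comp => //; exact: measurable_coor.
  by apply/funext => p /=; exact: row_consS.
- rewrite (_ : (fun _ => _) = fst) //.
  by apply/funext => p; exact: row_cons0.
Qed.

Definition row_uncons n (x : 'rV[R]_n.+1) : R * 'rV[R]_n :=
  (x ord0 ord0, \row_i x ord0 (lift ord0 i)).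

Lemma row_consK n : cancel (@row_cons n) (@row_uncons n).
Proof.
move=> [a x]; rewrite /row_uncons row_cons0; congr pair.
by apply/rowP => i; rewrite mxE row_consS.
Qed.

Lemma measurable_row_uncons n :
  measurable_fun [set: 'rV[R]_n.+1] (@row_uncons n).
Proof.
apply: measurable_fun_pair; first exact: measurable_coor.
apply: measurable_fun_rowP => i.
under eq_fun do rewrite mxE.
exact: measurable_coor.
Qed.

Section step.
Variables (n : nat) (mu : {sigma_finite_measure set 'rV[R]_n -> \bar R}).

Definition lebesgue_step : set 'rV[R]_n.+1 -> \bar R :=
  pushforward (@lebesgue_measure R \x mu)%E (@row_cons n).

Let lebesgue_step0 : lebesgue_step set0 = 0%E.
Proof. by rewrite /lebesgue_step /pushforward preimage_set0 measure0. Qed.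

Let lebesgue_step_ge0 A : (0 <= lebesgue_step A)%E.
Proof. by rewrite /lebesgue_step /pushforward; exact: measure_ge0. Qed.

Let lebesgue_step_sigma_additive : semi_sigma_additive lebesgue_step.
Proof.
move=> F mF tF mUF; rewrite /lebesgue_step /pushforward preimage_bigcup.
have mc B : measurable B -> measurable (@row_cons n @^-1` B).
  by move=> mB; rewrite -[X in measurable X]setTI; exact: measurable_row_cons.
apply: measure_semi_sigma_additive.
- by move=> i; exact: mc.
- apply/trivIsetP => /= i j _ _ ij; rewrite -preimage_setI.
  by move/trivIsetP : tF => /(_ _ _ _ _ ij) ->//; rewrite preimage_set0.
- by rewrite -preimage_bigcup; exact: mc.
Qed.

HB.instance Definition _ := isMeasure.Build _ _ _ lebesgue_step
  lebesgue_step0 lebesgue_step_ge0 lebesgue_step_sigma_additive.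

Let lebesgue_step_sigma_finite : sigma_finite setT lebesgue_step.
Proof.
have /sigma_finiteP[F [TF ndF Foo]] := sigma_finiteT (@lebesgue_measure R).
have /sigma_finiteP[G [TG ndG Goo]] := sigma_finiteT mu.
exists (fun i => @row_uncons n @^-1` (F i `*` G i)) => [|i].
  apply/esym; rewrite -subTset => x _.
  have [i _ Fi] : (\bigcup_i F i) (row_uncons x).1 by rewrite -TF.
  have [j _ Gj] : (\bigcup_i G i) (row_uncons x).2 by rewrite -TG.
  exists (maxn i j) => //; split.
    by move: Fi; exact/subsetPset/ndF/leq_maxl.
  by move: Gj; exact/subsetPset/ndG/leq_maxr.
have [mF oF] := Foo i; have [mG oG] := Goo i; split.
  rewrite -[X in measurable X]setTI; apply: measurable_row_uncons => //.
  exact: measurableX.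
rewrite /lebesgue_step /pushforward -comp_preimage.
rewrite (_ : _ \o _ = id) ?preimage_id; last exact/funext/row_consK.
by rewrite product_measure1E// lte_mul_pinfty// ge0_fin_numE.
Qed.

HB.instance Definition _ := Measure_isSigmaFinite.Build _ _ _ lebesgue_step
  lebesgue_step_sigma_finite.

End step.

(* n-dimensional Lebesgue measure V_n: the n-fold product of the Lebesgue
   measure on R (the unit mass at the only point in dimension 0). *)
Fixpoint lebesgue_row (n : nat) :
    {sigma_finite_measure set 'rV[R]_n -> \bar R} :=
  match n with
  | 0%N => @dirac _ 'rV[R]_0 0 R
  | n'.+1 => lebesgue_step (lebesgue_row n')
  end.

End lebesgue_row.

Section convex_geometry.
Context {R : realType}.

(* The norm `|x| of the library on 'rV[R]_n is the sup norm. *)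
Definition enorm n (x : 'rV[R]_n) : R := Num.sqrt (\sum_i x ord0 i ^+ 2).

Definition eball n : set 'rV[R]_n := [set x | enorm x <= 1].

Definition conv_hull n (A : set 'rV[R]_n) : set 'rV[R]_n :=
  smallest (@convex_set R 'rV[R]_n) A.

(* v_0, ..., v_n are nonnegative and satisfy Steiner's formula for K. *)
Definition steiner_coefficients n (K : set 'rV[R]_n)
    (v : {ffun 'I_n.+1 -> R}) : Prop :=
  (forall j, 0 <= v j) /\
  forall t : R, 0 <= t ->
    lebesgue_row n [set x + t *: y | x in K & y in @eball n] =
    (\sum_(j < n.+1) (t ^+ (n - j))%:E * lebesgue_row (n - j) (@eball (n - j))
       * (v j)%:E)%E.

(* Steiner's formula determines the coefficients uniquely; the value is 0 by
   convention if k > n or if K admits no Steiner formula. *)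
Definition intrinsic_volume n (k : nat) (K : set 'rV[R]_n) : R :=
  if (k <= n)%N
  then xget [ffun=> 0] [set v | steiner_coefficients K v] (inord k)
  else 0.

(* The beta distribution: density proportional to (1 - ||x||^2)^b on the unit
   ball. *)
Definition beta_law n (b : R) (A : set 'rV[R]_n) : \bar R :=
  (\int[lebesgue_row n]_(x in A `&` @eball n) ((1 - enorm x ^+ 2) `^ b)%:E /
   \int[lebesgue_row n]_(x in @eball n) ((1 - enorm x ^+ 2) `^ b)%:E)%E.

End convex_geometry.

Definition mutually_independent d d' (T : measurableType d)
    (T' : measurableType d') (R : realType) (P : probability T R)
    (I : finType) (X : I -> {RV P >-> T'}) : Prop :=
  forall (J : {set I}) (A : I -> set T'), (forall i, measurable (A i)) ->
    P (\bigcap_(i in [set` J]) X i @^-1` A i) =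
    (\prod_(i in J) P (X i @^-1` A i))%E.

(* Main.v *)
Require Import Defs.
From HB Require Import structures.
From mathcomp Require Import all_boot all_order all_algebra.
From mathcomp Require Import all_classical all_reals all_analysis.
From mathcomp Require Import measurable_realfun ring lra zify.
Import Order.TTheory GRing.Theory Num.Theory.
Import numFieldNormedType.Exports.
Local Open Scope classical_set_scope.
Local Open Scope ring_scope.

Set Implicit Arguments.
Unset Strict Implicit.
Unset Printing Implicit Defensive.

(** Write K for the random polytope, B for the unit ball, kappa_n for the
    volume of B, and a_j = V_j(K) / V_j(B). As Vol(B + tB) = (1 + t)^n kappa_n,
    Steiner's formula reads
      Vol(K + tB) = kappa_n \sum_j 'C(n, j) a_j t^(n - j),
    a polynomial with nonnegative coefficients, and both limits follow from
    estimates of the left-hand side. At t = n / s the j-th term is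
    kappa_n t^n 'C(n, j) n^-j a_j s^j, and for fixed j the factor
    'C(n, j) n^-j stays between two positive constants.

    Let x = beta + (n - k) / 2, which tends to infinity with n.

    Many points, N >= exp(x^(1 + eps)). A cap of B of fixed height has
    probability at least exp(- O(x)) (beta_law_cap_ge). A net of exp(O(x^2))
    directions therefore has a point of the sample in each of its caps, except
    with a probability that tends to 0, and then K contains (1 - d)B for a
    fixed small d (ball_sub_hull, prob_missed). So Vol(K + tB) lies between
    its values for (1 - d)B and for B. Two polynomials in s with nonnegative
    bounded coefficients that are uniformly close on ]0, 1] have close
    coefficients (close_coefficients), hence a_k is close to 1
    (volume_ratio_sandwich). On the exceptional event a_k is bounded by a
    constant that depends on k only (volume_ratio_crude).

    Few points, N <= exp(x^(1 - eps)). One term of Steiner's formula gives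
    a_k <= Vol(K + tB) / (kappa_n 'C(n, k) t^(n - k)). A point z of K + tB has
    norm at most t + r, or a sample point X_i satisfies <X_i, z> >= r |z|
    (parallel_body_sub), which has probability at most exp(- r^2 x)
    (beta_law_cap_le). With r = x^(- eps / 3) and t = n r the expectation of
    a_k is O(r^k) (expectation_upper, upper_bound_small).

    Steiner's formula for polytopes (steiner_polytope) comes from cutting
    space into cells according to the set J of the vertices that are extremal
    in the direction from the nearest point of K. On a cell the nearest point
    is an orthogonal projection, and the part of the cell at distance at most
    t from K is the image of the part at distance at most 1 under the linear
    map that stretches by t in the normal directions (cell_scaling). The
    behaviour of Lebesgue measure under linear maps is derived from Tonelli's
    theorem and translation invariance (lebesgue_row_mulmx_swap). *)

(** * Euclidean norm and inner product *)

Section euclidean.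
Context {R : realType}.
Implicit Types n : nat.

Definition dot n (x y : 'rV[R]_n) : R := \sum_i x ord0 i * y ord0 i.

Lemma dotC n (x y : 'rV[R]_n) : dot x y = dot y x.
Proof. by apply: eq_bigr => i _; rewrite mulrC. Qed.

Lemma dotDl n (x y z : 'rV[R]_n) : dot (x + y) z = dot x z + dot y z.
Proof. by rewrite -big_split; apply: eq_bigr => i _; rewrite mxE mulrDl. Qed.

Lemma dotDr n (x y z : 'rV[R]_n) : dot x (y + z) = dot x y + dot x z.
Proof. by rewrite dotC dotDl !(dotC x). Qed.

Lemma dotZl n a (x y : 'rV[R]_n) : dot (a *: x) y = a * dot x y.
Proof. by rewrite mulr_sumr; apply: eq_bigr => i _; rewrite mxE mulrA. Qed.

Lemma dotZr n a (x y : 'rV[R]_n) : dot x (a *: y) = a * dot x y.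
Proof. by rewrite dotC dotZl dotC. Qed.

Lemma dotNl n (x y : 'rV[R]_n) : dot (- x) y = - dot x y.
Proof. by rewrite -scaleN1r dotZl mulN1r. Qed.

Lemma dotNr n (x y : 'rV[R]_n) : dot x (- y) = - dot x y.
Proof. by rewrite dotC dotNl dotC. Qed.

Lemma dotBl n (x y z : 'rV[R]_n) : dot (x - y) z = dot x z - dot y z.
Proof. by rewrite dotDl dotNl. Qed.

Lemma dotBr n (x y z : 'rV[R]_n) : dot x (y - z) = dot x y - dot x z.
Proof. by rewrite dotDr dotNr. Qed.

Lemma dot0l n (x : 'rV[R]_n) : dot 0 x = 0.
Proof. by rewrite -(scale0r 0) dotZl mul0r. Qed.

Lemma dot0r n (x : 'rV[R]_n) : dot x 0 = 0.
Proof. by rewrite dotC dot0l. Qed.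

Lemma dot_sumr n (I : finType) (w : I -> R) (x : I -> 'rV[R]_n) y :
  dot (\sum_i w i *: x i) y = \sum_i w i * dot (x i) y.
Proof.
elim/big_rec2 : _ => [|i a b _ <-]; first exact: dot0l.
by rewrite dotDl dotZl.
Qed.

Lemma dotxx_ge0 n (x : 'rV[R]_n) : 0 <= dot x x.
Proof. by apply: sumr_ge0 => i _; rewrite -expr2 sqr_ge0. Qed.

Lemma dotxx_eq0 n (x : 'rV[R]_n) : dot x x = 0 -> x = 0.
Proof.
move=> /eqP; rewrite psumr_eq0 => [|i _]; last by rewrite -expr2 sqr_ge0.
move=> /allP /= x0; apply/rowP => i; rewrite mxE.
by have := x0 i (mem_index_enum _); rewrite -expr2 sqrf_eq0 => /eqP.
Qed.

Lemma enormE n (x : 'rV[R]_n) : enorm x = Num.sqrt (dot x x).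
Proof. by congr Num.sqrt; apply: eq_bigr => i _; rewrite expr2. Qed.

Lemma enorm_ge0 n (x : 'rV[R]_n) : 0 <= enorm x.
Proof. exact: sqrtr_ge0. Qed.

Lemma sqr_enorm n (x : 'rV[R]_n) : enorm x ^+ 2 = dot x x.
Proof. by rewrite enormE sqr_sqrtr ?dotxx_ge0. Qed.

Lemma enorm_eq0 n (x : 'rV[R]_n) : enorm x = 0 -> x = 0.
Proof. by move=> x0; apply: dotxx_eq0; rewrite -sqr_enorm x0 expr0n. Qed.

Lemma enorm0 n : enorm (0 : 'rV[R]_n) = 0.
Proof. by rewrite enormE dot0l sqrtr0. Qed.

Lemma enormZ n a (x : 'rV[R]_n) : enorm (a *: x) = `|a| * enorm x.
Proof.
rewrite !enormE dotZl dotZr mulrA -expr2 sqrtrM ?sqr_ge0//.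
by rewrite sqrtr_sqr.
Qed.

Lemma enormN n (x : 'rV[R]_n) : enorm (- x) = enorm x.
Proof. by rewrite -scaleN1r enormZ normrN1 mul1r. Qed.

Lemma enorm_le n (x : 'rV[R]_n) (r : R) :
  0 <= r -> (enorm x <= r) = (dot x x <= r ^+ 2).
Proof.
by move=> r0; rewrite -sqr_enorm ler_pXn2r// nnegrE ?enorm_ge0.
Qed.

Lemma dot_le_enorm n (x y : 'rV[R]_n) : dot x y <= enorm x * enorm y.
Proof.
have [y0|y0] := eqVneq (enorm y) 0.
  by rewrite (enorm_eq0 y0) dot0r enorm0 mulr0.
have [x0|x0] := eqVneq (enorm x) 0.
  by rewrite (enorm_eq0 x0) dot0l enorm0 mul0r.
have xy : 0 < enorm x * enorm y.
  by rewrite mulr_gt0// lt_def ?x0 ?y0 enorm_ge0.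
have := dotxx_ge0 (enorm y *: x - enorm x *: y).
rewrite !(dotBl, dotBr, dotZl, dotZr) -!sqr_enorm (dotC y x) => H.
have {}H : 0 <= (enorm x * enorm y) * (enorm x * enorm y - dot x y) by nra.
by rewrite -subr_ge0 -(pmulr_rge0 _ xy).
Qed.

Lemma enormD n (x y : 'rV[R]_n) : enorm (x + y) <= enorm x + enorm y.
Proof.
rewrite enorm_le ?addr_ge0 ?enorm_ge0//.
rewrite !(dotDl, dotDr) -!sqr_enorm (dotC y x).
by have := dot_le_enorm x y; nra.
Qed.

Lemma coord_le_enorm n (x : 'rV[R]_n) i : `|x ord0 i| <= enorm x.
Proof.
rewrite -sqrtr_sqr enormE ler_wsqrtr// /dot (bigD1 i)//= -expr2 lerDl.
by apply: sumr_ge0 => j _; rewrite -expr2 sqr_ge0.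
Qed.

Lemma enorm_le_coord n (x : 'rV[R]_n) (e : R) :
  (forall i, `|x ord0 i| <= e) -> enorm x <= e * n%:R.
Proof.
move=> xe; case: n x xe => [x _|n x xe].
  by rewrite mulr0 enormE /dot big_ord0 sqrtr0.
have e0 : 0 <= e by apply: le_trans (xe ord0).
rewrite enorm_le ?mulr_ge0//.
apply: (@le_trans _ _ (\sum_(i < n.+1) e ^+ 2)).
  apply: ler_sum => i _; rewrite -expr2 -real_normK ?num_real//.
  by rewrite ler_pXn2r// nnegrE.
rewrite sumr_const card_ord -[leLHS]mulr_natr exprMn ler_wpM2l ?sqr_ge0//.
by rewrite -natrX ler_nat -mulnn leq_pmulr.
Qed.

End euclidean.

(** * Measurability in row spaces *)

Section lebesgue_row_theory.
Context {R : realType}.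
Local Notation lam := (@lebesgue_row R).

Lemma measurable_rowE n d (T : measurableType d) (f : T -> 'rV[R]_n) (i : 'I_n) :
  measurable_fun [set: T] f -> measurable_fun [set: T] (fun t => f t ord0 i).
Proof.
move=> mf.
rewrite (_ : (fun _ => _) = (fun x : 'rV[R]_n => x ord0 i) \o f)//.
by apply: measurableT_comp => //; exact: measurable_coor.
Qed.

Lemma measurable_rowD n d (T : measurableType d) (f g : T -> 'rV[R]_n) :
  measurable_fun [set: T] f -> measurable_fun [set: T] g ->
  measurable_fun [set: T] (fun t => f t + g t).
Proof.
move=> mf mg; apply: measurable_fun_rowP => i.
under eq_fun do rewrite mxE.
by apply: measurable_funD; exact: measurable_rowE.
Qed.

Lemma measurable_rowZ n d (T : measurableType d) (g : T -> R)
    (f : T -> 'rV[R]_n) :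
  measurable_fun [set: T] g -> measurable_fun [set: T] f ->
  measurable_fun [set: T] (fun t => g t *: f t).
Proof.
move=> mg mf; apply: measurable_fun_rowP => i.
under eq_fun do rewrite mxE.
by apply: measurable_funM => //; exact: measurable_rowE.
Qed.

Lemma measurable_rowN n d (T : measurableType d) (f : T -> 'rV[R]_n) :
  measurable_fun [set: T] f -> measurable_fun [set: T] (fun t => - f t).
Proof.
move=> mf; under eq_fun do rewrite -scaleN1r.
exact: measurable_rowZ.
Qed.

Lemma measurable_rowB n d (T : measurableType d) (f g : T -> 'rV[R]_n) :
  measurable_fun [set: T] f -> measurable_fun [set: T] g ->
  measurable_fun [set: T] (fun t => f t - g t).
Proof. by move=> mf mg; apply: measurable_rowD => //; exact: measurable_rowN. Qed.

Lemma measurable_rowM n m (M : 'M[R]_(n, m)) d (T : measurableType d)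
    (f : T -> 'rV[R]_n) :
  measurable_fun [set: T] f -> measurable_fun [set: T] (fun t => f t *m M).
Proof.
move=> mf; apply: measurable_fun_rowP => i.
under eq_fun do rewrite mxE.
apply: measurable_sum => j; apply: measurable_funM => //.
exact: measurable_rowE.
Qed.

Lemma measurable_dot n d (T : measurableType d) (f g : T -> 'rV[R]_n) :
  measurable_fun [set: T] f -> measurable_fun [set: T] g ->
  measurable_fun [set: T] (fun t => dot (f t) (g t)).
Proof.
move=> mf mg; apply: measurable_sum => j.
by apply: measurable_funM; exact: measurable_rowE.
Qed.

Lemma measurable_enorm n d (T : measurableType d) (f : T -> 'rV[R]_n) :
  measurable_fun [set: T] f -> measurable_fun [set: T] (fun t => enorm (f t)).
Proof.
move=> mf; under eq_fun do rewrite enormE.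
apply: measurableT_comp; last exact: measurable_dot.
apply: continuous_measurable_fun; exact: sqrt_continuous.
Qed.

(** Both sides are the product measure of E. *)
Lemma tonelli_sections d1 d2 (T1 : measurableType d1) (T2 : measurableType d2)
    (m1 : {sigma_finite_measure set T1 -> \bar R})
    (m2 : {sigma_finite_measure set T2 -> \bar R}) (E : set (T1 * T2)) :
  measurable E ->
  (\int[m1]_x m2 [set y | E (x, y)] = \int[m2]_y m1 [set x | E (x, y)])%E.
Proof.
move=> mE; have := indic_fubini_tonelli m1 m2 mE.
rewrite indic_fubini_tonelli_FE// indic_fubini_tonelli_GE// /comp.
under eq_integral do rewrite /xsection.
move=> H; etransitivity; first last.
  etransitivity; first exact: H.
  apply: eq_integral => y _; congr (m1 _).
  by rewrite ysectionE.
apply: eq_integral => y _; congr (m2 _).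
by apply/seteqP; split => z /=; rewrite inE.
Qed.

End lebesgue_row_theory.

(** * Translation invariance of Lebesgue measure *)

Section lebesgue_row_invariance.
Context {R : realType}.
Local Notation lam := (@lebesgue_row R).

Lemma lebesgue_measure_translate (a : R) (A : set R) : measurable A ->
  lebesgue_measure [set x | A (x + a)] = lebesgue_measure A.
Proof.
have -> : lebesgue_measure [set x | A (x + a)] =
    pushforward (@lebesgue_measure R) (+%R^~ a : _ -> measurableTypeR R) A by [].
move=> mA; apply/esym/lebesgue_measure_unique => //=.
  by apply: measurable_funD.
move=> mf _ [[b c]] _ <-; rewrite /pushforward.
rewrite (_ : _ @^-1` _ = `]b - a, c - a]%classic); last first.
  by apply/seteqP; split => x /=; rewrite !in_itv/= ltrBlDr lerBrDr.
rewrite !lebesgue_measure_itv/= !lte_fin ltrD2r -!EFinB.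
by case: ifP => // _; congr EFin; ring.
Qed.

Lemma lebesgue_row_consE n (A : set 'rV[R]_n.+1) : measurable A ->
  lam n.+1 A = (\int[lebesgue_measure]_a lam n [set x | A (row_cons (a, x))])%E.
Proof.
move=> mA; rewrite /=/lebesgue_step /pushforward.
rewrite /product_measure1/=; apply: eq_integral => a _ /=.
by congr (lebesgue_row n _); rewrite xsectionE.
Qed.

Lemma measurable_row_cons_preimage n (A : set 'rV[R]_n.+1) : measurable A ->
  measurable (row_cons (R := R) (n := n) @^-1` A).
Proof.
by move=> mA; rewrite -[X in measurable X]setTI; exact: measurable_row_cons.
Qed.

Lemma measurable_preimageT d1 d2 (T1 : measurableType d1)
    (T2 : measurableType d2) (f : T1 -> T2) (A : set T2) :
  measurable_fun [set: T1] f -> measurable A -> measurable (f @^-1` A).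
Proof. by move=> mf mA; rewrite -[X in measurable X]setTI; exact: mf. Qed.

(** Induction on the dimension: the slices with fixed first coordinate
    absorb the translation of the other coordinates, and after an exchange of
    the integrals the remaining slices absorb that of the first one. *)
Lemma lebesgue_row_translate n (v : 'rV[R]_n) (A : set 'rV[R]_n) :
  measurable A -> lam n [set x | A (x + v)] = lam n A.
Proof.
elim: n v A => [|n IHn] v A mA.
  congr (lam 0 _); apply/seteqP.
  by split=> x; rewrite /= (_ : x + v = x)//; apply/rowP => -[].
pose v0 := v ord0 ord0; pose v' := (row_uncons v).2.
have addE a x : row_cons (a, x) + v = row_cons (a + v0, x + v').
  apply/rowP => i; have [j ->|->] := unliftP ord0 i.
    by rewrite mxE !row_consS /= !mxE.
  by rewrite mxE !row_cons0.
have mT (w : 'rV[R]_n.+1) : measurable_fun setT (fun x : 'rV[R]_n.+1 => x + w).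
  by apply: measurable_rowD.
have mAv : measurable [set x | A (x + v)].
  exact: (measurable_preimageT (mT v) mA).
have slice (B : set 'rV[R]_n.+1) a :
    measurable B -> measurable [set x | B (row_cons (a, x))].
  move=> mB; apply: (measurable_preimageT _ mB).
  apply: (measurableT_comp (f := @row_cons R n)); first exact: measurable_row_cons.
  exact: measurable_pair1.
rewrite !lebesgue_row_consE//.
under eq_integral => a _.
  rewrite (_ : [set x | _] =
      [set x | [set y | A (row_cons (a + v0, y))] (x + v')]); last first.
    by apply/seteqP; split=> x /=; rewrite addE.
  rewrite IHn; last exact: slice.
  over.
have E (B : set (measurableTypeR R * 'rV[R]_n)) : measurable B ->
    (\int[@lebesgue_measure R]_a lam n [set x | B (a, x)] =
     \int[lam n]_x @lebesgue_measure R [set a | B (a, x)])%E.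
  exact: tonelli_sections.
have mcv0 : measurable_fun [set: R * 'rV[R]_n]
    (fun p => row_cons (p.1 + v0, p.2)).
  apply: (measurableT_comp (f := @row_cons R n)); first exact: measurable_row_cons.
  apply: measurable_fun_pair => //=; exact: measurable_funD.
rewrite (E _ (measurable_preimageT mcv0 mA)).
rewrite (E _ (measurable_row_cons_preimage mA)).
apply: eq_integral => x _ /=.
have mcx : measurable_fun [set: R] (fun a => row_cons (a, x)).
  apply: (measurableT_comp (f := @row_cons R n)); first exact: measurable_row_cons.
  exact: measurable_pair2.
exact: (lebesgue_measure_translate v0 (measurable_preimageT mcx mA)).
Qed.

End lebesgue_row_invariance.

(** * Lebesgue measure under linear maps *)

Section lebesgue_row_linear.
Context {R : realType}.
Local Notation lam := (@lebesgue_row R).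

Definition box n (a : 'I_n -> R) : set 'rV[R]_n :=
  [set x | forall i, 0 <= x ord0 i <= a i].

Lemma measurable_ler d (T : measurableType d) (f g : T -> R) :
  measurable_fun [set: T] f -> measurable_fun [set: T] g ->
  measurable [set t | f t <= g t].
Proof.
move=> mf mg; rewrite (_ : [set t | _] = (fun t => f t <= g t) @^-1` [set true]).
  by apply: measurable_preimageT => //; exact: measurable_fun_ler.
by apply/seteqP; split => t /=; [move=> ->|].
Qed.

Lemma measurable_box n (a : 'I_n -> R) : measurable (box a).
Proof.
rewrite (_ : box a = \bigcap_(i in [set: 'I_n])
    ([set x | 0 <= x ord0 i] `&` [set x | x ord0 i <= a i])).
  apply: fin_bigcap_measurable => // i _; apply: measurableI.
    by apply: measurable_ler => //; exact: measurable_coor.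
  by apply: measurable_ler => //; exact: measurable_coor.
apply/seteqP; split => x /= Hx i.
  by move=> _; have /andP[] := Hx i; split.
by have [/= -> ->] := Hx i I.
Qed.

Lemma lebesgue_row_box n (a : 'I_n -> R) : (forall i, 0 <= a i) ->
  lam n (box a) = (\prod_i a i)%:E.
Proof.
elim: n a => [|n IHn] a a0.
  rewrite big_ord0 /= /dirac indicE mem_set// => i.
  by case: i.
rewrite lebesgue_row_consE; last exact: measurable_box.
under eq_integral => b _.
  rewrite (_ : lam n _ =
      ((\prod_i a (lift ord0 i))%:E * (\1_(`[0, a ord0]%classic) b)%:E)%E).
    over.
  rewrite indicE; have [b0|b0] := boolP (b \in _).
    rewrite mule1 -IHn//; congr (lam n _); apply/seteqP; split => x /= xa i.
      by have := xa (lift ord0 i); rewrite row_consS.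
    have [j ->|->] := unliftP ord0 i; first by rewrite row_consS.
    by move: b0; rewrite inE row_cons0/= in_itv.
  rewrite mule0 (_ : [set x | _] = set0) ?measure0//.
  apply/seteqP; split => x //= xa; move/negP: b0; apply.
  by rewrite inE/= in_itv/=; have := xa ord0; rewrite row_cons0.
rewrite ge0_integralZl//; last first.
- by rewrite lee_fin prodr_ge0.
- by apply/measurable_EFinP; exact: measurable_indic.
rewrite integral_indic// setIT.
rewrite [X in (_ * X)%E](_ : _ = (a ord0)%:E); last first.
  transitivity (if 0%:E < (a ord0)%:E then (a ord0)%:E - 0%:E else 0)%E.
    exact: (lebesgue_measure_itv `[0, a ord0]%R).
  rewrite lte_fin; case: ltP => [_|]; first by rewrite sube0.
  by move=> a00; congr EFin; apply: le_anti; rewrite a00 a0.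
by rewrite big_ord_recl [in RHS]mulrC EFinM.
Qed.

Lemma measurable_mulmx_preimage n (M : 'M[R]_n) (A : set 'rV[R]_n) :
  measurable A -> measurable [set x | A (x *m M)].
Proof.
have mf : measurable_fun setT (fun x : 'rV[R]_n => x *m M).
  by apply: measurable_rowM; exact: measurable_id.
by move=> mA; exact: (measurable_preimageT mf mA).
Qed.

(** The uniqueness of translation-invariant measures, for the image of
    Lebesgue measure under a linear map. Both sides are the measure of the set
    of the (x, y) with A (x M + y) and B y: for fixed y the translation of x
    by y M^-1 gives the left-hand side; for fixed x the translation of y by
    x M, followed by one of x, gives the right-hand side. *)
Lemma lebesgue_row_mulmx_swap n (M : 'M[R]_n) (A B : set 'rV[R]_n) :
  M \in unitmx -> measurable A -> measurable B ->
  (lam n [set x | A (x *m M)] * lam n B =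
   lam n [set x | B (- (x *m M))%R] * lam n A)%E.
Proof.
move=> uM mA mB.
have mNM : measurable_fun setT (fun x : 'rV[R]_n => - (x *m M)).
  apply: measurable_rowN; apply: measurable_rowM; exact: measurable_id.
have mE1 : measurable [set p : 'rV[R]_n * 'rV[R]_n | A (p.1 *m M + p.2) /\ B p.2].
  apply: measurableI; last exact: (measurable_preimageT (@measurable_snd _ _ _ _) mB).
  apply: (measurable_preimageT (f := fun p : 'rV[R]_n * 'rV[R]_n => p.1 *m M + p.2) _ mA).
  by apply: measurable_rowD => //; exact: measurable_rowM.
have mE2 : measurable [set p : 'rV[R]_n * 'rV[R]_n | A p.2 /\ B (p.2 - p.1 *m M)].
  apply: measurableI; first exact: (measurable_preimageT (@measurable_snd _ _ _ _) mA).
  apply: (measurable_preimageT (f := fun p : 'rV[R]_n * 'rV[R]_n => p.2 - p.1 *m M) _ mB).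
  by apply: measurable_rowB => //; exact: measurable_rowM.
have indE (C : set 'rV[R]_n) c : measurable C -> (0 <= c)%E ->
    (\int[lam n]_y (c * (\1_C y)%:E) = c * lam n C)%E.
  move=> mC c0; rewrite ge0_integralZl//.
    by rewrite integral_indic// setIT.
  by apply/measurable_EFinP; exact: measurable_indic.
rewrite -indE// -[RHS]indE//.
transitivity (\int[lam n]_y lam n [set x | A (x *m M + y)%R /\ B y])%E.
  apply: eq_integral => y _; rewrite indicE; have [By|By] := boolP (y \in B).
    rewrite mule1 -(lebesgue_row_translate (y *m invmx M)); last first.
      exact: measurable_mulmx_preimage.
    congr (lam n _); apply/seteqP; split=> x /=; rewrite mulmxDl mulmxKV//.
    - by split => //; rewrite inE in By.
    - by case.
  rewrite mule0 (_ : [set x | _] = set0) ?measure0//.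
  by apply/seteqP; split => x //= -[_ By']; move/negP: By; apply; rewrite inE.
rewrite -(tonelli_sections (lam n) (lam n) mE1).
transitivity (\int[lam n]_x lam n [set y | A y /\ B (y - x *m M)%R])%E.
  apply: eq_integral => x _.
  rewrite -[RHS](lebesgue_row_translate (x *m M)).
    congr (lam n _); apply/seteqP; split=> y /=.
      by rewrite addrK addrC.
    by rewrite addrK addrC.
  apply: measurableI => //.
  apply: (measurable_preimageT (f := fun y : 'rV[R]_n => y - x *m M) _ mB).
  by apply: measurable_rowB.
rewrite (tonelli_sections (lam n) (lam n) mE2); apply: eq_integral => y _ /=.
rewrite indicE; have [Ay|Ay] := boolP (y \in A).
  rewrite mule1 -[RHS](lebesgue_row_translate (- (y *m invmx M))); last first.
    exact: (measurable_preimageT mNM mB).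
  congr (lam n _); apply/seteqP; split => x /=; rewrite mulmxBl mulmxKV// opprB.
    by case.
  by split => //; rewrite inE in Ay.
rewrite mule0 (_ : [set x | _] = set0) ?measure0//.
by apply/seteqP; split => x //= -[Ay' _]; move/negP: Ay; apply; rewrite inE.
Qed.

(** In the exchange identity take for B the set that x |-> - x M pulls back
    to the unit cube: the constant is the inverse of the measure of B. *)
Lemma lebesgue_row_unitmx n (M : 'M[R]_n) : M \in unitmx ->
  exists2 c : R, 0 < c & forall A, measurable A ->
    lam n [set x | A (x *m M)] = (c%:E * lam n A)%E.
Proof.
move=> uM; pose Q := @box n (fun=> 1); have mQ : measurable Q by exact: measurable_box.
have Q1 : lam n Q = 1%E by rewrite lebesgue_row_box// big1.
pose B := [set y | Q (- (y *m invmx M))].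
have mB : measurable B.
  apply: (measurable_preimageT (f := fun y : 'rV[R]_n => - (y *m invmx M)) _ mQ).
  by apply: measurable_rowN; exact: measurable_rowM.
have AB A : measurable A -> (lam n [set x | A (x *m M)] * lam n B = lam n A)%E.
  move=> mA; rewrite lebesgue_row_mulmx_swap// /B/=.
  under eq_set do rewrite mulNmx mulmxK// opprK.
  by rewrite (_ : [set x | _] = Q)// Q1 mul1e.
have [b b0 Bb] : exists2 b : R, 0 < b & lam n B = b%:E.
  have := AB _ mQ; rewrite Q1.
  have : (0 <= lam n B)%E by exact: measure_ge0.
  have : (0 <= lam n [set x | Q (x *m M)])%E by exact: measure_ge0.
  move: (lam n B) (lam n [set x | _]) => [b||]// a a0 b0 ab1.
    exists b => //; rewrite lt_def -lee_fin b0 andbT; apply/eqP => b0'.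
    by move: ab1; rewrite b0' mule0 => /eqP; rewrite eqe eq_sym oner_eq0.
  have [a00|a00] := eqVneq a 0%E.
    by move: ab1; rewrite a00 mul0e => /eqP; rewrite eqe eq_sym oner_eq0.
  by move: ab1; rewrite gt0_muley// lt_def a00.
exists b^-1; first by rewrite invr_gt0.
move=> A mA; rewrite -(AB _ mA) Bb muleC -muleA -EFinM divff ?mule1//.
by rewrite gt_eqF.
Qed.

(** The constant is found on the box that the map pulls back to the unit
    cube. *)
Lemma lebesgue_row_diag n (a : 'rV[R]_n) (A : set 'rV[R]_n) :
  (forall i, 0 < a ord0 i) -> measurable A ->
  lam n [set x | A (x *m diag_mx a)] = ((\prod_i a ord0 i)^-1%:E * lam n A)%E.
Proof.
move=> a0 mA.
have p0 : 0 < \prod_i a ord0 i by apply: prodr_gt0.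
have uD : diag_mx a \in unitmx by rewrite unitmxE det_diag unitfE gt_eqF.
have [c c0 cE] := lebesgue_row_unitmx uD; rewrite cE//; congr (_%:E * _)%E.
have := cE _ (measurable_box (fun i => a ord0 i)).
rewrite lebesgue_row_box => [|i]; last exact: ltW.
rewrite (_ : [set x | _] = box (fun=> 1)); last first.
  apply/seteqP; split => x /= xa i; have := xa i; rewrite mul_mx_diag mxE.
    by rewrite pmulr_lge0// ger_pMl//.
  by rewrite pmulr_lge0// ger_pMl//.
rewrite lebesgue_row_box => [|i //]; rewrite big1// => -[] H.
by apply: (mulIf (lt0r_neq0 p0)); rewrite -H mulVf// gt_eqF.
Qed.

(** The constants of Q and of its inverse cancel. *)
Lemma lebesgue_row_diagonalizable n (Q M : 'M[R]_n) (a : 'rV[R]_n)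
    (A : set 'rV[R]_n) :
  Q \in unitmx -> Q *m M = diag_mx a *m Q -> (forall i, 0 < a ord0 i) ->
  measurable A ->
  lam n [set x | A (x *m M)] = ((\prod_i a ord0 i)^-1%:E * lam n A)%E.
Proof.
move=> uQ QM a0 mA.
have [c c0 cE] := lebesgue_row_unitmx uQ.
have uQ' : invmx Q \in unitmx by rewrite unitmx_inv.
have [c' c0' cE'] := lebesgue_row_unitmx uQ'.
have cc' : c' * c = 1.
  have mQ := measurable_box (fun=> 1 : R) (n := n).
  have := cE' _ (measurable_mulmx_preimage Q mQ); rewrite cE//.
  rewrite (_ : [set x | _] = box (fun=> 1)).
    rewrite lebesgue_row_box => [|i //]; rewrite big1// => -[].
    by rewrite mulr1.
  by apply/funext => x; rewrite /mkset mulmxKV.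
have mA1 := measurable_mulmx_preimage Q mA.
have mA2 := measurable_mulmx_preimage (diag_mx a) mA1.
have := cE' _ mA2; rewrite lebesgue_row_diag// cE//.
rewrite (_ : [set x | _] = [set x | A (x *m M)]); last first.
  by apply/seteqP; split=> x /=; rewrite -mulmxA -QM mulmxA mulmxKV.
move=> ->; rewrite !muleA -!EFinM mulrAC; congr (_%:E * _)%E.
by rewrite cc' mul1r.
Qed.

Lemma lebesgue_row_scale n (a : R) (A : set 'rV[R]_n) : 0 < a -> measurable A ->
  lam n [set x | A (a *: x)] = ((a ^+ n)^-1%:E * lam n A)%E.
Proof.
move=> a0 mA; have := @lebesgue_row_diag n (const_mx a) A.
rewrite diag_const_mx => H.
under eq_set do rewrite -mul_mx_scalar.
rewrite H// => [|i]; last by rewrite mxE.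
by under eq_bigr do rewrite mxE; rewrite prodr_const card_ord.
Qed.

Definition cball n (c : 'rV[R]_n) (r : R) : set 'rV[R]_n :=
  [set x | enorm (x - c) <= r].

Lemma measurable_cball n (c : 'rV[R]_n) r : measurable (cball c r).
Proof.
apply: measurable_ler => //; apply: measurable_enorm.
exact: measurable_rowB.
Qed.

Lemma eballE n : @eball R n = cball 0 1.
Proof. by apply/seteqP; split => x; rewrite /cball/eball/= subr0. Qed.

Lemma measurable_eball n : measurable (@eball R n).
Proof. by rewrite eballE; exact: measurable_cball. Qed.

Definition ball_volume n : R := fine (lam n (@eball R n)).
Local Notation kap := ball_volume.

Lemma lebesgue_row_eball n : lam n (@eball R n) = (kap n)%:E.
Proof.
rewrite /kap fineK// ge0_fin_numE//.
pose v : 'rV[R]_n := const_mx 1.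
have mb := @measurable_box n (fun=> 2).
have mv : measurable_fun setT (fun x : 'rV[R]_n => x + v) by exact: measurable_rowD.
apply: (@le_lt_trans _ _ (lam n [set x | box (fun=> 2) (x + v)])).
  apply: le_measure; rewrite ?inE.
  - exact: measurable_eball.
  - exact: (measurable_preimageT mv mb).
  move=> x xb i /=; rewrite /eball/= in xb; have := coord_le_enorm x i; rewrite !mxE.
  by move=> /le_trans /(_ xb); rewrite ler_norml; lra.
by rewrite lebesgue_row_translate// lebesgue_row_box ?ltry.
Qed.

Lemma ball_volume_gt0 n : 0 < kap n.
Proof.
have e0 : 0 < (n.+1%:R)^-1 :> R by rewrite invr_gt0.
rewrite -lte_fin -lebesgue_row_eball.
apply: (@lt_le_trans _ _ (lam n (box (fun=> (n.+1%:R)^-1)))).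
  rewrite lebesgue_row_box => [|i]; last exact: ltW.
  by rewrite lte_fin prodr_gt0.
apply: le_measure; rewrite ?inE; [exact: measurable_box|exact: measurable_eball|].
move=> x xb; rewrite /eball/=; apply: (le_trans (@enorm_le_coord _ _ _ (n.+1%:R)^-1 _)).
  by move=> i; have /andP[x0 x1] := xb i; rewrite ger0_norm.
by rewrite ler_pdivrMl ?ltr0n// mulr1 ler_nat.
Qed.

Lemma lebesgue_row_cball n (c : 'rV[R]_n) r : 0 < r ->
  lam n (cball c r) = (r ^+ n * kap n)%:E.
Proof.
move=> r0; rewrite -(lebesgue_row_translate c); last exact: measurable_cball.
have := lebesgue_row_scale (A := [set x | cball c r (x + c)]) r0.
rewrite (_ : [set x | _ (r *: x)] = @eball R n); last first.
  apply/seteqP; split=> x; rewrite /cball/eball/= addrK enormZ gtr0_norm//.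
    by rewrite ger_pMr.
  by rewrite ger_pMr.
rewrite lebesgue_row_eball => H; rewrite EFinM H.
  by rewrite muleA -EFinM divff ?mul1e// gt_eqF// exprn_gt0.
apply: (measurable_preimageT (f := fun x : 'rV[R]_n => x + c) _ (measurable_cball c r)).
exact: measurable_rowD.
Qed.

End lebesgue_row_linear.

(** * Polytopes and nearest points *)

Section hull.
Context {R : realType}.

Definition simplex N : set 'rV[R]_N :=
  [set w | (forall i, 0 <= w ord0 i) /\ \sum_i w ord0 i = 1].

Definition barycenter N n (x : 'I_N -> 'rV[R]_n) (w : 'rV[R]_N) : 'rV[R]_n :=
  \sum_i w ord0 i *: x i.

Definition hull N n (x : 'I_N -> 'rV[R]_n) : set 'rV[R]_n :=
  [set barycenter x w | w in @simplex N].

Lemma convex_setE n (A : set 'rV[R]_n) :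
  convex_set (A : set (convex_lmodType 'rV[R]_n)) <->
  forall x y (a : R), 0 <= a <= 1 -> A x -> A y -> A (a *: x + (1 - a) *: y).
Proof.
split => [cA x y a a01 Ax Ay|cA x y l].
  pose l : {i01 R} := Itv01 (andP a01).1 (andP a01).2.
  by have := cA x y l (mem_set Ax) (mem_set Ay); rewrite inE.
rewrite !inE => Ax Ay; apply: cA => //.
by rewrite ge0 le1.
Qed.

Lemma barycenterD N n (x : 'I_N -> 'rV[R]_n) w w' :
  barycenter x (w + w') = barycenter x w + barycenter x w'.
Proof. by rewrite -big_split; apply: eq_bigr => i _; rewrite mxE scalerDl. Qed.

Lemma barycenterZ N n (x : 'I_N -> 'rV[R]_n) a w :
  barycenter x (a *: w) = a *: barycenter x w.
Proof. by rewrite scaler_sumr; apply: eq_bigr => i _; rewrite mxE scalerA. Qed.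

Lemma simplex_convex N (w w' : 'rV[R]_N) a : 0 <= a <= 1 ->
  simplex w -> simplex w' -> simplex (a *: w + (1 - a) *: w').
Proof.
move=> /andP[a0 a1] [w0 w1] [w0' w1']; split=> [i|].
  by rewrite !mxE addr_ge0// mulr_ge0// subr_ge0.
under eq_bigr do rewrite !mxE.
by rewrite big_split/= -!mulr_sumr w1 w1'; ring.
Qed.

Lemma hull_convex N n (x : 'I_N -> 'rV[R]_n) p q a : 0 <= a <= 1 ->
  hull x p -> hull x q -> hull x (a *: p + (1 - a) *: q).
Proof.
move=> a01 [w sw <-] [w' sw' <-]; exists (a *: w + (1 - a) *: w').
  exact: simplex_convex.
by rewrite barycenterD !barycenterZ.
Qed.

Lemma mem_hull N n (x : 'I_N -> 'rV[R]_n) i : hull x (x i).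
Proof.
exists (\row_j (j == i)%:R).
  split=> [j|]; first by rewrite mxE ler0n.
  rewrite (bigD1 i)//= mxE eqxx big1 ?addr0// => j ji.
  by rewrite mxE (negbTE ji).
rewrite /barycenter (bigD1 i)//= mxE eqxx scale1r big1 ?addr0// => j ji.
by rewrite mxE (negbTE ji) scale0r.
Qed.

(** The weights are not normalized, so that the induction on the list of
    indices can remove one of them. *)
Lemma convex_combination N n (x : 'I_N -> 'rV[R]_n) (A : set 'rV[R]_n)
    (w : 'I_N -> R) (s : seq 'I_N) :
  (forall x y (a : R), 0 <= a <= 1 -> A x -> A y -> A (a *: x + (1 - a) *: y)) ->
  (forall i, A (x i)) -> (forall i, 0 <= w i) -> 0 < \sum_(i <- s) w i ->
  A ((\sum_(i <- s) w i)^-1 *: \sum_(i <- s) w i *: x i).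
Proof.
move=> cA Ax w0; elim: s => [|i s IHs]; first by rewrite big_nil ltxx.
rewrite !big_cons.
set W := \sum_(j <- s) w j; set X := \sum_(j <- s) w j *: x j => wW.
have W0 : 0 <= W by apply: sumr_ge0.
have [W0'|W0'] := eqVneq W 0.
  have -> : X = 0.
    move: W0'; rewrite /W /X => /eqP; rewrite psumr_eq0// => /allP /= ws.
    by rewrite big_seq big1// => j js; rewrite (eqP (ws j js)) scale0r.
  have wi : w i != 0 by rewrite W0' addr0 in wW; rewrite gt_eqF.
  by rewrite W0' !addr0 scalerA mulVf// scale1r.
have {}W0 : 0 < W by rewrite lt_def W0'.
have := cA (x i) (W^-1 *: X) (w i / (w i + W)) _ (Ax i) (IHs W0).
rewrite (_ : _ *: _ + _ = (w i + W)^-1 *: (w i *: x i + X)); last first.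
  rewrite scalerDr !scalerA [w i / _]mulrC; congr (_ + _ *: _).
  by field; rewrite W0'/= gt_eqF.
apply; apply/andP; split; first by rewrite divr_ge0// ltW.
by rewrite ler_pdivrMr// mul1r lerDl ltW.
Qed.

Lemma conv_hullE N n (x : 'I_N -> 'rV[R]_n) : conv_hull (range x) = hull x.
Proof.
apply/seteqP; split => p.
  apply; split; last by move=> _ [i _ <-]; exact: mem_hull.
  by apply/convex_setE => q r a; exact: hull_convex.
move=> [w [w0 w1] <-] C [/convex_setE cC xC].
have := @convex_combination N n x C (w ord0) (index_enum 'I_N) cC _ w0.
rewrite w1 invr1 scale1r; apply => // i; apply: xC.
by exists i.
Qed.

Lemma coord_continuousT N (i : 'I_N) : continuous (fun w : 'rV[R]_N => w ord0 i).
Proof. exact: coord_continuous. Qed.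

Lemma continuous_sum (T : topologicalType) (I : finType) (F : I -> T -> R) :
  (forall i, continuous (F i)) -> continuous (fun t => \sum_i F i t).
Proof.
by move=> cF; apply: continuous_big => [|i _]; [exact: add_continuous|exact: cF].
Qed.

Lemma simplex_compact N : compact (@simplex N).
Proof.
have cB : compact [set v : 'rV[R]_N | forall i, `[0, 1]%classic (v ord0 i)].
  apply: (@rV_compact _ N (fun=> `[(0 : R), 1]%classic)) => i.
  exact: segment_compact.
apply: subclosed_compact cB _.
  rewrite (_ : @simplex N = (\bigcap_(i in [set: 'I_N])
      ((fun w : 'rV[R]_N => w ord0 i) @^-1` [set r | 0 <= r])) `&`
      ((fun w : 'rV[R]_N => \sum_i w ord0 i) @^-1` [set 1])); last first.
    apply/seteqP; split => w [w0 w1]; split => //= i; last exact: w0.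
    by move=> _; exact: w0.
  apply: closedI.
    apply: closed_bigI => i _; apply: closed_comp; last exact: closed_ge.
    by move=> w _; exact: coord_continuous.
  apply: closed_comp; last exact: closed_eq.
  move=> w _; apply: continuous_sum => i; exact: coord_continuous.
move=> w [w0 w1] i /=; rewrite in_itv/= w0/= -w1 (bigD1 i)//= lerDl.
exact: sumr_ge0.
Qed.

Lemma continuous_distance_barycenter N n (x : 'I_N -> 'rV[R]_n) z :
  continuous (fun w => dot (z - barycenter x w) (z - barycenter x w)).
Proof.
have cj (j : 'I_n) : continuous (fun w : 'rV[R]_N => (z - barycenter x w) ord0 j).
  move=> w; rewrite (_ : (fun _ => _) =
      (fun w : 'rV[R]_N => z ord0 j - \sum_i w ord0 i * x i ord0 j)); last first.
    apply/funext => w'; rewrite !mxE summxE; congr (_ - _).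
    by apply: eq_bigr => i _; rewrite mxE.
  have cs : continuous (fun w : 'rV[R]_N => \sum_i w ord0 i * x i ord0 j).
    apply: continuous_sum => i w'.
    exact: cvgM (@coord_continuousT N i w') (cvg_cst _).
  exact: cvgB (cvg_cst _) (cs w).
apply: continuous_sum => j w; exact: cvgM (cj j w) (cj j w).
Qed.

(** A minimizer of the distance exists by compactness of the simplex of
    weights; the inequality is the first-order condition on the segments from
    the minimizer to the vertices. *)
Lemma nearest_point N n (x : 'I_N -> 'rV[R]_n) z : (0 < N)%N ->
  exists2 p, hull x p & forall i, dot (x i - p) (z - p) <= 0.
Proof.
move=> N0.
have s0 : @simplex N !=set0.
  by have [w sw _] := mem_hull (fun=> 0 : 'rV[R]_n) (Ordinal N0); exists w.
have [w] := EVT_min_rV s0 (@simplex_compact N)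
  (continuous_subspaceT (@continuous_distance_barycenter N n x z)).
rewrite inE => sw wmin; set p := barycenter x w in wmin.
have pmin q : hull x q -> dot (z - p) (z - p) <= dot (z - q) (z - q).
  by move=> [w' sw' <-]; apply: wmin; rewrite inE.
exists p; first by exists w.
move=> i; rewrite leNgt; apply/negP.
set c := dot _ _ => c0; pose D := dot (x i - p) (x i - p).
have D0 : 0 <= D by exact: dotxx_ge0.
have cD : 0 < c + D by rewrite ltr_pwDl.
(* A step a towards x i changes the squared distance to z by - a (2 c - a D),
   and a D <= c for this choice. *)
pose a := c / (c + D).
have a01 : 0 <= a <= 1.
  apply/andP; split; first by rewrite divr_ge0// ltW.
  by rewrite /a ler_pdivrMr// mul1r lerDl.
have a0 : 0 < a by rewrite divr_gt0.
have := pmin _ (hull_convex a01 (mem_hull x i) (ex_intro2 _ _ w sw erefl)).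
rewrite -/p (_ : z - (a *: x i + (1 - a) *: p) = (z - p) - a *: (x i - p)); last first.
  by rewrite scalerBl scalerBr scale1r; apply/rowP => j; rewrite !mxE; ring.
have dotBZ (u v : 'rV[R]_n) : dot (u - a *: v) (u - a *: v) =
    dot u u - a * (2 * dot v u - a * dot v v).
  by rewrite !(dotBl, dotBr, dotZl, dotZr) (dotC u v); ring.
rewrite dotBZ -/c -/D lerDl oppr_ge0 pmulr_rle0// subr_le0.
rewrite /a mulrAC ler_pdivlMr// -mulrA [leRHS]mulrC (mulrC 2) -mulrA.
rewrite mulrC; nra.
Qed.

End hull.

(** * Stretching an orthogonal complement *)

Section orthogonal_scaling.
Context {R : realType}.
Local Notation lam := (@lebesgue_row R).

Lemma dotE n (x y : 'rV[R]_n) : x *m y^T = (dot x y)%:M.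
Proof.
by apply/matrixP => i j; rewrite !ord1 !mxE mulr1n; apply: eq_bigr => l _; rewrite mxE.
Qed.

(** The first rows of Q span the row space of D, the last ones its
    orthogonal complement, which is the kernel of D^T. They are independent
    because a vector in both spaces is orthogonal to itself. *)
Lemma orthogonal_splitting N n (D : 'M[R]_(N, n)) :
  exists2 Q : 'M[R]_n, Q \in unitmx &
    (forall w : 'rV_n, (w <= D)%MS -> exists c : 'rV_n, w = c *m pid_mx (\rank D) *m Q) /\
    (forall u : 'rV_n, u *m D^T = 0 -> exists c : 'rV_n, u = c *m copid_mx (\rank D) *m Q).
Proof.
set m := \rank D; have mn : (m <= n)%N by exact: rank_leq_col.
pose U := row_ebase D; pose V := invmx (col_ebase D^T).
pose Q := pid_mx m *m U + copid_mx m *m V.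
have kerE : kermx D^T = copid_mx m *m V by rewrite /kermx mxrank_tr.
have pidQ : (pid_mx m : 'M[R]_n) *m Q = pid_mx m *m U.
  rewrite /Q mulmxDr !mulmxA mul_pid_mx_copid// mul0mx addr0.
  by rewrite pid_mx_id.
have copidQ : (copid_mx m : 'M[R]_n) *m Q = copid_mx m *m V.
  by rewrite /Q mulmxDr !mulmxA mul_copid_mx_pid// mul0mx add0r copid_mx_id.
exists Q; last split.
- rewrite -row_free_unit; apply: inj_row_free => v vQ.
  set y := v *m pid_mx m *m U.
  have yE : y = - (v *m copid_mx m *m V).
    by apply/eqP; rewrite -addr_eq0 /y -!mulmxA -mulmxDr vQ.
  have y0 : y = 0.
    apply: dotxx_eq0.
    have [C yD] : exists C, y = C *m D.
      exists (v *m pid_mx m *m invmx (col_ebase D)).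
      transitivity (v *m pid_mx m *m invmx (col_ebase D) *m
          (col_ebase D *m pid_mx m *m row_ebase D)); last by rewrite mulmx_ebase.
      rewrite !mulmxA mulmxKV ?col_ebase_unit// -(mulmxA v) pid_mx_id//.
      exact: rank_leq_row.
    have : y *m D^T = 0.
      rewrite yE mulNmx -(mulmxA v) -kerE -mulmxA mulmx_ker mulmx0 oppr0//.
    move=> yD0; have : y *m y^T = 0.
      by rewrite {2}yD trmx_mul mulmxA yD0 mul0mx.
    by rewrite dotE => /matrixP /(_ ord0 ord0); rewrite !mxE mulr1n.
  have vp : v *m pid_mx m = 0 :> 'rV[R]_n.
    by rewrite -(mulmxK (row_ebase_unit D) (v *m _)) -/U -/y y0 mul0mx.
  have vc : v *m copid_mx m = 0.
    have uV : V \in unitmx by rewrite unitmx_inv col_ebase_unit.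
    rewrite -(mulmxK uV (v *m _)) -[X in X *m _]opprK -yE y0 oppr0 mul0mx//.
  by rewrite -(mulmx1 v) -(subrK (pid_mx m) 1%:M) addrC mulmxDr vp vc addr0.
- move=> w /submxP[C ->]; exists (C *m col_ebase D *m pid_mx m).
  rewrite -(mulmxA _ _ Q) pidQ.
  transitivity (C *m (col_ebase D *m pid_mx m *m row_ebase D)).
    by rewrite mulmx_ebase.
  by rewrite !mulmxA -(mulmxA _ (pid_mx m) (pid_mx m)) pid_mx_id.
- move=> u /eqP; rewrite -sub_kermx kerE => /submxP[C ->]; exists C.
  by rewrite -(mulmxA C _ Q) copidQ.
Qed.

(** M t is the identity on the row space of D and the multiplication by t on
    its orthogonal complement; it is diagonal in the basis of an orthogonal
    splitting. In particular M 0 is the orthogonal projection. *)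
Lemma orthogonal_scaling N n (D : 'M[R]_(N, n)) :
  exists M : R -> 'M[R]_n,
  [/\ forall t (w : 'rV_n), (w <= D)%MS -> w *m M t = w,
      forall t (u : 'rV_n), u *m D^T = 0 -> u *m M t = t *: u,
      forall t, 0 < t -> M t \in unitmx &
      forall t A, 0 < t -> measurable A ->
        lam n [set x | A (x *m M t)] = ((t ^+ (n - \rank D))^-1%:E * lam n A)%E].
Proof.
have [Q uQ [QD QD']] := orthogonal_splitting D.
set m := \rank D in QD QD' *; have mn : (m <= n)%N by exact: rank_leq_col.
pose d t : 'rV[R]_n := \row_i (if (i < m)%N then 1 else t).
have d0 t i : 0 < t -> 0 < d t ord0 i by move=> t0; rewrite mxE; case: ifP.
have dE t : diag_mx (d t) = pid_mx m + t *: copid_mx m.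
  apply/matrixP => i j; rewrite !mxE.
  case: (eqVneq i j) => [->|ij]; last first.
    by rewrite -val_eqE/= in ij; rewrite (negbTE ij)/= subr0 mulr0 addr0.
  by rewrite eqxx/= mulr1n; case: ifP => jm /=; ring.
pose M t := invmx Q *m diag_mx (d t) *m Q.
have uD t : 0 < t -> diag_mx (d t) \in unitmx.
  move=> t0; rewrite unitmxE det_diag unitfE gt_eqF//.
  by apply: prodr_gt0 => i _; exact: d0.
exists M; split.
- move=> t w /QD[c ->]; rewrite /M !mulmxA mulmxK// dE mulmxDr -scalemxAr.
  by rewrite -!(mulmxA c) pid_mx_id// mul_pid_mx_copid// mulmx0 scaler0 addr0 mulmxA.
- move=> t u /QD'[c ->]; rewrite /M !mulmxA mulmxK// dE mulmxDr -scalemxAr.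
  by rewrite -!(mulmxA c) copid_mx_id// mul_copid_mx_pid// mulmx0 add0r -scalemxAl mulmxA.
- by move=> t t0; rewrite /M !unitmx_mul unitmx_inv uQ (uD t t0).
- move=> t A t0 mA; rewrite (lebesgue_row_diagonalizable (Q := Q) (a := d t))//.
  + congr ((_^-1)%:E * _)%E.
    under eq_bigr do rewrite mxE.
    rewrite -(big_mkord xpredT (fun i => if (i < m)%N then 1 else t)).
    rewrite (big_cat_nat (leq0n m) mn)//= [X in X * _]big_nat big1 => [|i /andP[_ ->]//].
    rewrite mul1r big_nat (eq_bigr (fun=> t)) => [|i /andP[mi _]]; last first.
      by rewrite ltnNge mi.
    by rewrite -big_nat prodr_const_nat.
  + by rewrite /M mulmxA mulmxA mulmxV// mul1mx.
  + by move=> i; exact: d0.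
Qed.

End orthogonal_scaling.

(** * Cells of the complement of a polytope *)

Section steiner_polytope.
Context {R : realType}.
Local Notation lam := (@lebesgue_row R).
Local Notation kap := (@ball_volume R).

Lemma dot_hull N n (x : 'I_N -> 'rV[R]_n) p u (b : R) :
  hull x p -> (forall i, dot (x i) u <= b) -> dot p u <= b.
Proof.
move=> [w [w0 w1] <-] xb; rewrite dot_sumr -[b]mul1r -w1 mulr_suml.
by apply: ler_sum => i _; exact: ler_wpM2l.
Qed.

Lemma enorm_hull N n (x : 'I_N -> 'rV[R]_n) p (r : R) :
  (forall i, enorm (x i) <= r) -> hull x p -> enorm p <= r.
Proof.
move=> xr [w [w0 w1] <-]; rewrite /barycenter.
apply: (@le_trans _ _ (\sum_i enorm (w ord0 i *: x i))).
  elim/big_ind2 : _ => [|a a' c c' H H'|//]; first by rewrite enorm0.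
  by apply: le_trans (enormD _ _) _; exact: lerD.
rewrite -[r]mul1r -w1 mulr_suml; apply: ler_sum => i _.
by rewrite enormZ ger0_norm// ler_wpM2l.
Qed.

Lemma rational_approx n (u : 'rV[R]_n) (e : R) : 0 < e ->
  exists q : 'rV[rat]_n, enorm (map_mx ratr q - u) <= e * n%:R.
Proof.
move=> e0.
have H i : exists q : rat, `|ratr q - u ord0 i| <= e.
  have : u ord0 i - e < u ord0 i + e by lra.
  move=> /rat_in_itvoo[q]; rewrite in_itv/= => /andP[q1 q2].
  by exists q; rewrite ler_norml; apply/andP; split; lra.
have [f fE] := choice H.
exists (\row_i f i); apply: enorm_le_coord => i.
by rewrite !mxE.
Qed.

(** A polytope is the intersection of the countably many half-spaces with
    rational normal vectors that contain it. *)
Lemma measurable_hull N n (x : 'I_N -> 'rV[R]_n) : (0 < N)%N ->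
  measurable (hull x).
Proof.
move=> N0.
pose H (q : 'rV[rat]_n) : set 'rV[R]_n := \bigcup_(i in [set: 'I_N])
  [set z | dot z (map_mx ratr q) <= dot (x i) (map_mx ratr q)].
have mH q : measurable (H q).
  apply: fin_bigcup_measurable => // i _.
  by apply: measurable_ler => //; exact: measurable_dot.
suff -> : hull x = ~` (\bigcup_q ~` H q).
  apply: measurableC; apply: countable_bigcupT_measurable => // q.
  exact: measurableC.
rewrite setC_bigcup; apply/seteqP; split => [z [w [w0 w1] <-] q _|z Hz].
  rewrite setCK; pose g : 'rV[R]_n := map_mx ratr q.
  apply: contrapT => H'.
  have {H'} xz i : dot (x i) g < dot (barycenter x w) g.
    by rewrite ltNge; apply/negP => ?; apply: H'; exists i.
  have /eqP : \sum_i w ord0 i * (dot (barycenter x w) g - dot (x i) g) = 0.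
    under eq_bigr do rewrite mulrBr.
    by rewrite sumrB -mulr_suml w1 mul1r -dot_sumr subrr.
  rewrite psumr_eq0 => [|i _]; last by rewrite mulr_ge0// subr_ge0 ltW.
  move=> /allP/= w00; move: w1; rewrite big1 => [/esym/eqP|i _].
    by rewrite oner_eq0.
  have := w00 i (mem_index_enum _); rewrite mulf_eq0 => /orP[/eqP//|].
  by rewrite subr_eq0 gt_eqF.
have [p hp pz] := nearest_point x z N0.
have [/eqP u0|u0] := eqVneq (z - p) 0.
  by move: u0; rewrite subr_eq0 => /eqP ->.
exfalso.
pose u := z - p; pose B := 1 + \sum_i enorm (z - x i).
have B0 : 0 < B by rewrite ltr_pwDl// sumr_ge0// => i _; exact: enorm_ge0.
have uu0 : 0 < dot u u.
  rewrite lt_def dotxx_ge0 andbT; apply/eqP => /dotxx_eq0 H0.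
  by move/eqP : u0.
pose e := dot u u / (B * n.+1%:R).
have e0 : 0 < e by rewrite divr_gt0// mulr_gt0.
have [q qu] := rational_approx u e0.
have := Hz q I; rewrite setCK => -[i _ /=]; pose g : 'rV[R]_n := map_mx ratr q.
rewrite -/g in qu *.
rewrite leNgt => /negP; apply.
have zu : dot u u <= dot (z - x i) u.
  rewrite -subr_ge0 -dotBl (_ : z - x i - u = - (x i - p)).
    by rewrite dotNl oppr_ge0.
  by rewrite /u; apply/rowP => j; rewrite !mxE; ring.
have := dot_le_enorm (- (z - x i)) (g - u); rewrite enormN dotNl dotBr => zg.
have zB : enorm (z - x i) <= B.
  rewrite /B (bigD1 i)//=; have : 0 <= \sum_(j | j != i) enorm (z - x j).
    by apply: sumr_ge0 => j _; exact: enorm_ge0.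
  by lra.
have : enorm (z - x i) * enorm (g - u) < dot u u.
  apply: (@le_lt_trans _ _ (B * (e * n%:R))).
    by apply: ler_pM => //; exact: enorm_ge0.
  rewrite /e (_ : B * _ = dot u u * (n%:R / n.+1%:R)); last first.
    have fld (a b c m : R) : b != 0 -> c != 0 -> b * (a / (b * c) * m) = a * (m / c).
      by move=> b0 c0; field; apply/andP; split.
    by apply: fld; rewrite gt_eqF// ltr0n.
  by rewrite gtr_pMr// ltr_pdivrMr ?ltr0n// mul1r ltr_nat.
move=> zgu; rewrite -subr_gt0 -dotBl; lra.
Qed.

(** The points whose nearest point in the polytope is at distance at most t,
    and whose outer normal vector there is maximized exactly at the
    vertices J. *)
Definition cell N n (x : 'I_N -> 'rV[R]_n) (J : {set 'I_N}) (t : R) :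
    set 'rV[R]_n :=
  [set z | exists p, [/\ hull x p,
    forall i, i \in J -> dot (x i - p) (z - p) = 0,
    forall i, i \notin J -> dot (x i - p) (z - p) < 0 &
    enorm (z - p) <= t]].

Lemma cell_le N n (x : 'I_N -> 'rV[R]_n) (J : {set 'I_N}) p z :
  (forall i, i \in J -> dot (x i - p) (z - p) = 0) ->
  (forall i, i \notin J -> dot (x i - p) (z - p) < 0) ->
  forall q, hull x q -> dot (q - p) (z - p) <= 0.
Proof.
move=> pJ pJ' q hq; rewrite dotBl subr_le0; apply: dot_hull hq _ => i.
rewrite -subr_le0 -dotBl; have [iJ|iJ] := boolP (i \in J).
  by rewrite pJ.
by rewrite ltW// pJ'.
Qed.

(** The nearest point is unique, hence so is the set of the vertices that are
    extremal in the normal direction. *)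
Lemma trivIset_cell N n (x : 'I_N -> 'rV[R]_n) t : trivIset setT (cell x ^~ t).
Proof.
move=> J J' _ _ [z [[p [hp pJ pJ' _]] [p' [hp' p'J p'J' _]]]].
have pp' : p = p'.
  apply/eqP; rewrite -subr_eq0; apply/eqP; apply: dotxx_eq0.
  apply/eqP; rewrite eq_le dotxx_ge0 andbT.
  have := cell_le pJ pJ' hp'; have := cell_le p'J p'J' hp.
  rewrite (_ : dot (p - p') (p - p') =
    dot (p - p') (z - p') + dot (p' - p) (z - p)); first by lra.
  rewrite -(opprB p p') dotNl -dotBr; congr dot.
  by apply/rowP => j; rewrite !mxE; ring.
subst p'; apply/setP => i.
have [iJ|iJ] := boolP (i \in J); have [iJ'|iJ'] := boolP (i \in J') => //.
  by have := p'J' i iJ'; rewrite pJ// ltxx.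
by have := pJ' i iJ; rewrite p'J// ltxx.
Qed.

(** Complementary slackness: p is an average of vertices of which the inner
    products with z - p are at most that of p, so that those where it is
    smaller have weight 0. *)
Lemma cell_active N n (x : 'I_N -> 'rV[R]_n) (J : {set 'I_N}) p z w :
  simplex w -> barycenter x w = p ->
  (forall i, i \in J -> dot (x i - p) (z - p) = 0) ->
  (forall i, i \notin J -> dot (x i - p) (z - p) < 0) ->
  forall i, i \notin J -> w ord0 i = 0.
Proof.
move=> [w0 w1] wp pJ pJ' i iJ.
have /eqP : \sum_i w ord0 i * dot (p - x i) (z - p) = 0.
  under eq_bigr do rewrite dotBl mulrBr.
  by rewrite sumrB -mulr_suml w1 mul1r -dot_sumr -/(barycenter x w) wp subrr.
have px j : 0 <= dot (p - x j) (z - p).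
  rewrite -(opprB (x j)) dotNl oppr_ge0.
  by have [/pJ -> //|/pJ' /ltW] := boolP (j \in J).
rewrite psumr_eq0 => [/allP/= /(_ i (mem_index_enum _))|j _]; last exact: mulr_ge0.
rewrite mulf_eq0 => /orP[/eqP //|].
by rewrite -(opprB (x i)) dotNl oppr_eq0 lt_eqF// pJ'.
Qed.

Lemma parallel_body_cells N n (x : 'I_N -> 'rV[R]_n) t : (0 < N)%N -> 0 <= t ->
  [set p + t *: y | p in hull x & y in @eball R n] =
  \bigcup_(J in [set: {set 'I_N}]) cell x J t.
Proof.
move=> N0 t0; apply/seteqP; split => z.
  move=> [q hq [y yB <-]]; set z' := q + t *: y.
  have [p hp pz] := nearest_point x z' N0.
  exists [set i | dot (x i - p) (z' - p) == 0]%SET => //; exists p; split => //.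
  - by move=> i; rewrite inE => /eqP.
  - by move=> i; rewrite inE lt_neqAle pz andbT.
  - have pq : dot (q - p) (z' - p) <= 0.
      rewrite dotBl subr_le0; apply: dot_hull hq _ => i.
      by rewrite -subr_le0 -dotBl.
    have zq : enorm (z' - q) <= t.
      by rewrite /z' addrAC subrr add0r enormZ ger0_norm// ler_piMr.
    apply: le_trans zq; rewrite enorm_le ?enorm_ge0// sqr_enorm.
    rewrite (_ : z' - q = (z' - p) - (q - p)); last first.
      by apply/rowP => j; rewrite !mxE; ring.
    move: (z' - p) (q - p) pq => u v uv.
    rewrite [leRHS](_ : _ = dot u u + (dot v v - 2 * dot v u)); last first.
      by rewrite !(dotBl, dotBr) (dotC u v); ring.
    by have := dotxx_ge0 v; lra.
move=> [J _ [p [hp _ _ pz]]]; exists p => //.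
have [t00|t00] := eqVneq t 0.
  exists 0; first by rewrite /eball/= enorm0.
  rewrite scaler0 addr0; apply/esym/eqP; rewrite -subr_eq0; apply/eqP.
  by apply: enorm_eq0; apply: le_anti; rewrite enorm_ge0 -t00 pz.
exists (t^-1 *: (z - p)); last by rewrite scalerA divff// scale1r addrC subrK.
rewrite /eball/= enormZ ger0_norm ?invr_ge0// ler_pdivrMl ?mulr1//.
by rewrite lt_def t00.
Qed.

Lemma cell_finite N n (x : 'I_N -> 'rV[R]_n) J t :
  measurable (cell x J t) -> (lam n (cell x J t) < +oo)%E.
Proof.
move=> mJ; pose r := 1 + (`|t| + \sum_i enorm (x i)).
have r0 : 0 < r.
  by rewrite ltr_pwDl// addr_ge0// sumr_ge0// => i _; exact: enorm_ge0.
apply: (@le_lt_trans _ _ (lam n (cball 0 r))).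
  apply: le_measure; rewrite ?inE//; first exact: measurable_cball.
  have xS i : enorm (x i) <= \sum_i enorm (x i).
    by rewrite (bigD1 i)//= lerDl sumr_ge0// => j _; exact: enorm_ge0.
  move=> z [p [hp _ _ pz]]; rewrite /cball/= subr0 -(subrK p z).
  apply: le_trans (enormD _ _) _; have := enorm_hull xS hp.
  by have := ler_norm t; rewrite /r; lra.
by rewrite lebesgue_row_cball// ltry.
Qed.

End steiner_polytope.

(** * Steiner's formula for polytopes *)

Section steiner_formula.
Context {R : realType}.
Local Notation lam := (@lebesgue_row R).
Local Notation kap := (@ball_volume R).

Lemma cell_set0 N n (x : 'I_N -> 'rV[R]_n) t : cell x finset.set0 t = set0.
Proof.
apply/seteqP; split => // z [p [[w sw wp] pJ pJ' _]].
have := cell_active sw wp pJ pJ'; case: sw => _ w1 w0.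
move: w1; rewrite big1 => [/esym/eqP|i _]; first by rewrite oner_eq0.
by rewrite w0// finset.in_set0.
Qed.

(** The codimension n - m is that of the affine hull of the vertices J. On
    the cell, the nearest point p is the orthogonal projection of z onto this
    affine hull, so that z |-> p + t (z - p) is the restriction of an affine
    map of determinant t^(n - m) and maps the part of the cell at distance at
    most 1 onto the part at distance at most t. The case t = 0 is a limit,
    unless n = m, where the normal directions are trivial. *)
Lemma cell_scaling N n (x : 'I_N -> 'rV[R]_n) (J : {set 'I_N}) : (0 < N)%N ->
  exists m, [/\ (m <= n)%N, forall t, measurable (cell x J t) &
    forall t, 0 <= t ->
      lam n (cell x J t) = ((t ^+ (n - m))%:E * lam n (cell x J 1))%E].
Proof.
move=> N0; have [->|/finset.set0Pn[j0 j0J]] := eqVneq J finset.set0.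
  by exists 0%N; split => // [t|t _]; rewrite !cell_set0 ?measure0 ?mule0.
pose a := x j0.
pose D : 'M[R]_(N, n) := \matrix_i (if i \in J then x i - a else 0).
have [M [MW MWT uM lamM]] := orthogonal_scaling D.
set m := \rank D in lamM; have mn : (m <= n)%N by exact: rank_leq_col.
have rowD i : i \in J -> row i D = x i - a by move=> iJ; rewrite rowK iJ.
have split_cell p z : hull x p ->
    (forall i, i \in J -> dot (x i - p) (z - p) = 0) ->
    (forall i, i \notin J -> dot (x i - p) (z - p) < 0) ->
    (p - a <= D)%MS /\ (z - p) *m D^T = 0.
  move=> [w sw wp] pJ pJ'; split.
    have w0 := cell_active sw wp pJ pJ'; case: sw => _ w1.
    rewrite (_ : p - a = \sum_i w ord0 i *: (x i - a)); last first.
      under eq_bigr do rewrite scalerBr.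
      by rewrite sumrB -scaler_suml w1 scale1r -/(barycenter x w) wp.
    apply: summx_sub => i _; have [iJ|iJ] := boolP (i \in J); last first.
      by rewrite w0// scale0r sub0mx.
    by rewrite scalemx_sub// -rowD// row_sub.
  apply/rowP => i; rewrite [RHS]mxE.
  transitivity (dot (row i D) (z - p)).
    by rewrite mxE; apply: eq_bigr => j _; rewrite mulrC !mxE.
  rewrite rowK; case: ifP => iJ; last by rewrite dot0l.
  rewrite (_ : x i - a = (x i - p) - (a - p)); last first.
    by apply/rowP => j; rewrite !mxE; ring.
  by rewrite dotBl !pJ// subrr.
have stretch p z t : (p - a <= D)%MS -> (z - p) *m D^T = 0 ->
    a + (z - a) *m M t = p + t *: (z - p).
  move=> pa zp; rewrite (_ : z - a = (p - a) + (z - p)); last first.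
    by apply/rowP => j; rewrite !mxE; ring.
  by rewrite mulmxDl MW// MWT// addrA [a + _]addrC subrK.
have mproj : measurable_fun setT (fun z : 'rV[R]_n => a + (z - a) *m M 0).
  by apply: measurable_rowD => //; apply: measurable_rowM; apply: measurable_rowB.
have mJ t : measurable (cell x J t).
  pose p (z : 'rV[R]_n) := a + (z - a) *m M 0.
  have mp : measurable_fun setT p by exact: mproj.
  have mzp : measurable_fun setT (fun z : 'rV[R]_n => z - p z) by exact: measurable_rowB.
  have md i : measurable_fun setT (fun z : 'rV[R]_n => dot (x i - p z) (z - p z)).
    by apply: measurable_dot => //; apply: measurable_rowB.
  rewrite (_ : cell x J t = (p @^-1` hull x) `&`
      (\bigcap_(i in [set` J]) [set z | dot (x i - p z) (z - p z) = 0]) `&`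
      (\bigcap_(i in [set` finset.setC J]) [set z | dot (x i - p z) (z - p z) < 0]) `&`
      [set z | enorm (z - p z) <= t]).
    apply: measurableI.
      apply: measurableI.
        apply: measurableI; first exact: (measurable_preimageT mp (measurable_hull x N0)).
        apply: fin_bigcap_measurable => // i _.
        exact: (measurable_preimageT (md i) (measurable_set1 0)).
      apply: fin_bigcap_measurable => // i _.
      rewrite -[X in measurable X]setCK; apply: measurableC.
      rewrite (_ : ~` _ = [set z | 0 <= dot (x i - p z) (z - p z)]).
        exact: measurable_ler.
      by apply/seteqP; split => z /=; [move/negP; rewrite -leNgt|rewrite leNgt => /negP].
    by apply: measurable_ler => //; exact: measurable_enorm.
  apply/seteqP; split => z.
    move=> [q [hq qJ qJ' qt]].
    have [qa zq] := split_cell _ _ hq qJ qJ'.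
    have pq : p z = q by rewrite /p (stretch q)// scale0r addr0.
    split; last by rewrite /= pq.
    split; first split.
    - by rewrite /= pq.
    - by move=> i /= iJ; rewrite pq qJ.
    - by move=> i /=; rewrite inE => iJ; rewrite pq qJ'.
  move=> [[[hp pJ] pJ'] pt]; exists (p z); split => //.
  by move=> i iJ; apply: pJ'; rewrite /= inE.
have scaled t : 0 < t ->
    [set z | cell x J t (a + (z - a) *m M t)] = cell x J 1.
  move=> t0; apply/seteqP; split => z /=.
    move=> [p [hp pJ pJ' pt]].
    have [pa zp] := split_cell _ _ hp pJ pJ'.
    set y := a + _ in pJ pJ' pt zp.
    pose z' := p + t^-1 *: (y - p).
    have z'p : z' - p = t^-1 *: (y - p) by rewrite /z' addrAC subrr add0r.
    have zz' : z = z'.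
      suff : z - a = z' - a by move=> /addIr.
      apply: (can_inj (mulmxK (uM t t0))); apply: (addrI a).
      rewrite (stretch p z')//; last by rewrite z'p -scalemxAl zp scaler0.
      by rewrite z'p scalerA divff ?gt_eqF// scale1r [RHS]addrC subrK.
    exists p; rewrite zz' z'p; split => //.
    - by move=> i iJ; rewrite dotZr pJ// mulr0.
    - by move=> i iJ; rewrite dotZr pmulr_rlt0 ?invr_gt0// pJ'.
    - by rewrite enormZ gtr0_norm ?invr_gt0// ler_pdivrMl// mulr1.
  move=> [p [hp pJ pJ' p1]]; have [pa zp] := split_cell _ _ hp pJ pJ'.
  exists p; rewrite (stretch p)// (_ : p + _ - p = t *: (z - p)); last first.
    by rewrite addrAC subrr add0r.
  split => //.
  - by move=> i iJ; rewrite dotZr pJ// mulr0.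
  - by move=> i iJ; rewrite dotZr pmulr_rlt0// pJ'.
  - by rewrite enormZ gtr0_norm// ler_piMr// ltW.
have lam_pos t : 0 < t ->
    lam n (cell x J t) = ((t ^+ (n - m))%:E * lam n (cell x J 1))%E.
  move=> t0; have mS : measurable [set y | cell x J t (a + y)].
    have mf : measurable_fun setT (fun y : 'rV[R]_n => a + y) by exact: measurable_rowD.
    exact: (measurable_preimageT mf (mJ t)).
  have e1 : lam n (cell x J t) = lam n [set y | cell x J t (a + y)].
    rewrite -(lebesgue_row_translate a)//; congr (lam n _).
    by apply/seteqP; split => z /=; rewrite addrC.
  have e2 : lam n (cell x J 1) =
      lam n [set z | [set y | cell x J t (a + y)] (z *m M t)].
    rewrite -(lebesgue_row_translate a)// -(scaled t t0); congr (lam n _).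
    by apply/seteqP; split => z /=; rewrite addrK.
  rewrite e1 e2 lamM// muleA -EFinM.
  by rewrite divff ?mul1e// gt_eqF// exprn_gt0.
exists m; split => // t'; rewrite le_eqVlt => /predU1P[<- {t'}|]; last exact: lam_pos.
have [nm|nm] := eqVneq (n - m)%N 0%N.
  rewrite nm expr0 mul1e; congr (lam n _).
  have zp0 p z : (z - p) *m D^T = 0 -> z - p = 0.
    move=> /eqP; rewrite mulmx_free_eq0 => [/eqP//|].
    rewrite /row_free mxrank_tr -/m eqn_leq mn/=.
    by rewrite -subn_eq0 nm.
  apply/seteqP; split => z [p [hp pJ pJ' pt]].
    by exists p; split => //; exact: le_trans pt _.
  exists p; split => //; have [_ /zp0 ->] := split_cell _ _ hp pJ pJ'.
  by rewrite enorm0.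
rewrite expr0n (negbTE nm) mul0e; apply: le_anti; rewrite measure_ge0 andbT.
have cfin : lam n (cell x J 1) = (fine (lam n (cell x J 1)))%:E.
  by rewrite fineK// ge0_fin_numE//; exact: cell_finite.
set c := fine _ in cfin.
have c0 : 0 <= c by rewrite fine_ge0.
apply/lee_addgt0Pr => e e0; rewrite add0e.
pose t := Num.min 1 (e / (1 + c)).
have t0 : 0 < t by rewrite lt_min ltr01 divr_gt0// ltr_pwDl.
apply: (@le_trans _ _ (lam n (cell x J t))).
  apply: le_measure; rewrite ?inE//.
  by move=> z [p [hp pJ pJ' pt]]; exists p; split => //; apply: le_trans pt (ltW t0).
rewrite lam_pos// cfin -EFinM lee_fin.
have te : t * (1 + c) <= e.
  by rewrite -ler_pdivlMr ?ltr_pwDl// /t ge_min lexx orbT.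
have t1 : t <= 1 by rewrite /t ge_min lexx.
have tt : t ^+ (n - m) <= t.
  by rewrite -[leRHS]expr1 ler_wiXn2l ?lt0n// ltW.
have : t ^+ (n - m) * c <= t * c by exact: ler_wpM2r.
nra.
Qed.

Lemma measurable_parallel_body N n (x : 'I_N -> 'rV[R]_n) t :
  (0 < N)%N -> 0 <= t ->
  measurable [set p + t *: y | p in hull x & y in @eball R n].
Proof.
move=> N0 t0; rewrite parallel_body_cells//.
by apply: fin_bigcup_measurable => // J _; have [m []] := cell_scaling x J N0.
Qed.

(** The cells over the faces of dimension j contribute the term of degree
    n - j. *)
Lemma steiner_polytope N n (x : 'I_N -> 'rV[R]_n) : (0 < N)%N ->
  exists v, steiner_coefficients (hull x) v.
Proof.
move=> N0; have [m mP] := choice (fun J => cell_scaling x J N0).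
have mn J : (m J < n.+1)%N by have [] := mP J.
have mJ J t : measurable (cell x J t) by have [] := mP J.
pose c J := fine (lam n (cell x J 1)).
have cE J : lam n (cell x J 1) = (c J)%:E.
  by rewrite fineK// ge0_fin_numE//; exact: cell_finite.
exists [ffun j : 'I_n.+1 =>
  (\sum_(J | Ordinal (mn J) == j) c J) / kap (n - j)]; split => [j|t t0].
  rewrite ffunE divr_ge0//; last exact/ltW/ball_volume_gt0.
  by apply: sumr_ge0 => J _; rewrite fine_ge0.
rewrite parallel_body_cells// measure_fin_bigcup//=; last exact: trivIset_cell.
transitivity (\sum_(J : {set 'I_N}) (t ^+ (n - m J) * c J)%:E)%E.
  rewrite (fsbigE (index_enum {set 'I_N})) ?index_enum_uniq//.
    apply: eq_big => [J|J _]; first by apply: mem_set.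
    by have [_ _ ->//] := mP J; rewrite cE -EFinM.
  by move=> J _; rewrite mem_index_enum.
rewrite sumEFin.
rewrite [in RHS](eq_bigr (fun j : 'I_n.+1 =>
  (t ^+ (n - j) * \sum_(J | Ordinal (mn J) == j) c J)%:E)); last first.
  move=> j _; rewrite lebesgue_row_eball ffunE -!EFinM; congr EFin.
  have := ball_volume_gt0 (R := R) (n - j); move: (kap _) (\sum_(_ | _) _) => k s k0.
  by field; rewrite gt_eqF.
rewrite sumEFin; congr EFin.
rewrite (partition_big (fun J => Ordinal (mn J)) xpredT)//=.
apply: eq_bigr => j _; rewrite mulr_sumr; apply: eq_bigr => J /eqP <-.
by [].
Qed.

End steiner_formula.

(** * Intrinsic volumes and the Steiner polynomial *)

Section intrinsic_volumes.
Context {R : realType}.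
Local Notation lam := (@lebesgue_row R).
Local Notation kap := (@ball_volume R).
Implicit Types (n k : nat).

Definition psum n (b : nat -> R) (s : R) : R := \sum_(j < n) b j * s ^+ j.

Lemma psumS n b s : psum n.+1 b s = b 0%N + s * psum n (b \o S) s.
Proof.
rewrite /psum big_ord_recl expr0 mulr1 mulr_sumr; congr (_ + _).
by apply: eq_bigr => j _; rewrite exprS mulrCA.
Qed.

Lemma psum_ge0 n b s : (forall j, 0 <= b j) -> 0 <= s -> 0 <= psum n b s.
Proof. by move=> b0 s0; apply: sumr_ge0 => j _; rewrite mulr_ge0 ?exprn_ge0. Qed.

Lemma psum_le1 n b s : (forall j, 0 <= b j) -> 0 <= s <= 1 ->
  psum n b s <= psum n b 1.
Proof.
move=> b0 /andP[s0 s1]; apply: ler_sum => j _.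
by rewrite ler_wpM2l// expr1n exprn_ile1.
Qed.

(** Polynomials with nonnegative coefficients that are close on an interval
    [sigma, 1] have close coefficients, uniformly in their length: the
    constant terms are compared at a small s, then they are removed and the
    quotients by s are compared. *)
Lemma close_coefficients k (eta M : R) : 0 < eta -> 0 <= M ->
  exists d : R * R, [/\ 0 < d.1, 0 < d.2 <= 1 & forall n b c,
    (forall j, 0 <= b j) -> (forall j, 0 <= c j) ->
    (k < n)%N -> psum n b 1 <= M -> psum n c 1 <= M ->
    (forall s, d.2 <= s <= 1 -> `|psum n b s - psum n c s| <= d.1) ->
    `|b k - c k| <= eta].
Proof.
move=> eta0 M0.
have base (e : R) : 0 < e -> exists d : R * R,
    [/\ 0 < d.1, 0 < d.2 <= 1 & forall n b c,
    (forall j, 0 <= b j) -> (forall j, 0 <= c j) ->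
    (0 < n)%N -> psum n b 1 <= M -> psum n c 1 <= M ->
    (forall s, d.2 <= s <= 1 -> `|psum n b s - psum n c s| <= d.1) ->
    `|b 0%N - c 0%N| <= e].
  move=> e0; pose s := Num.min 1 (e / (2 * (M + 1))).
  have s0 : 0 < s by rewrite lt_min ltr01/= divr_gt0// mulr_gt0// ltr_wpDl.
  have s1 : s <= 1 by rewrite /s ge_min lexx.
  have sM : s * M <= e / 2.
    have : s * (2 * (M + 1)) <= e.
      by rewrite -ler_pdivlMr ?mulr_gt0 ?ltr_wpDl// /s ge_min lexx orbT.
    by nra.
  exists (e / 2, s); split => /=; [by rewrite divr_gt0|by rewrite s0|].
  move=> [//|n] b c b0 c0 _ bM cM /(_ s); rewrite lexx s1 !psumS => /(_ isT).
  rewrite !psumS !mul1r in bM cM.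
  have s01 : 0 <= s <= 1 by rewrite ltW.
  have b0' j : 0 <= (b \o S) j by exact: b0.
  have c0' j : 0 <= (c \o S) j by exact: c0.
  have := psum_le1 n b0' s01; have := psum_le1 n c0' s01.
  have := psum_ge0 n b0' (ltW s0); have := psum_ge0 n c0' (ltW s0).
  have := b0 0%N; have := c0 0%N.
  move: (psum n _ s) (psum n _ s) => p q.
  move=> c00 b00 p0 q0 pc qb; rewrite !ler_distl => /andP[H1 H2].
  have : s * p <= e / 2 by apply: le_trans sM; rewrite ler_pM2l//; lra.
  have : s * q <= e / 2 by apply: le_trans sM; rewrite ler_pM2l//; lra.
  have : 0 <= s * p by rewrite mulr_ge0// ltW.
  have : 0 <= s * q by rewrite mulr_ge0// ltW.
  by move=> ? ? ? ?; apply/andP; split; lra.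
elim: k => [|k [[d' s'] /= [d'0 /andP[s'0 s'1] IH]]]; first exact: base.
pose e := d' * s' / 2; have e0 : 0 < e by rewrite divr_gt0// mulr_gt0.
have [[d s] /= [d0 /andP[s0 s1] Hb]] := base _ e0.
exists (Num.min d e, Num.min s s'); split => /=.
- by rewrite lt_min d0.
- by rewrite lt_min s0 s'0/= ge_min s1.
move=> [//|n] b c b0 c0 kn bM cM H.
have /= bc0 := Hb n.+1 b c b0 c0 isT bM cM _.
have {}bc0 : `|b 0%N - c 0%N| <= e.
  apply: bc0 => r /andP[sr r1]; apply: le_trans (H r _) _.
    by rewrite r1 andbT ge_min sr.
  by rewrite ge_min lexx.
apply: (IH n (b \o S) (c \o S)) => //.
- by move=> j; exact: b0.
- by move=> j; exact: c0.
- by apply: le_trans bM; rewrite psumS mul1r lerDr.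
- by apply: le_trans cM; rewrite psumS mul1r lerDr.
move=> r /andP[s'r r1].
have r0 : 0 < r by apply: lt_le_trans s'r.
have : `|psum n.+1 b r - psum n.+1 c r| <= e.
  apply: le_trans (H r _) _; last by rewrite ge_min lexx orbT.
  by rewrite r1 andbT ge_min s'r orbT.
rewrite !psumS => H'.
rewrite -(ler_pM2l s'0); apply: (@le_trans _ _ (r * `|psum n (b \o S) r - psum n (c \o S) r|)).
  by rewrite ler_wpM2r.
rewrite -{1}(gtr0_norm r0) -normrM mulrBr.
move: (r * _) (r * _) H' => p q; rewrite !ler_distl => H'.
move: bc0; rewrite ler_distl => /andP[? ?].
have ? : s' * d' = e + e by rewrite /e; field.
by move: H' => /andP[? ?]; apply/andP; split; lra.
Qed.

(** The coefficients of the polynomial Vol(K + tB) of t, listed from the top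
    degree. *)
Definition steiner_term n (v : {ffun 'I_n.+1 -> R}) (j : nat) : R :=
  kap (n - j) * v (inord j).

Lemma steiner_term_ge0 n K v : @steiner_coefficients R n K v ->
  forall j, 0 <= steiner_term v j.
Proof. by move=> [v0 _] j; rewrite mulr_ge0// ltW// ball_volume_gt0. Qed.

Lemma steiner_psum n K v (s : R) : @steiner_coefficients R n K v -> 0 < s ->
  lam n [set x + s^-1 *: y | x in K & y in @eball R n] =
  ((s ^+ n)^-1 * psum n.+1 (steiner_term v) s)%:E.
Proof.
move=> [v0 Kv] s0; rewrite Kv ?invr_ge0 ?ltW//.
rewrite mulr_sumr -sumEFin; apply: eq_bigr => j _.
rewrite lebesgue_row_eball -!EFinM; congr EFin; rewrite /steiner_term inord_val.
have -> : s ^+ n = s ^+ (n - j) * s ^+ j by rewrite -exprD subnK// -ltnS.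
rewrite exprVn; move: (s ^+ (n - j)) (s ^+ j) (exprn_gt0 (n - j) s0) (exprn_gt0 j s0).
by move=> a b a0 b0; field; rewrite !gt_eqF.
Qed.

(** The two polynomials take the same values on ]0, 1], so that their
    coefficients are arbitrarily close. *)
Lemma steiner_unique n K v w :
  @steiner_coefficients R n K v -> steiner_coefficients K w -> v = w.
Proof.
move=> Kv Kw; apply/ffunP => j.
have vw s : 0 < s -> psum n.+1 (steiner_term v) s = psum n.+1 (steiner_term w) s.
  move=> s0; have := steiner_psum Kv s0; rewrite (steiner_psum Kw s0) => -[].
  by move/mulfI => H; apply/esym/H; rewrite invr_eq0 gt_eqF// exprn_gt0.
have v0 := steiner_term_ge0 Kv; have w0 := steiner_term_ge0 Kw.
suff : steiner_term v j = steiner_term w j.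
  rewrite /steiner_term inord_val => /mulfI; apply.
  by rewrite gt_eqF// ball_volume_gt0.
apply/eqP; rewrite -subr_eq0 -normr_eq0; apply/eqP/le_anti; rewrite normr_ge0 andbT.
apply/ler_addgt0Pr => e e0; rewrite add0r.
have [[d s] /= [d0 /andP[s0 _] H]] := close_coefficients j e0 (psum_ge0 n.+1 v0 ler01).
apply: (H n.+1) => //; first by rewrite -vw.
by move=> r /andP[sr _]; rewrite vw ?subrr ?normr0 ?ltW// (lt_le_trans s0).
Qed.

Lemma intrinsic_volumeE n k K v : (k <= n)%N -> steiner_coefficients K v ->
  @intrinsic_volume R n k K = v (inord k).
Proof.
move=> kn Kv; rewrite /intrinsic_volume kn; case: xgetP => [w _ Kw|/(_ v)//].
by rewrite (steiner_unique Kv Kw).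
Qed.

Lemma intrinsic_volume_ge0 n k K : 0 <= @intrinsic_volume R n k K.
Proof.
rewrite /intrinsic_volume; case: ifP => // _.
by case: xgetP => [w _ [w0 _]|_]; rewrite ?ffunE.
Qed.

Lemma parallel_ball n (a t : R) : 0 < a -> 0 <= t ->
  [set x + t *: y | x in @cball R n 0 a & y in @eball R n] = cball 0 (a + t).
Proof.
move=> a0 t0; have at0 : 0 < a + t by rewrite ltr_wpDr.
apply/seteqP; split => z.
  move=> [x + [y + <-]]; rewrite /cball/eball/= !subr0 => xa y1.
  apply: le_trans (enormD _ _) _; apply: lerD => //.
  by rewrite enormZ ger0_norm// ler_piMr.
rewrite /cball/= subr0 => zat; exists ((a / (a + t)) *: z).
  rewrite subr0 enormZ gtr0_norm ?divr_gt0//.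
  by rewrite mulrAC ler_pdivrMr// ler_pM2l.
exists ((a + t)^-1 *: z).
  by rewrite /eball/= enormZ gtr0_norm ?invr_gt0// ler_pdivrMl// mulr1.
by rewrite scalerA -scalerDl -mulrDl divff ?scale1r// gt_eqF.
Qed.

Lemma steiner_ball n : steiner_coefficients (@eball R n)
  [ffun j : 'I_n.+1 => 'C(n, j)%:R * kap n / kap (n - j)].
Proof.
split=> [j|t t0].
  by rewrite ffunE divr_ge0 ?mulr_ge0// ltW// ball_volume_gt0.
rewrite {1}eballE parallel_ball// lebesgue_row_cball ?ltr_wpDr//.
rewrite [1 + t]addrC exprDn mulr_suml -sumEFin; apply: eq_bigr => j _.
rewrite lebesgue_row_eball ffunE expr1n mulr1 -!EFinM; congr EFin.
have := ball_volume_gt0 (R := R) (n - j); move: (kap (n - j)) => c c0.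
by rewrite -mulr_natr; field; rewrite gt_eqF.
Qed.

Lemma intrinsic_volume_ball n k : (k <= n)%N ->
  intrinsic_volume k (@eball R n) = 'C(n, k)%:R * kap n / kap (n - k).
Proof.
by move=> kn; rewrite (intrinsic_volumeE kn (steiner_ball n)) ffunE inordK.
Qed.

Lemma intrinsic_volume_ball_gt0 n k : (k <= n)%N ->
  0 < intrinsic_volume k (@eball R n).
Proof.
move=> kn; rewrite intrinsic_volume_ball// divr_gt0 ?ball_volume_gt0// mulr_gt0//.
  by rewrite ltr0n bin_gt0.
exact: ball_volume_gt0.
Qed.

Definition volume_ratio n k (K : set 'rV[R]_n) : R :=
  intrinsic_volume k K / intrinsic_volume k (@eball R n).

Lemma volume_ratioE n k K v : (k <= n)%N -> @steiner_coefficients R n K v ->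
  steiner_term v k = volume_ratio k K * ('C(n, k)%:R * kap n).
Proof.
move=> kn Kv; rewrite /volume_ratio (intrinsic_volumeE kn Kv) intrinsic_volume_ball//.
have C0 : 0 < 'C(n, k)%:R :> R by rewrite ltr0n bin_gt0.
have := ball_volume_gt0 (R := R) (n - k); have := ball_volume_gt0 (R := R) n.
rewrite /steiner_term; move: (kap n) (kap _) ('C(n, k)%:R) C0 => a b c c0 a0 b0.
by field; rewrite !gt_eqF.
Qed.

Lemma volume_ratio_ge0 n k K : 0 <= @volume_ratio n k K.
Proof. by rewrite divr_ge0// intrinsic_volume_ge0. Qed.

(** One term of Steiner's formula bounds the sum from below; if K admits no
    Steiner formula, the intrinsic volume is 0 by convention. *)
Lemma volume_ratio_le n k K (t : R) : (k <= n)%N -> 0 < t ->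
  ((volume_ratio k K * ('C(n, k)%:R * kap n * t ^+ (n - k)))%:E <=
   lam n [set (x + t *: y)%R | x in K & y in @eball R n])%E.
Proof.
move=> kn t0; have [[v Kv]|noK] := pselect (exists v, @steiner_coefficients R n K v).
  have s0 : 0 < t^-1 by rewrite invr_gt0.
  have := steiner_psum Kv s0; rewrite invrK => ->; rewrite lee_fin.
  have Sk := volume_ratioE kn Kv; rewrite mulrA -Sk.
  have v0 := steiner_term_ge0 Kv.
  rewrite /psum (bigD1 (inord k))//= inordK//.
  set S := \sum_(_ | _) _; have S0 : 0 <= S.
    by apply: sumr_ge0 => j _; rewrite mulr_ge0// exprn_ge0// ltW.
  rewrite exprVn invrK -[t ^+ n](_ : t ^+ (n - k) * t ^+ k = _); last first.
    by rewrite -exprD subnK.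
  rewrite mulrDr exprVn [X in _ <= X + _](_ : _ = steiner_term v k * t ^+ (n - k)).
    by rewrite lerDl mulr_ge0// mulr_ge0// exprn_ge0// ltW.
  by field; rewrite gt_eqF// exprn_gt0.
suff -> : volume_ratio k K = 0 by rewrite mul0r.
rewrite /volume_ratio /intrinsic_volume kn; case: xgetP => [w _ Kw|_].
  by exfalso; apply: noK; exists w.
by rewrite ffunE mul0r.
Qed.

Lemma bin_lower n k : (2 * k <= n)%N ->
  (n ^ k <= 'C(n, k) * (2 ^ k * k`!))%N.
Proof.
rewrite mulnCA bin_ffact; elim: k => [//|k IHk] kn.
have {}IHk : (n ^ k <= 2 ^ k * n ^_ k)%N by apply: IHk; lia.
rewrite ffactnSr (mulnC (n ^_ k)) !expnS; have : (n <= 2 * (n - k))%N by lia.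
by move=> /leq_mul /(_ IHk); rewrite mulnACA.
Qed.

(** The coefficients of (1 + s / n)^n stay away from 0 as n grows. *)
Lemma bin_lowerR n k : (0 < n)%N -> (2 * k <= n)%N ->
  1 <= 'C(n, k)%:R / n%:R ^+ k * (2 ^ k * k`!)%:R :> R.
Proof.
move=> n0 kn; rewrite mulrAC ler_pdivlMr ?exprn_gt0 ?ltr0n// mul1r.
by rewrite -natrX -natrM ler_nat bin_lower.
Qed.

Lemma exprn_le_expR n (s : R) : (0 < n)%N -> 0 <= s ->
  (1 + s / n%:R) ^+ n <= expR s.
Proof.
move=> n0 s0; have nn : n%:R != 0 :> R by rewrite pnatr_eq0 -lt0n.
rewrite -[in leRHS](divfK nn s).
rewrite [in leRHS]mulrC expRM_natl; apply: lerXn2r; rewrite ?nnegrE ?expR_ge0//.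
  by rewrite addr_ge0// divr_ge0.
exact: expR_ge1Dx.
Qed.

Lemma exprn_sub_le n (a b : R) : 0 <= b <= a ->
  a ^+ n - b ^+ n <= n%:R * (a - b) * a ^+ n.-1.
Proof.
move=> /andP[b0 ba]; elim: n => [|n IHn]; first by rewrite !expr0 subrr !mul0r.
have a0 : 0 <= a by apply: le_trans ba.
have -> : a ^+ n.+1 - b ^+ n.+1 = a * (a ^+ n - b ^+ n) + (a - b) * b ^+ n.
  by rewrite !exprS; ring.
have bn : b ^+ n <= a ^+ n by apply: lerXn2r; rewrite ?nnegrE.
have H1 : (a - b) * b ^+ n <= (a - b) * a ^+ n by rewrite ler_wpM2l// subr_ge0.
have H2 : a * (a ^+ n - b ^+ n) <= n%:R * (a - b) * a ^+ n.
  case: n IHn {bn H1} => [|n] IHn; first by rewrite !expr0 subrr mulr0 !mul0r.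
  by rewrite [a ^+ n.+1 in leRHS]exprS mulrCA ler_wpM2l.
by rewrite -natr1 /=; lra.
Qed.

(** The term of degree n - k of Steiner's formula at t = n, where Vol(K + tB)
    is at most (1 + n)^n kappa_n. *)
Lemma volume_ratio_crude n k K : (0 < n)%N -> (2 * k <= n)%N ->
  K `<=` @eball R n ->
  (forall t, 0 <= t -> measurable [set x + t *: y | x in K & y in @eball R n]) ->
  volume_ratio k K <= expR 1 * (2 ^ k * k`!)%:R.
Proof.
move=> n0 kn KB mK; have nR : 0 < n%:R :> R by rewrite ltr0n.
have kn' : (k <= n)%N by lia.
pose S := [set x + n%:R *: y | x in K & y in @eball R n].
have sub : S `<=` cball 0 (1 + n%:R).
  rewrite -parallel_ball ?ltW// -eballE => z [x /KB xB [y yB <-]].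
  by exists x => //; exists y.
have le1 : (lam n S <= lam n (cball 0 (1 + n%:R)))%E.
  by apply: le_measure; rewrite ?inE//; [exact: (mK _ (ltW nR))|exact: measurable_cball].
have := le_trans (volume_ratio_le K kn' nR) le1.
rewrite lebesgue_row_cball ?addr_gt0// lee_fin.
have k0 := ball_volume_gt0 (R := R) n.
set r := volume_ratio k K; set C := 'C(n, k)%:R;
move=> H.
have nk : 0 < n%:R ^+ (n - k) :> R by rewrite exprn_gt0.
have rC : r * (C / n%:R ^+ k) <= expR 1.
  apply: le_trans (exprn_le_expR n0 ler01).
  have -> : 1 + 1 / n%:R = (1 + n%:R) / n%:R :> R by field; rewrite gt_eqF.
  rewrite expr_div_n ler_pdivlMr ?exprn_gt0//.
  rewrite -(ler_pM2r k0); apply: le_trans H.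
  have -> : n%:R ^+ n = n%:R ^+ (n - k) * n%:R ^+ k :> R by rewrite -exprD subnK.
  rewrite le_eqVlt; apply/orP; left; apply/eqP; field.
  by rewrite gt_eqF// exprn_gt0.
have Ck := bin_lowerR n0 kn; rewrite -/C in Ck.
have r0 : 0 <= r by exact: volume_ratio_ge0.
apply: (@le_trans _ _ (r * (C / n%:R ^+ k * (2 ^ k * k`!)%:R))).
  by rewrite ler_peMr.
by rewrite mulrA ler_wpM2r.
Qed.

(** At the scale t = n / s the Steiner polynomial of the ball becomes
    (1 + s / n)^n, which is at most e for s <= 1, and the sandwich bounds its
    difference to the polynomial of K by d * e. The coefficients are then
    close uniformly in n, and those of the ball are bounded away from 0. *)
Lemma volume_ratio_sandwich k (eta : R) : 0 < eta ->
  exists2 d : R, 0 < d < 1 & forall n (K : set 'rV[R]_n),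
    (0 < n)%N -> (2 * k <= n)%N -> (exists v, steiner_coefficients K v) ->
    (forall t, 0 <= t -> measurable [set x + t *: y | x in K & y in @eball R n]) ->
    cball 0 (1 - d) `<=` K -> K `<=` @eball R n ->
    `|volume_ratio k K - 1| <= eta.
Proof.
move=> eta0; pose D : R := (2 ^ k * k`!)%:R.
have D0 : 0 < D by rewrite ltr0n muln_gt0 expn_gt0 fact_gt0.
have [[d s] /= [d0 /andP[s0 s1] H]] :=
  close_coefficients k (divr_gt0 eta0 D0) (expR_ge0 1).
pose e := Num.min (2^-1) (d / expR 1).
have e0 : 0 < e by rewrite lt_min invr_gt0 ltr0n/= divr_gt0// expR_gt0.
have e1 : e < 1 by rewrite gt_min; apply/orP; left; lra.
exists e; first by rewrite e0.
move=> n K n0 kn [v Kv] mK BK KB.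
have nR : 0 < n%:R :> R by rewrite ltr0n.
have kn' : (k <= n)%N by lia.
have kap0 := ball_volume_gt0 (R := R) n.
pose b j := steiner_term v j / (n%:R ^+ j * kap n).
pose c j : R := 'C(n, j)%:R / n%:R ^+ j.
have b0 j : 0 <= b j.
  rewrite divr_ge0//; first exact: steiner_term_ge0 Kv _.
  by rewrite mulr_ge0 ?exprn_ge0// ltW.
have c0 j : 0 <= c j by rewrite divr_ge0// exprn_ge0.
have cE r : psum n.+1 c r = (1 + r / n%:R) ^+ n.
  rewrite exprDn; apply: eq_bigr => j _; rewrite expr1n mul1r /c expr_div_n.
  by rewrite -[RHS]mulr_natl mulrAC mulrA.
have bE r : 0 < r ->
    lam n [set x + (n%:R / r) *: y | x in K & y in @eball R n] =
    ((n%:R / r) ^+ n * kap n * psum n.+1 b r)%:E.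
  move=> r0; have rn0 : 0 < r / n%:R by rewrite divr_gt0.
  have := steiner_psum Kv rn0; rewrite invf_div => ->; congr EFin.
  rewrite -exprVn invf_div -mulrA; congr (_ * _).
  rewrite mulr_sumr; apply: eq_bigr => j _; rewrite /b expr_div_n.
  by field; rewrite !gt_eqF// exprn_gt0.
have sandwich r : 0 < r <= 1 ->
    (1 + (1 - e) * r / n%:R) ^+ n <= psum n.+1 b r <= (1 + r / n%:R) ^+ n.
  move=> /andP[r0 r1]; pose t := n%:R / r; have t0 : 0 < t by rewrite divr_gt0.
  have tn0 : 0 < t ^+ n * kap n by rewrite mulr_gt0// exprn_gt0.
  have e1t : 0 < 1 - e + t by lra.
  have t1 : 0 < 1 + t by lra.
  have scaleE a : t ^+ n * kap n * (1 + a * r / n%:R) ^+ n = (a + t) ^+ n * kap n.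
    rewrite mulrAC -exprMn; congr (_ ^+ _ * _); rewrite /t.
    by field; rewrite !gt_eqF.
  have sub1 : cball 0 (1 - e + t) `<=`
      [set x + t *: y | x in K & y in @eball R n].
    rewrite -parallel_ball ?ltW ?subr_gt0// => z [x /BK xK [y yB <-]].
    by exists x => //; exists y.
  have sub2 : [set x + t *: y | x in K & y in @eball R n] `<=` cball 0 (1 + t).
    rewrite -parallel_ball ?ltW// -eballE => z [x /KB xB [y yB <-]].
    by exists x => //; exists y.
  apply/andP; split; rewrite -(ler_pM2l tn0).
    rewrite scaleE -lee_fin -bE// -(lebesgue_row_cball 0 e1t)//.
    by apply: le_measure; rewrite ?inE//; [exact: measurable_cball|exact: (mK _ (ltW t0))].
  rewrite -[X in _ <= _ * (1 + X / _) ^+ _]mul1r scaleE -lee_fin -bE//.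
  rewrite -(lebesgue_row_cball 0 t1)//.
  by apply: le_measure; rewrite ?inE//; [exact: (mK _ (ltW t0))|exact: measurable_cball].
have c1 : psum n.+1 c 1 <= expR 1 by rewrite cE; exact: exprn_le_expR.
have bk : b k = volume_ratio k K * c k.
  rewrite /b (volume_ratioE kn' Kv) /c; field.
  by rewrite !gt_eqF// exprn_gt0.
have b1 : psum n.+1 b 1 <= expR 1.
  have := sandwich 1; rewrite ltr01 lexx => /(_ isT)/andP[_ H1].
  by apply: le_trans H1 _; rewrite -cE.
have : `|b k - c k| <= eta / D.
  apply: (H n.+1) => // r /andP[sr r1]; have r0 : 0 < r by exact: lt_le_trans sr.
  have /andP[br1 br2] := sandwich r (introT andP (conj r0 r1)).
  rewrite cE distrC ger0_norm ?subr_ge0//.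
  apply: (@le_trans _ _ ((1 + r / n%:R) ^+ n - (1 + (1 - e) * r / n%:R) ^+ n)).
    by rewrite lerB.
  apply: le_trans (exprn_sub_le _ _) _.
    apply/andP; split.
      by rewrite addr_ge0// divr_ge0// mulr_ge0; lra.
    by rewrite lerD2l ler_pM2r ?invr_gt0// ler_piMl; lra.
  have -> : n%:R * (1 + r / n%:R - (1 + (1 - e) * r / n%:R)) = e * r.
    by field; rewrite gt_eqF.
  have er : e * r <= d / expR 1.
    apply: (@le_trans _ _ e); first by rewrite ler_piMr// ltW.
    by rewrite /e ge_min lexx orbT.
  have ne : expR 1 != 0 :> R by rewrite gt_eqF// expR_gt0.
  rewrite -[leRHS](divfK ne).
  apply: ler_pM => //; [by rewrite mulr_ge0// ltW| |].
    by rewrite exprn_ge0// addr_ge0// divr_ge0// ltW.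
  apply: le_trans (exprn_le_expR n0 ler01).
  have q1 : 1 <= 1 + r / n%:R by rewrite lerDl divr_ge0// ltW.
  apply: (@le_trans _ _ ((1 + r / n%:R) ^+ n)).
    by rewrite ler_weXn2l// leq_pred.
  apply: lerXn2r; rewrite ?nnegrE.
  - exact: le_trans ler01 q1.
  - by rewrite addr_ge0// divr_ge0.
  - by rewrite lerD2l ler_pM2r// invr_gt0.
rewrite bk -[X in _ - X]mul1r -mulrBl normrM (ger0_norm (c0 k)) ler_pdivlMr//.
apply: le_trans; rewrite -mulrA ler_peMr ?normr_ge0//.
exact: bin_lowerR.
Qed.

End intrinsic_volumes.

(** * Integrals of radial functions over cones *)

Section radial_integrals.
Context {R : realType}.
Local Notation lam := (@lebesgue_row R).
Local Notation kap := (@ball_volume R).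

Lemma ge0_integral_mrestr d (T : measurableType d)
    (mu : {measure set T -> \bar R}) (D : set T) (mD : measurable D)
    (f : T -> \bar R) :
  measurable_fun setT f -> (forall x, 0 <= f x)%E ->
  (\int[mrestr mu mD]_x f x = \int[mu]_(x in D) f x)%E.
Proof.
move=> mf f0; have mDC := measurableC mD.
rewrite -(setUv D) (ge0_integral_setU _ mD mDC)//=; last 2 first.
- by rewrite setUv.
- by apply/disj_setPS => x [].
rewrite [X in (_ + X)%E]null_set_integral ?adde0.
- by apply: eq_measure_integral => A mA AD; rewrite /= /mrestr setIidl.
- exact: measurableC.
- exact: measurable_funS mf.
- by rewrite /= /mrestr setICl measure0.
Qed.

Lemma ge0_integral_affine n (c : 'rV[R]_n) (r : R) (f : 'rV[R]_n -> \bar R) :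
  0 < r -> measurable_fun setT f -> (forall x, 0 <= f x)%E ->
  (\int[lam n]_x f x = (r ^+ n)%:E * \int[lam n]_y f (c + r *: y)%R)%E.
Proof.
move=> r0 mf f0.
have mphi : measurable_fun setT (fun y : 'rV[R]_n => c + r *: y).
  by apply: measurable_rowD => //; exact: measurable_rowZ.
have rn0 : 0 < r ^+ n by exact: exprn_gt0.
have rn0' : 0 <= (r ^+ n)^-1 by rewrite invr_ge0 ltW.
have := ge0_integral_pushforward mphi (lam n) measurableT mf (fun x _ => f0 x).
rewrite preimage_setT /= => <-.
rewrite [in RHS](eq_measure_integral (mscale (NngNum rn0') (lam n))); last first.
  move=> A mA _; rewrite /= /pushforward.
  have -> : mscale (NngNum rn0') (lam n) A = (((r ^+ n)^-1)%:E * lam n A)%E by [].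
  have mA' : measurable [set x | A (x + c)].
    have mf' : measurable_fun setT (fun y : 'rV[R]_n => y + c) by exact: measurable_rowD.
    exact: (measurable_preimageT mf' mA).
  rewrite -(lebesgue_row_translate c mA) -lebesgue_row_scale//.
  by congr (lam n _); apply/seteqP; split => y /=; rewrite addrC.
rewrite ge0_integral_mscale//= muleA -EFinM divff ?mul1e//.
by rewrite gt_eqF.
Qed.

Lemma lebesgue_row_cone n (C : set 'rV[R]_n) (s : R) : measurable C ->
  (forall a x, 0 < a -> C x -> C (a *: x)) -> 0 < s ->
  lam n (C `&` cball 0 s) = ((s ^+ n)%:E * lam n (C `&` @eball R n))%E.
Proof.
move=> mC hC s0; have mCs : measurable (C `&` cball 0 s).
  by apply: measurableI => //; exact: measurable_cball.
have := lebesgue_row_scale s0 mCs.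
rewrite (_ : [set x | _] = C `&` @eball R n); last first.
  apply/seteqP; split => x /=; rewrite /cball/eball/= subr0 enormZ gtr0_norm//.
    move=> [Cx x1]; split; last by move: x1; rewrite ger_pMr.
    by rewrite -[x]scale1r -(mulVf (lt0r_neq0 s0)) -scalerA; apply: hC; rewrite ?invr_gt0.
  by move=> [Cx x1]; split; [exact: hC|rewrite ger_pMr].
by move=> ->; rewrite muleA -EFinM divff ?mul1e// gt_eqF// exprn_gt0.
Qed.

(** Integrating a function of the norm over a cone: the images of Lebesgue
    measure on the cone and on the ball under the norm are proportional,
    because by homogeneity they are on the intervals [0, s]. *)
Lemma radial_integral_cone n (C : set 'rV[R]_n) (g : R -> \bar R) :
  (0 < n)%N -> measurable C -> (forall a x, 0 < a -> C x -> C (a *: x)) ->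
  measurable_fun setT g -> (forall t, 0 <= g t)%E ->
  ((kap n)%:E * \int[lam n]_(x in C `&` @eball R n) g (enorm x) =
   lam n (C `&` @eball R n) * \int[lam n]_(x in @eball R n) g (enorm x))%E.
Proof.
move=> n0 mC hC mg g0.
have mB := @measurable_eball R n; have mCB := measurableI _ _ mC mB.
have mE : measurable_fun setT (@enorm R n) by exact: measurable_enorm.
have CBfin : lam n (C `&` @eball R n) = (fine (lam n (C `&` @eball R n)))%:E.
  rewrite fineK// ge0_fin_numE//; apply: (@le_lt_trans _ _ (lam n (@eball R n))).
    by apply: le_measure; rewrite ?inE.
  by rewrite lebesgue_row_eball ltry.
set c := fine _ in CBfin; have c0 : 0 <= c by rewrite fine_ge0.
have kap0 : 0 <= kap n by rewrite ltW// ball_volume_gt0.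
have radE A (mA : measurable A) :
    (\int[lam n]_(x in A) g (enorm x) =
     \int[pushforward (mrestr (lam n) mA) (@enorm R n : _ -> measurableTypeR R)]_t g t)%E.
  rewrite ge0_integral_pushforward//= preimage_setT ge0_integral_mrestr//.
  exact: measurableT_comp mg mE.
rewrite !radE CBfin.
rewrite -[LHS](ge0_integral_mscale _ measurableT (NngNum kap0))//.
rewrite -[RHS](ge0_integral_mscale _ measurableT (NngNum c0))//.
pose E (I : set R) : set 'rV[R]_n := @enorm R n @^-1` I.
have initial (s : R) :
    ((kap n)%:E * lam n (E `]-oo, s]%classic `&` (C `&` @eball R n)) =
     c%:E * lam n (E `]-oo, s]%classic `&` @eball R n))%E.
  have preE : E `]-oo, s]%classic = @cball R n 0 s.
    by apply/seteqP; split => x; rewrite /E /cball/= in_itv/= subr0.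
  rewrite preE; have [s0|s0] := ltP 0 s; last first.
    suff Z A : measurable A -> lam n (cball 0 s `&` A) = 0%E by rewrite !Z// !mule0.
    move=> mA; apply: le_anti; rewrite measure_ge0 andbT.
    have <- : lam n (box (fun=> 0)) = 0%E.
      by rewrite lebesgue_row_box// prodr_const card_ord expr0n gtn_eqF.
    apply: le_measure; rewrite ?inE; [|exact: measurable_box|].
      by apply: measurableI => //; exact: measurable_cball.
    move=> x [xs _] i; rewrite /cball/= subr0 in xs.
    by have := coord_le_enorm x i; rewrite ler_norml => /andP[? ?]; apply/andP; split; lra.
  have [s1|s1] := leP s 1.
    have sub : cball 0 s `<=` @eball R n.
      by move=> x; rewrite /cball/eball/= subr0 => /le_trans; exact.
    rewrite (setIidl sub) setIC -setIA (setIC (@eball R n)) (setIidl sub).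
    by rewrite lebesgue_row_cone// CBfin lebesgue_row_cball// -!EFinM; congr EFin; ring.
  have sub : @eball R n `<=` cball 0 s.
    by move=> x; rewrite /cball/eball/= subr0 => /le_trans; apply; exact: ltW.
  rewrite (setIidr sub) setIidr; last by move=> x [_ /sub].
  by rewrite CBfin lebesgue_row_eball -!EFinM mulrC.
have mEI (I : set R) : measurable I -> measurable (E I).
  by move=> mI; exact: (measurable_preimageT mE mI).
have Bfin A : measurable A -> A `<=` @eball R n -> (lam n A < +oo)%E.
  move=> mA AB; apply: (@le_lt_trans _ _ (lam n (@eball R n))).
    by apply: le_measure; rewrite ?inE.
  by rewrite lebesgue_row_eball ltry.
have mono (a b : R) : a <= b ->
    ((kap n)%:E * lam n (E `]a, b]%classic `&` (C `&` @eball R n)) =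
     c%:E * lam n (E `]a, b]%classic `&` @eball R n))%E.
  move=> ab; have := initial b; have := initial a.
  have U D : measurable D -> D `<=` @eball R n ->
      exists x y : R, [/\ lam n (E `]-oo, a]%classic `&` D) = x%:E,
      lam n (E `]a, b]%classic `&` D) = y%:E &
      lam n (E `]-oo, b]%classic `&` D) = (x + y)%:E].
    move=> mD DB.
    have f1 : lam n (E `]-oo, a]%classic `&` D) \is a fin_num.
      rewrite ge0_fin_numE//; apply: Bfin => [|x [_ /DB]//].
      by apply: measurableI => //; exact: mEI.
    have f2 : lam n (E `]a, b]%classic `&` D) \is a fin_num.
      rewrite ge0_fin_numE//; apply: Bfin => [|x [_ /DB]//].
      by apply: measurableI => //; exact: mEI.
    exists (fine (lam n (E `]-oo, a]%classic `&` D))).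
    exists (fine (lam n (E `]a, b]%classic `&` D))).
    rewrite EFinD !fineK//; split => //.
    rewrite -measureU.
    - congr (lam n _); apply/seteqP; split => x; rewrite /E/= !in_itv/=.
        move=> [xb Dx]; have [xa|xa] := leP (enorm x) a; first by left.
        by right; rewrite xb.
      by move=> [[xa Dx]|[/andP[_ xb] Dx]]//; split => //; exact: le_trans xa _.
    - by apply: measurableI => //; exact: mEI.
    - by apply: measurableI => //; exact: mEI.
    - apply/seteqP; split => // x [[+ _] [+ _]]; rewrite /E/= !in_itv/=.
      by move=> xa /andP[ax _]; move: (lt_le_trans ax xa); rewrite ltxx.
  have [x [y [-> -> ->]]] := U _ mCB (@subIsetr _ _ _).
  have [x' [y' [-> -> ->]]] := U _ mB (@subset_refl _ _).
  rewrite -!EFinM => -[H] [H']; congr EFin.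
  by rewrite !mulrDr H in H'; exact: addrI H'.
apply: eq_measure_integral => A mA _.
apply: (@measure_unique _ R (measurableTypeR R) (@ocitv R)
  (fun k : nat => `](- k%:R), k%:R]%classic)) => //.
- exact: ocitvI.
- by move=> k; exact: is_ocitv.
- apply/seteqP; split => // x _; exists (Num.truncn `|x|).+1 => //=.
  have := truncnS_gt `|x|; rewrite in_itv/= => H.
  have := ler_norm x; have := ler_norm (- x); rewrite normrN => ? ?.
  by apply/andP; split; lra.
- move=> _ [[a b] _ <-]; have [ab|ab] := leP a b; first exact: mono.
  by rewrite set_itv_ge ?measure0// bnd_simp -leNgt ltW.
- move=> k; apply: (@le_lt_trans _ _ ((kap n)%:E * lam n (@eball R n))%E).
    apply: lee_wpmul2l => //; apply: le_measure; rewrite ?inE//.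
      by apply: measurableI => //; exact: mEI.
    by move=> x [_ []].
  by rewrite lebesgue_row_eball -EFinM ltry.
Qed.

End radial_integrals.

(** * Upper bound for the caps of the beta distribution *)

Section beta_tails.
Context {R : realType}.
Local Notation lam := (@lebesgue_row R).
Local Notation kap := (@ball_volume R).
Implicit Types (n : nat) (b r : R).

Definition beta_weight b (t : R) : \bar R := ((1 - t ^+ 2) `^ b)%:E.

Definition beta_mass n b (A : set 'rV[R]_n) : \bar R :=
  (\int[lam n]_(x in A `&` @eball R n) beta_weight b (enorm x))%E.

Lemma beta_weight_ge0 b t : (0 <= beta_weight b t)%E.
Proof. by rewrite lee_fin powR_ge0. Qed.

Lemma measurable_beta_weight b : measurable_fun setT (beta_weight b).
Proof.
apply/measurable_EFinP; apply: (measurableT_comp (measurable_powR b)).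
by apply: measurable_funB => //; exact: measurable_funX.
Qed.

Lemma measurable_beta_weight_enorm n b :
  measurable_fun setT (fun x : 'rV[R]_n => beta_weight b (enorm x)).
Proof.
apply: (measurableT_comp (measurable_beta_weight b)).
exact: measurable_enorm.
Qed.

Lemma beta_mass_ge0 n b A : (0 <= @beta_mass n b A)%E.
Proof. by apply: integral_ge0 => x _; exact: beta_weight_ge0. Qed.

Lemma beta_mass_le n b A A' : measurable A -> measurable A' ->
  A `&` @eball R n `<=` A' -> (beta_mass b A <= beta_mass b A')%E.
Proof.
move=> mA mA' AA'; apply: ge0_subset_integral.
- by apply: measurableI => //; exact: measurable_eball.
- by apply: measurableI => //; exact: measurable_eball.
- by apply: measurable_funTS; exact: measurable_beta_weight_enorm.
- by move=> x _; exact: beta_weight_ge0.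
- by move=> x [Ax Bx]; split => //; exact: AA'.
Qed.

Lemma beta_mass_const n b (A : set 'rV[R]_n) (w : R) :
  measurable A -> 0 <= w -> 
  (forall x, A x -> eball x -> (1 - enorm x ^+ 2) `^ b <= w) ->
  (beta_mass b A <= w%:E * lam n (A `&` @eball R n))%E.
Proof.
move=> mA w0 Aw; have mAB : measurable (A `&` @eball R n).
  by apply: measurableI => //; exact: measurable_eball.
rewrite -integral_cst//; apply: ge0_le_integral => //.
- by move=> x _; exact: beta_weight_ge0.
- by apply: measurable_funTS; exact: measurable_beta_weight_enorm.
- by move=> x [Ax Bx]; rewrite lee_fin Aw.
Qed.

Lemma beta_mass_const_ge n b (A : set 'rV[R]_n) (w : R) :
  measurable A -> 0 <= w -> A `<=` @eball R n ->
  (forall x, A x -> w <= (1 - enorm x ^+ 2) `^ b) ->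
  (w%:E * lam n A <= beta_mass b A)%E.
Proof.
move=> mA w0 AB Aw; rewrite /beta_mass (setIidl AB).
rewrite -integral_cst//; apply: ge0_le_integral => //.
- by apply: measurable_funTS; exact: measurable_beta_weight_enorm.
Qed.

(** In the extended reals 0 / 0 = +oo / +oo = 0, so a total mass 1 forces the
    normalizing integral to be finite and positive. *)
Lemma beta_lawE n b : @beta_law R n b setT = 1%E ->
  exists z : R, [/\ 0 < z, beta_mass b [set: 'rV[R]_n] = z%:E &
    forall A : set 'rV[R]_n, beta_law b A = (beta_mass b A * (z^-1)%:E)%E].
Proof.
have massE A : @beta_law R n b A = (beta_mass b A / beta_mass b [set: 'rV[R]_n])%E.
  by rewrite /beta_law /beta_mass setTI.
rewrite massE => b1; have := @beta_mass_ge0 n b setT.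
move: b1 massE; case: (beta_mass b [set: 'rV[R]_n]) => [z||]// b1 massE z0.
  have {}z0 : 0 < z.
    rewrite lt_def -lee_fin z0 andbT; apply/eqP => z0'; move: b1.
    by rewrite z0' mul0e => /eqP; rewrite eqe eq_sym oner_eq0.
  exists z; split => // A; rewrite massE inver gt_eqF//.
by move: b1; rewrite invey mule0 => /eqP; rewrite eqe eq_sym oner_eq0.
Qed.

Definition cap n (u : 'rV[R]_n) r : set 'rV[R]_n := [set x | r <= dot x u].

Definition circular_cone n (u : 'rV[R]_n) r : set 'rV[R]_n :=
  [set x | r * enorm x <= dot x u].

Lemma measurable_cap n (u : 'rV[R]_n) r : measurable (cap u r).
Proof. by apply: measurable_ler => //; exact: measurable_dot. Qed.

(** The cap is contained in the translate by r *: u of a ball of radius rho,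
    and the density there is at most the density of the scaled beta
    distribution. *)
Lemma beta_mass_cap_le n b r (rho : R) (u : 'rV[R]_n) :
  0 <= b -> 0 <= r -> 0 < rho -> r ^+ 2 + rho ^+ 2 = 1 -> dot u u = 1 ->
  (beta_mass b (cap u r) <=
   ((rho ^+ 2) `^ b * rho ^+ n)%:E * beta_mass b [set: 'rV[R]_n])%E.
Proof.
move=> b0 r0 rho0 r1 u1.
have mw := measurable_beta_weight_enorm b (n := n).
have mB := @measurable_eball R n.
have mcap : measurable (cap u r `&` @eball R n).
  by apply: measurableI => //; exact: measurable_cap.
rewrite /beta_mass setTI integral_mkcond [in leRHS]integral_mkcond.
set f := (_ \_ (cap u r `&` _))%R.
set g := (_ \_ @eball R n)%R.
have f0 x : (0 <= f x)%E.
  by apply: erestrict_ge0 => y _; exact: beta_weight_ge0.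
have g0 x : (0 <= g x)%E.
  by apply: erestrict_ge0 => y _; exact: beta_weight_ge0.
have mf : measurable_fun setT f.
  exact: ((measurable_restrictT _ mcap).1 (measurable_funTS mw)).
have mg : measurable_fun setT g.
  exact: ((measurable_restrictT _ mB).1 (measurable_funTS mw)).
have mphi : measurable_fun setT (fun y : 'rV[R]_n => r *: u + rho *: y).
  by apply: measurable_rowD => //; exact: measurable_rowZ.
rewrite (ge0_integral_affine (r *: u) rho0 mf f0).
have rn0 : 0 <= rho ^+ n by rewrite exprn_ge0// ltW.
rewrite (_ : (_ * _)%:E = (rho ^+ n)%:E * ((rho ^+ 2) `^ b)%:E)%E; last first.
  by rewrite -EFinM mulrC.
rewrite -muleA; apply: lee_wpmul2l; first by rewrite lee_fin.
rewrite -ge0_integralZl//; last by rewrite lee_fin powR_ge0.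
apply: ge0_le_integral => //.
- exact: (measurableT_comp mf mphi).
- exact: emeasurable_funM.
move=> y _; rewrite /f patchE; case: ifPn => [|_]; last first.
  by rewrite mule_ge0// lee_fin powR_ge0.
rewrite inE /cap => -[/=]; rewrite dotDl !dotZl u1 mulr1 lerDl pmulr_rge0// => yu.
have normE : enorm (r *: u + rho *: y) ^+ 2 =
    r ^+ 2 + rho ^+ 2 * enorm y ^+ 2 + 2 * r * rho * dot y u.
  rewrite !sqr_enorm !(dotDl, dotDr, dotZl, dotZr) u1 (dotC u y); ring.
have yu' : 0 <= 2 * r * rho * dot y u.
  by rewrite mulr_ge0// mulr_ge0 ?mulr_ge0// ltW.
rewrite /eball/= => xB.
have xB2 : enorm (r *: u + rho *: y) ^+ 2 <= 1.
  by rewrite exprn_ile1// enorm_ge0.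
have rho2 : 0 < rho ^+ 2 by rewrite exprn_gt0.
have yB : enorm y ^+ 2 <= 1.
  by rewrite -(ler_pM2l rho2) mulr1; lra.
have yB' : eball y.
  by rewrite /eball/= -(ler_pXn2r (n := 2))// ?nnegrE ?enorm_ge0// expr1n.
rewrite /g patchE mem_set// /beta_weight -EFinM lee_fin -powRM ?(ltW rho2) ?subr_ge0//.
apply: ge0_ler_powR; rewrite ?nnegrE ?subr_ge0//.
  by rewrite mulr_ge0 ?(ltW rho2)// subr_ge0.
by rewrite normE; lra.
Qed.

Lemma beta_mass_cone n b (C : set 'rV[R]_n) :
  (0 < n)%N -> measurable C -> (forall a x, 0 < a -> C x -> C (a *: x)) ->
  ((kap n)%:E * beta_mass b C = lam n (C `&` @eball R n) * beta_mass b [set: 'rV[R]_n])%E.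
Proof.
move=> n0 mC hC; rewrite /beta_mass setTI radial_integral_cone//.
- exact: measurable_beta_weight.
- exact: beta_weight_ge0.
Qed.

Lemma measurable_circular_cone n (u : 'rV[R]_n) r :
  measurable (circular_cone u r).
Proof.
apply: measurable_ler => //; last exact: measurable_dot.
by apply: measurable_funM => //; exact: measurable_enorm.
Qed.

Lemma circular_cone_homogeneous n (u : 'rV[R]_n) r a x : 0 < a ->
  circular_cone u r x -> circular_cone u r (a *: x).
Proof.
by rewrite /circular_cone/= => a0 rx; rewrite enormZ gtr0_norm// dotZl mulrCA ler_pM2l.
Qed.

(** A point x of the ball in the cone satisfies
    |x - r u|^2 <= |x|^2 - 2 r^2 |x| + r^2, a convex function of |x| that is
    at most rho^2 at 0 and at 1. *)
Lemma circular_cone_volume_le n r (rho : R) (u : 'rV[R]_n) :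
  0 < rho -> r ^+ 2 <= rho ^+ 2 -> r ^+ 2 + rho ^+ 2 = 1 ->
  0 <= r -> dot u u = 1 ->
  (lam n (circular_cone u r `&` @eball R n) <=
   (rho ^+ n * kap n)%:E)%E.
Proof.
move=> rho0 rrho r1 r0 u1; rewrite -(lebesgue_row_cball (r *: u) rho0).
have mC := measurable_circular_cone u r.
apply: le_measure; rewrite ?inE; [|exact: measurable_cball|].
  by apply: measurableI => //; exact: measurable_eball.
move=> x [/= xC xB]; rewrite /cball/= enorm_le ?(ltW rho0)//.
rewrite !(dotBl, dotBr, dotZl, dotZr) u1 (dotC u x) -sqr_enorm.
rewrite /eball/= in xB; rewrite /circular_cone/= in xC.
have := enorm_ge0 x; move: (enorm x) xC xB => t xC t1 t0.
have : r * (r * t) <= r * dot x u by exact: ler_wpM2l.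
have : t * t <= t by rewrite ler_piMl.
have : 0 <= (rho ^+ 2 - r ^+ 2) * (1 - t) by rewrite mulr_ge0 ?subr_ge0.
have : (r ^+ 2 + rho ^+ 2) * t = t by rewrite r1 mul1r.
by move: r1; rewrite !expr2; lra.
Qed.

(** For b >= 0 the cap is compared with a ball of radius
    rho = sqrt(1 - r^2) <= exp(- r^2 / 2). For b < 0, where the density is
    unbounded, the cap is contained in a cone, of which the distribution has
    the same share as Lebesgue measure on the ball. *)
Lemma beta_law_cap_le n b r (u : 'rV[R]_n) : (0 < n)%N ->
  @beta_law R n b setT = 1%E -> 0 < r -> r ^+ 2 <= 2^-1 -> dot u u = 1 ->
  (beta_law b (cap u r) <=
   (expR (- (r ^+ 2 * (Num.max b 0 + n%:R / 2))))%:E)%E.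
Proof.
move=> n0 /beta_lawE[z [z0 zE ->]] r0 r2 u1.
pose rho := Num.sqrt (1 - r ^+ 2).
have rho2 : rho ^+ 2 = 1 - r ^+ 2 by rewrite sqr_sqrtr//; lra.
have rho0 : 0 < rho by rewrite sqrtr_gt0; lra.
have r1 : r ^+ 2 + rho ^+ 2 = 1 by rewrite rho2; ring.
have rhoe : rho <= expR (- (r ^+ 2 / 2)).
  rewrite -(ler_pXn2r (n := 2))// ?nnegrE ?expR_ge0 ?(ltW rho0)// -expRM_natl rho2.
  have -> : 2%:R * - (r ^+ 2 / 2) = - r ^+ 2 :> R by field.
  exact: expR_ge1Dx.
have rhon : rho ^+ n <= expR (- (r ^+ 2 * (n%:R / 2))).
  have -> : - (r ^+ 2 * (n%:R / 2)) = n%:R * - (r ^+ 2 / 2) by field.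
  by rewrite expRM_natl; apply: lerXn2r; rewrite ?nnegrE ?expR_ge0// ltW.
suff H : (beta_mass b (cap u r) <=
    (expR (- (r ^+ 2 * (Num.max b 0 + n%:R / 2))) * z)%:E)%E.
  have zi : (0 <= (z^-1)%:E)%E by rewrite lee_fin invr_ge0 ltW.
  apply: le_trans (lee_wpmul2r zi H) _.
  by rewrite -EFinM mulfK// gt_eqF.
have [b0|b0] := leP 0 b.
  apply: le_trans (beta_mass_cap_le b0 (ltW r0) rho0 r1 u1) _.
  rewrite zE -EFinM lee_fin ler_wpM2r ?(ltW z0)//.
  rewrite mulrDr opprD expRD; apply: ler_pM => //.
  - exact: powR_ge0.
  - by rewrite exprn_ge0 ?ltW.
  - have -> : - (r ^+ 2 * b) = b * - (r ^+ 2) by ring.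
    rewrite mulrC expRM; apply: ge0_ler_powR; rewrite ?nnegrE ?expR_ge0//.
      by rewrite exprn_ge0// ltW.
    by rewrite rho2; exact: expR_ge1Dx.
rewrite add0r.
have mC := measurable_circular_cone u r.
apply: (@le_trans _ _ (beta_mass b (circular_cone u r))).
  apply: beta_mass_le => //; first exact: measurable_cap.
  move=> x [/= rx xB]; apply: le_trans rx; rewrite ler_piMr ?(ltW r0)//.
have := beta_mass_cone b n0 mC (circular_cone_homogeneous (u := u) (r := r)).
have vol0 := circular_cone_volume_le rho0 _ r1 (ltW r0) u1.
rewrite zE; have k0 := ball_volume_gt0 (R := R) n.
have r2' : r ^+ 2 <= rho ^+ 2 by rewrite rho2; lra.
move=> cone; have vol := vol0 r2'.
have k0' : (0 < (kap n)%:E)%E by rewrite lte_fin.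
rewrite -(@lee_pmul2l _ (kap n)%:E)// cone.
have z0' : (0 <= z%:E)%E by rewrite lee_fin ltW.
apply: le_trans (lee_wpmul2r z0' vol) _.
rewrite -!EFinM lee_fin mulrAC [leRHS]mulrC ler_pM2r//.
by rewrite ler_pM2r.
Qed.

End beta_tails.

(** * Lower bound for the caps of the beta distribution *)

Section beta_lower_tail.
Context {R : realType}.
Local Notation lam := (@lebesgue_row R).
Local Notation kap := (@ball_volume R).
Implicit Types (n : nat) (b r : R).

Lemma beta_mass_total_le n b : 0 <= b ->
  (beta_mass b [set: 'rV[R]_n] <= (kap n)%:E)%E.
Proof.
move=> b0; rewrite -[leRHS]mul1e -lebesgue_row_eball -[X in lam n X]setTI.
apply: beta_mass_const => // x _; rewrite /eball/= => xB.
apply: (@le_trans _ _ (1 `^ b)); last by rewrite powR1.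
apply: ge0_ler_powR; rewrite ?nnegrE//.
  by rewrite subr_ge0 exprn_ile1// enorm_ge0.
by rewrite gerBl sqr_ge0.
Qed.

Lemma powR_antitone b (x y : R) : b < 0 -> 0 < x -> x <= y -> y `^ b <= x `^ b.
Proof.
move=> b0 x0 xy; have y0 := lt_le_trans x0 xy.
rewrite -[b]opprK (powRN y) (powRN x) lef_pV2 ?posrE ?powR_gt0//.
by apply: ge0_ler_powR; rewrite ?nnegrE ?oppr_ge0// ltW.
Qed.

(** The cap contains a ball of radius d / 4 at distance d / 4 from the
    sphere. *)
Lemma beta_mass_cap_ge n b (d : R) (u : 'rV[R]_n) :
  0 <= b -> 0 < d < 1 -> dot u u = 1 ->
  (((d / 4) `^ b * (d / 4) ^+ n)%:E * beta_mass b [set: 'rV[R]_n] <=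
   beta_mass b (cap u (1 - d)))%E.
Proof.
move=> b0 /andP[d0 d1] u1.
have un : enorm u = 1 by rewrite enormE u1 sqrtr1.
pose A := cball ((1 - d / 2) *: u) (d / 4).
have mA : measurable A by exact: measurable_cball.
have nA x : A x -> enorm x <= 1 - d / 4.
  move=> Ax; rewrite -[x](subrK ((1 - d / 2) *: u)).
  apply: le_trans (enormD _ _) _; rewrite enormZ un mulr1 ger0_norm; last by lra.
  by rewrite /A /cball/= in Ax; lra.
have AB : A `<=` @eball R n by move=> x /nA; rewrite /eball/=; lra.
have Acap : A `<=` cap u (1 - d).
  move=> x Ax; rewrite /cap/=.
  have := dot_le_enorm (- (x - (1 - d / 2) *: u)) u.
  rewrite enormN un mulr1 dotNl dotBl dotZl u1 mulr1.
  by rewrite /A /cball/= in Ax; lra.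
have d4 : 0 < d / 4 by lra.
apply: (@le_trans _ _ (((d / 4) `^ b * (d / 4) ^+ n)%:E * (kap n)%:E)%E).
  apply: lee_wpmul2l; last exact: beta_mass_total_le.
  by rewrite lee_fin mulr_ge0 ?powR_ge0 ?exprn_ge0// ltW.
apply: (@le_trans _ _ (beta_mass b A)); last first.
  by apply: beta_mass_le => //; [exact: measurable_cap|move=> x [/Acap]].
have -> : (((d / 4) `^ b * (d / 4) ^+ n)%:E * (kap n)%:E =
    ((d / 4) `^ b)%:E * lam n A)%E.
  by rewrite lebesgue_row_cball// -!EFinM mulrA.
apply: beta_mass_const_ge => // [|x /nA xA]; first exact: powR_ge0.
have x0 := enorm_ge0 x.
apply: ge0_ler_powR; rewrite ?nnegrE//; [exact: ltW|nra|nra].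
Qed.

(** The cone contains the ball of radius d / 8 about u / 2. *)
Lemma circular_cone_volume_ge n (d : R) (u : 'rV[R]_n) :
  0 < d < 1 -> dot u u = 1 ->
  (((d / 8) ^+ n * kap n)%:E <=
   lam n (circular_cone u (1 - d / 2) `&` @eball R n))%E.
Proof.
move=> /andP[d0 d1] u1; have un : enorm u = 1 by rewrite enormE u1 sqrtr1.
have d8 : 0 < d / 8 by lra.
rewrite -(lebesgue_row_cball (2^-1 *: u) d8).
have mC := measurable_circular_cone u (1 - d / 2).
apply: le_measure; rewrite ?inE; [exact: measurable_cball| |].
  by apply: measurableI => //; exact: measurable_eball.
move=> x; rewrite /cball/circular_cone/eball/= => xu.
have xn : enorm x <= 2^-1 + d / 8.
  rewrite -[x](subrK (2^-1 *: u)) addrC; apply: le_trans (enormD _ _) _.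
  by rewrite enormZ un mulr1 ger0_norm ?invr_ge0//; lra.
have := dot_le_enorm (- (x - 2^-1 *: u)) u.
rewrite enormN un mulr1 dotNl dotBl dotZl u1 mulr1 => xu'.
by split; nra.
Qed.

Definition outside n (s : R) : set 'rV[R]_n := [set x | s <= enorm x].

Lemma measurable_outside n s : measurable (@outside n s).
Proof. by apply: measurable_ler => //; exact: measurable_enorm. Qed.

(** For b < 0 the density increases with the norm, so the outer shells carry
    at least the share of mass that they have for Lebesgue measure. *)
Lemma beta_mass_shell_ge n b (s a z : R) : (0 < n)%N -> b < 0 ->
  0 < s < a -> a < 1 -> beta_mass b [set: 'rV[R]_n] = z%:E ->
  (((1 - s / a) * z)%:E <= beta_mass b (@outside n s))%E.
Proof.
move=> n0 b0 /andP[s0 sa] a1 zE; have a0 := lt_trans s0 sa.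
have k0 := ball_volume_gt0 (R := R) n.
pose S := @outside n s; have mS : measurable S := @measurable_outside n s.
have mSC := measurableC mS; have mB := @measurable_eball R n.
have ss : s ^+ 2 < 1 by rewrite exprn_ilt1//; lra.
pose W := (1 - s ^+ 2) `^ b.
have W0 : 0 < W by apply: powR_gt0; rewrite subr_gt0.
have sn0 : 0 < s ^+ n by rewrite exprn_gt0.
have subSC : ~` S `<=` cball 0 s.
  by move=> x; rewrite /S/outside/= => /negP; rewrite -ltNge /cball/= subr0 => /ltW.
have inner : (beta_mass b (~` S) <= (W * (s ^+ n * kap n))%:E)%E.
  apply: (@le_trans _ _ (W%:E * lam n (~` S `&` @eball R n))%E).
    apply: beta_mass_const => // [|x xs xB]; first exact: ltW.
    have := subSC x xs; rewrite /cball/= subr0 => xs'.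
    apply: powR_antitone => //; first by rewrite subr_gt0.
    by rewrite lerD2l lerN2 ler_pXn2r// nnegrE ?enorm_ge0// ltW.
  rewrite EFinM -(lebesgue_row_cball 0)//; apply: lee_wpmul2l.
    by rewrite lee_fin ltW.
  apply: le_measure; rewrite ?inE; [exact: measurableI|exact: measurable_cball|].
  by move=> x [/subSC].
have outer : ((W * ((a ^+ n - s ^+ n) * kap n))%:E <= beta_mass b S)%E.
  pose A := S `&` cball 0 a.
  have mA : measurable A by apply: measurableI => //; exact: measurable_cball.
  have AB : A `<=` @eball R n.
    by move=> x [_]; rewrite /cball/eball/= subr0 => /le_trans; apply; exact: ltW.
  apply: (@le_trans _ _ (beta_mass b A)); last first.
    by apply: beta_mass_le => // x [[]].
  apply: (@le_trans _ _ (W%:E * lam n A)%E); last first.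
    apply: beta_mass_const_ge => // [|x [xs]]; first exact: ltW.
    rewrite /cball/= subr0 => xa.
    apply: powR_antitone => //.
      by rewrite subr_gt0 exprn_ilt1 ?enorm_ge0//; lra.
    by rewrite lerD2l lerN2 ler_pXn2r// nnegrE ?enorm_ge0// ltW.
  rewrite EFinM; apply: lee_wpmul2l; first by rewrite lee_fin ltW.
  have : (lam n (cball 0 a) <= lam n A + lam n (cball 0 s))%E.
    apply: (@le_trans _ _ (lam n (A `|` cball 0 s))).
      apply: le_measure; rewrite ?inE; [exact: measurable_cball| |].
        by apply: measurableU => //; exact: measurable_cball.
      by move=> x xa; have [xS|/subSC xS] := pselect (S x); [left|right].
    by apply: measureU2 => //; exact: measurable_cball.
  rewrite !lebesgue_row_cball// -leeBlDr//.
  by rewrite -EFinB mulrBl.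
have sum : (beta_mass b S + beta_mass b (~` S) = z%:E)%E.
  rewrite -zE /beta_mass -ge0_integral_setU//=.
  - by rewrite -setIUl setUv.
  - exact: measurableI.
  - exact: measurableI.
  - by apply: measurable_funTS; exact: measurable_beta_weight_enorm.
  - by move=> x _; exact: beta_weight_ge0.
  - by apply/disj_setPS => x [[xS _] [nS _]].
move: inner outer sum (beta_mass_ge0 b S) (beta_mass_ge0 b (~` S)).
rewrite -/S.
case: (beta_mass b S) => [i| |] //; case: (beta_mass b (~` S)) => [out| |] //.
rewrite !lee_fin -EFinD => inner outer [sum] i0 out0.
have an0 : 0 < a ^+ n by rewrite exprn_gt0.
have as0 : s ^+ n <= a ^+ n by apply: lerXn2r; rewrite ?nnegrE ltW.
have oz : out * a ^+ n <= s ^+ n * z.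
  have : out * (a ^+ n - s ^+ n) <= (W * (s ^+ n * kap n)) * (a ^+ n - s ^+ n).
    by rewrite ler_wpM2r// subr_ge0.
  have : s ^+ n * (W * ((a ^+ n - s ^+ n) * kap n)) <= s ^+ n * i.
    by rewrite ler_pM2l.
  by rewrite -sum; lra.
have sa1 : 0 <= s / a <= 1.
  apply/andP; split; first by apply: divr_ge0; exact: ltW.
  by rewrite ler_pdivrMr// mul1r ltW.
have z0 : 0 <= z by rewrite -sum addr_ge0.
have : out <= s / a * z.
  apply: (@le_trans _ _ ((s / a) ^+ n * z)).
    by rewrite expr_div_n mulrAC ler_pdivlMr.
  rewrite ler_wpM2r//; case/andP: sa1 => sa0 sa1.
  by rewrite -[leRHS]expr1; apply: ler_wiXn2l.
by rewrite -sum; lra.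
Qed.

Lemma beta_mass_cone_shell n b (C : set 'rV[R]_n) (s : R) :
  (0 < n)%N -> measurable C -> (forall a x, 0 < a -> C x -> C (a *: x)) ->
  ((kap n)%:E * beta_mass b (C `&` outside s) =
   lam n (C `&` @eball R n) * beta_mass b (@outside n s))%E.
Proof.
move=> n0 mC hC; pose g := (beta_weight b \_ `[s, +oo[)%R.
have gE A : beta_mass b (A `&` outside s) =
    (\int[lam n]_(x in A `&` @eball R n) g (enorm x))%E.
  rewrite /beta_mass setIAC integral_mkcondr; apply: eq_integral => x _.
  rewrite /g !patchE; congr (if _ then _ else _).
  by apply/idP/idP; rewrite !inE/= in_itv/= andbT.
rewrite gE -[X in (_ * beta_mass b X)%E]setTI gE setTI.
apply: radial_integral_cone => //.
  exact: ((measurable_restrictT _ (measurable_itv _)).1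
    (measurable_funTS (measurable_beta_weight b))).
by move=> t; apply: erestrict_ge0 => ? _; exact: beta_weight_ge0.
Qed.

(** For b >= 0 the bound is that of a ball inside the cap. For b < 0 the cap
    contains the part of norm at least 1 - d / 2 of the cone with axis u and
    slope 1 - d / 2. *)
Lemma beta_law_cap_ge n b (d : R) (u : 'rV[R]_n) : (0 < n)%N ->
  @beta_law R n b setT = 1%E -> 0 < d < 1 -> dot u u = 1 ->
  (((d / 8) ^+ n.+1 * (d / 8) `^ (Num.max b 0))%:E <=
   beta_law b (cap u (1 - d)))%E.
Proof.
move=> n0 /beta_lawE[z [z0 zE ->]] d01 u1; have /andP[d0 d1] := d01.
have d8 : 0 < d / 8 by lra.
suff H : (((d / 8) ^+ n.+1 * (d / 8) `^ (Num.max b 0) * z)%:E <=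
    beta_mass b (cap u (1 - d)))%E.
  have zi : (0 <= (z^-1)%:E)%E by rewrite lee_fin invr_ge0 ltW.
  apply: le_trans (lee_wpmul2r zi H).
  by rewrite -EFinM mulfK// gt_eqF.
have [b0|b0] := leP 0 b.
  apply: le_trans (beta_mass_cap_ge b0 d01 u1); rewrite zE -EFinM lee_fin.
  rewrite ler_wpM2r ?(ltW z0)// mulrC; apply: ler_pM.
  - exact: powR_ge0.
  - by rewrite exprn_ge0// ltW.
  - by apply: ge0_ler_powR; rewrite ?nnegrE//; lra.
  - apply: (@le_trans _ _ ((d / 8) ^+ n)).
      by rewrite exprS ler_piMl// ?exprn_ge0//; lra.
    by apply: lerXn2r; rewrite ?nnegrE; lra.
rewrite powRr0 mulr1.
pose C := circular_cone u (1 - d / 2).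
have mC : measurable C by exact: measurable_circular_cone.
pose S := @outside n (1 - d / 2).
have mS : measurable S := @measurable_outside n (1 - d / 2).
apply: (@le_trans _ _ (beta_mass b (C `&` S))); last first.
  apply: beta_mass_le; [exact: measurableI|exact: measurable_cap|].
  move=> x [[]]; rewrite /C /S /outside/circular_cone/cap/= => xC xS _.
  by apply: le_trans xC; nra.
have k0 := ball_volume_gt0 (R := R) n.
rewrite -(@lee_pmul2l _ (kap n)%:E) ?lte_fin// beta_mass_cone_shell//; last first.
  by move=> a x; exact: circular_cone_homogeneous.
have vol := circular_cone_volume_ge d01 u1.
have sh : (((1 - (1 - d / 2) / (1 - d / 4)) * z)%:E <= beta_mass b S)%E.
  by apply: beta_mass_shell_ge => //; [apply/andP; split|]; lra.
have q0 : d / 8 <= 1 - (1 - d / 2) / (1 - d / 4).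
  have a0 : 0 < 1 - d / 4 by lra.
  rewrite -subr_ge0 (_ : _ - _ = (d / 8 + d ^+ 2 / 32) / (1 - d / 4)).
    by rewrite divr_ge0//; nra.
  by field; rewrite gt_eqF//; lra.
apply: (@le_trans _ _ (((d / 8) ^+ n * kap n)%:E * ((d / 8) * z)%:E)%E).
  by rewrite -!EFinM lee_fin exprS le_eqVlt; apply/orP; left; apply/eqP; ring.
apply: lee_pmul => //.
- by rewrite lee_fin mulr_ge0 ?exprn_ge0 ?(ltW k0)// ltW.
- by rewrite lee_fin mulr_ge0// ltW.
- apply: le_trans sh; rewrite lee_fin ler_wpM2r ?(ltW z0)//.
Qed.

End beta_lower_tail.

(** * Random polytopes *)

Section integral_bounds.
Context d (T : measurableType d) {R : realType}.
Variable mu : {measure set T -> \bar R}.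
Import HBNNSimple.

(** The integral of a nonnegative function is the supremum of the integrals
    of the simple functions below it. The intrinsic volume of a random
    polytope is compared with measurable functions in this way. *)
Lemma ge0_le_integralT (f g : T -> \bar R) :
  (forall x, 0 <= f x)%E -> (forall x, f x <= g x)%E ->
  (\int[mu]_x f x <= \int[mu]_x g x)%E.
Proof.
move=> f0 fg; have g0 x : (0 <= g x)%E by exact: le_trans (f0 x) (fg x).
rewrite !ge0_integralTE//; apply: le_ereal_sup => _ [h /= hf <-].
by exists h => //= x; exact: le_trans (hf x) (fg x).
Qed.

Lemma ge0_integral_le_negligible (N : set T) (f g : T -> \bar R) :
  measurable N -> mu N = 0%E -> (forall x, 0 <= f x)%E ->
  measurable_fun setT g -> (forall x, 0 <= g x)%E ->
  (forall x, ~ N x -> f x <= g x)%E ->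
  (\int[mu]_x f x <= \int[mu]_x g x)%E.
Proof.
move=> mN N0 f0 mg g0 fg.
rewrite ge0_integralTE//; apply: ge_ereal_sup => _ [h /= hf <-].
have h0 x : (0 <= (h x)%:E)%E by rewrite lee_fin.
have mh : measurable_fun setT (EFin \o h) by exact/measurable_EFinP.
rewrite -integralT_nnsfun.
rewrite (ge0_negligible_integral mN measurableT mh (fun x _ => h0 x) N0).
apply: (@le_trans _ _ (\int[mu]_(x in [set: T] `\` N) g x)%E).
  apply: ge0_le_integral => //.
  - exact: measurableD.
  - by move=> x _; exact: h0.
  - exact: (measurable_funTS mh).
  - exact: (measurable_funTS mg).
  - by move=> x [_ Nx]; apply: le_trans (hf x) (fg x Nx).
apply: ge0_subset_integral => //; exact: measurableD.
Qed.

Lemma measure_finite_union (I : finType) (A : I -> set T) :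
  (forall i, measurable (A i)) ->
  (mu (\bigcup_(i in [set: I]) A i) <= \sum_i mu (A i))%E.
Proof.
move=> mA; have -> : [set: I] = [set` index_enum I].
  by apply/seteqP; split => i //= _; exact: mem_index_enum.
rewrite bigcup_seq; elim: (index_enum I) => [|i s IHs].
  by rewrite !big_nil measure0.
rewrite !big_cons; apply: le_trans (measureU2 _ _ _) _ => //.
  by apply: bigsetU_measurable.
exact: leeD2l.
Qed.

End integral_bounds.

Lemma measurable_section d1 d2 (T1 : measurableType d1) (T2 : measurableType d2)
    (R : realType) (m : {sigma_finite_measure set T2 -> \bar R})
    (E : set (T1 * T2)) :
  measurable E -> measurable_fun setT (fun x => m [set y | E (x, y)]).
Proof.
move=> mE; rewrite (_ : (fun _ => _) = m \o xsection E).
  exact: measurable_fun_xsection.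
by apply/funext => x /=; rewrite xsectionE.
Qed.

(** If every direction is close to a vector along which some vertex is almost
    extremal in the unit ball, then no point of the smaller ball can be
    separated from the polytope. *)
Lemma ball_sub_hull (R : realType) n N (x : 'I_N -> 'rV[R]_n) (a e : R) :
  (0 < N)%N -> 0 <= a <= 1 -> 0 <= e -> (forall i, enorm (x i) <= 1) ->
  (forall v : 'rV[R]_n, enorm v = 1 ->
    exists2 g, enorm (g - v) <= e & exists i, (1 - a) * enorm g <= dot (x i) g) ->
  cball 0 (1 - a - 2 * e) `<=` hull x.
Proof.
move=> N0 /andP[a0 a1] e0 x1 dense z; rewrite /cball/= subr0 => zr.
have [p hp pz] := nearest_point x z N0.
have [/eqP u0|u0] := eqVneq (z - p) 0.
  by move: u0; rewrite subr_eq0 => /eqP ->.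
exfalso; pose u := z - p.
have nu0 : 0 < enorm u.
  by rewrite lt_def enorm_ge0 andbT; apply/eqP => /enorm_eq0/eqP; apply/negP.
pose v := (enorm u)^-1 *: u.
have v1 : enorm v = 1.
  by rewrite enormZ gtr0_norm ?invr_gt0// mulVf// gt_eqF.
have [g gv [i xg]] := dense v v1.
have xv : dot (x i) v < enorm z.
  apply: (@lt_le_trans _ _ (dot z v)); last first.
    by apply: le_trans (dot_le_enorm _ _) _; rewrite v1 mulr1.
  rewrite -subr_gt0 -dotBl (_ : z - x i = u - (x i - p)); last first.
    by rewrite /u; apply/rowP => j; rewrite !mxE; ring.
  rewrite /v dotZr pmulr_rgt0 ?invr_gt0// dotBl.
  have := pz i; rewrite -/u; have : 0 < dot u u by rewrite -sqr_enorm exprn_gt0.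
  by lra.
have xgv : dot (x i) g <= dot (x i) v + e.
  rewrite -lerBlDl -dotBr; apply: le_trans (dot_le_enorm _ _) _.
  by apply: le_trans gv; rewrite ler_piMl ?enorm_ge0.
have g1 : 1 - e <= enorm g.
  have gv' : enorm (v - g) <= e by rewrite -enormN opprB.
  by have := enormD (v - g) g; rewrite subrK v1; lra.
have : (1 - a) * (1 - e) <= (1 - a) * enorm g by rewrite ler_wpM2l// subr_ge0.
have : 0 <= a * e by rewrite mulr_ge0.
by lra.
Qed.

(** The points of the cube [-1, 1]^n whose coordinates are multiples of
    1 / M. *)
Definition grid (R : realType) n M (f : {ffun 'I_n -> 'I_(2 * M).+1}) : 'rV[R]_n :=
  \row_i (((f i)%:R - M%:R) / M%:R).

Lemma grid_approx (R : realType) n M (v : 'rV[R]_n) : (0 < M)%N ->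
  enorm v <= 1 ->
  exists f : {ffun 'I_n -> 'I_(2 * M).+1}, enorm (grid R f - v) <= n%:R / M%:R.
Proof.
move=> M0 v1; have MR : 0 < M%:R :> R by rewrite ltr0n.
have vi i : - 1 <= v ord0 i <= 1.
  by rewrite -ler_norml; apply: le_trans v1; exact: coord_le_enorm.
pose y i := M%:R * (v ord0 i + 1).
have y0 i : 0 <= y i by have := vi i => /andP[? ?]; rewrite mulr_ge0//; lra.
have tle i : (Num.truncn (y i))%:R <= y i by rewrite truncn_le.
have fM i : (Num.truncn (y i) < (2 * M).+1)%N.
  rewrite ltnS -(ler_nat R); apply: le_trans (tle i) _.
  have := vi i => /andP[? ?]; rewrite mulnC natrM ler_pM2l//; lra.
exists [ffun i => Ordinal (fM i)].
rewrite mulrC; apply: enorm_le_coord => i; rewrite !mxE ffunE/=.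
have t1 := tle i; have t2 := truncnS_gt (y i).
rewrite -natr1 in t2.
have -> : ((Num.truncn (y i))%:R - M%:R) / M%:R - v ord0 i =
    ((Num.truncn (y i))%:R - y i) / M%:R.
  by rewrite /y; field; rewrite gt_eqF.
have Mi : 0 < M%:R^-1 :> R by rewrite invr_gt0.
rewrite normrM (gtr0_norm Mi) -[leRHS]mul1r ler_pM2r//.
by rewrite ler_norml; apply/andP; split; lra.
Qed.

Section random_polytope.
Context {R : realType} d (T : measurableType d) (P : probability T R).
Context (n N : nat) (X : 'I_N -> {RV P >-> 'rV[R]_n}) (b : R).
Context (n0 : (0 < n)%N) (nN : (n < N)%N).
Context (law : forall i (A : set 'rV[R]_n), measurable A ->
  distribution P (X i) A = beta_law b A).
Context (indep : mutually_independent X).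
Local Notation lam := (@lebesgue_row R).
Local Notation kap := (@ball_volume R).

Let N0 : (0 < N)%N. Proof. exact: leq_trans nN. Qed.

Let law_total : @beta_law R n b setT = 1%E.
Proof.
rewrite -(law (Ordinal N0) measurableT) /distribution/pushforward.
by rewrite preimage_setT probability_setT.
Qed.

Let prob_law i (A : set 'rV[R]_n) : measurable A -> P (X i @^-1` A) = beta_law b A.
Proof. by move=> mA; rewrite -(law i mA). Qed.

Let mX i : measurable_fun setT (X i). Proof. by []. Qed.

Let mpre i (A : set 'rV[R]_n) : measurable A -> measurable (X i @^-1` A).
Proof. by move=> mA; exact: (measurable_preimageT (mX i) mA). Qed.

Definition random_hull (w : T) : set 'rV[R]_n :=
  conv_hull (range (fun i => X i w)).

Definition escape : set T := \bigcup_(i in [set: 'I_N]) X i @^-1` (~` @eball R n).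

Lemma measurable_escape : measurable escape.
Proof.
apply: fin_bigcup_measurable => // i _; apply: mpre.
by apply: measurableC; exact: measurable_eball.
Qed.

Lemma escape_null : P escape = 0%E.
Proof.
apply: le_anti; rewrite measure_ge0 andbT.
apply: (@le_trans _ _ (\sum_(i < N) P (X i @^-1` (~` @eball R n)))%E).
  apply: measure_finite_union => i; apply: mpre.
  by apply: measurableC; exact: measurable_eball.
rewrite big1// => i _; rewrite prob_law; last first.
  by apply: measurableC; exact: measurable_eball.
by rewrite /beta_law setICl integral_set0 mul0e.
Qed.

Lemma hull_sub_ball w : ~ escape w -> random_hull w `<=` @eball R n.
Proof.
move=> nw; rewrite /random_hull conv_hullE => p; apply: enorm_hull => i.
by apply: contrapT => Xiw; apply: nw; exists i.
Qed.

Lemma measurable_random_body w t : 0 <= t ->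
  measurable [set x + t *: y | x in random_hull w & y in @eball R n].
Proof. by move=> t0; rewrite /random_hull conv_hullE; exact: measurable_parallel_body. Qed.

(** For z = x + t y one has |z|^2 <= <x, z> + t |z|. If |z| > t + r, then
    <x, z> > r |z|, and the linear form <., z> is at least as large at some
    vertex. *)
Lemma parallel_body_sub w (t r : R) : ~ escape w -> 0 < t -> 0 < r ->
  [set x + t *: y | x in random_hull w & y in @eball R n] `<=`
  cball 0 (t + r) `|` \bigcup_(i in [set: 'I_N])
    [set z | cball 0 (t + 1) z /\ 0 < enorm z /\ r * enorm z <= dot (X i w) z].
Proof.
move=> nw t0 r0 z [x hx [y yB <-{z}]]; set z := x + t *: y.
have xB := hull_sub_ball nw hx; rewrite /eball/= in xB yB.
have [zr|zr] := leP (enorm z) (t + r); first by left; rewrite /cball/= subr0.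
right; apply: contrapT => H.
have z0 : 0 < enorm z by apply: lt_trans zr; exact: addr_gt0.
have zt : enorm z <= t + 1.
  apply: le_trans (enormD _ _) _; rewrite addrC; apply: lerD => //.
  by rewrite enormZ gtr0_norm// ler_piMr// ltW.
have Xz i : dot (X i w) z <= r * enorm z.
  rewrite leNgt; apply/negP => Hi; apply: H; exists i => //; split; last split => //.
    by rewrite /cball/= subr0.
  exact: ltW.
have : dot x z <= r * enorm z.
  by move: hx; rewrite /random_hull conv_hullE => hx; exact: dot_hull hx Xz.
have yz : dot y z <= enorm z.
  by apply: le_trans (dot_le_enorm _ _) _; rewrite ler_piMl// enorm_ge0.
have : dot z z = dot x z + t * dot y z by rewrite {1}/z dotDl dotZl.
rewrite -sqr_enorm; have : t * dot y z <= t * enorm z by rewrite ler_pM2l.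
nra.
Qed.

Lemma prob_direction i (z : 'rV[R]_n) (r : R) : 0 < r -> r ^+ 2 <= 2^-1 ->
  0 < enorm z ->
  (P [set w | (r * enorm z <= dot (X i w) z)%R] <=
   (expR (- (r ^+ 2 * (Num.max b 0 + n%:R / 2))))%:E)%E.
Proof.
move=> r0 r2 z0; pose u := (enorm z)^-1 *: z.
have u1 : dot u u = 1.
  by rewrite dotZl dotZr -sqr_enorm expr2 mulrA; field; rewrite gt_eqF.
have -> : [set w | r * enorm z <= dot (X i w) z] = X i @^-1` cap u r.
  apply/seteqP; split => w; rewrite /cap/u/= dotZr ler_pdivlMl// mulrC//.
by rewrite prob_law; [exact: beta_law_cap_le|exact: measurable_cap].
Qed.

(** The volume of K + tB is at most that of the ball of radius t + r plus
    the volumes of the N sets of the z in the ball of radius t + 1 with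
    r |z| <= <X_i, z>; by Tonelli's theorem the expectation of the latter is an
    integral over z of probabilities of caps. *)
Lemma expectation_upper k (t r : R) : (k <= n)%N -> 0 < t -> 0 < r ->
  r ^+ 2 <= 2^-1 ->
  ('E_P[fun w => intrinsic_volume k (random_hull w)] <=
   (intrinsic_volume k (@eball R n) *
    (((t + r) ^+ n +
      N%:R * (expR (- (r ^+ 2 * (Num.max b 0 + n%:R / 2))) * (t + 1) ^+ n)) /
     ('C(n, k)%:R * t ^+ (n - k))))%:E)%E.
Proof.
move=> kn t0 r0 r2; set p := expR _; have p0 : 0 <= p by exact: expR_ge0.
have k0 := ball_volume_gt0 (R := R) n.
have VB0 := intrinsic_volume_ball_gt0 (R := R) kn.
set VB := intrinsic_volume k (@eball R n) in VB0 *.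
have C0 : 0 < 'C(n, k)%:R * t ^+ (n - k) :> R.
  by rewrite mulr_gt0 ?exprn_gt0// ltr0n bin_gt0.
set C := 'C(n, k)%:R * t ^+ (n - k) in C0 *.
pose c := VB / (C * kap n); have c0 : 0 < c by rewrite divr_gt0// mulr_gt0.
pose Z i : set (T * 'rV[R]_n) := [set wz |
  cball 0 (t + 1) wz.2 /\ 0 < enorm wz.2 /\ r * enorm wz.2 <= dot (X i wz.1) wz.2].
have t1 : 0 < t + 1 by rewrite addr_gt0.
have tr : 0 < t + r by rewrite addr_gt0.
have m2 : measurable_fun setT (snd : T * 'rV[R]_n -> _) by exact: measurable_snd.
have me2 : measurable_fun setT (fun wz : T * 'rV[R]_n => enorm wz.2).
  exact: measurable_enorm.
have mZ i : measurable (Z i).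
  apply: measurableI; first exact: (measurable_preimageT m2 (measurable_cball _ _)).
  apply: measurableI.
    rewrite [X in measurable X](_ : _ = ~` [set wz : T * 'rV[R]_n | enorm wz.2 <= 0]).
      by apply: measurableC; exact: measurable_ler.
    by apply/seteqP; split => wz /=; rewrite ltNge => /negP.
  apply: measurable_ler; first exact: measurable_funM.
  apply: measurable_dot => //.
  exact: (measurableT_comp (mX i) (@measurable_fst _ _ _ _)).
pose F i w := lam n [set z | Z i (w, z)].
have mF i : measurable_fun setT (F i) by exact: measurable_section.
have F0 i w : (0 <= F i w)%E by exact: measure_ge0.
pose G w := (lam n (cball 0 (t + r)) + \sum_i F i w)%E.
have mG : measurable_fun setT G.
  by apply: emeasurable_funD => //; exact: emeasurable_sum.
have G0 w : (0 <= G w)%E by rewrite adde_ge0// sume_ge0.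
rewrite unlock; apply: (@le_trans _ _ (\int[P]_w (c%:E * G w))%E).
  apply: (ge0_integral_le_negligible measurable_escape escape_null).
  - by move=> w; rewrite lee_fin intrinsic_volume_ge0.
  - exact: measurable_funeM.
  - by move=> w; rewrite mule_ge0// lee_fin ltW.
  move=> w nw.
  rewrite (_ : intrinsic_volume k (random_hull w) =
    c * (volume_ratio k (random_hull w) * ('C(n, k)%:R * kap n * t ^+ (n - k)))).
    rewrite EFinM; apply: lee_wpmul2l; first by rewrite lee_fin ltW.
    apply: le_trans (volume_ratio_le _ kn t0) _.
    have mSi i : measurable [set z | Z i (w, z)].
      exact: (measurable_preimageT (f := pair w) (measurable_pair1 _) (mZ i)).
    apply: (@le_trans _ _ (lam n (cball 0 (t + r) `|`
        \bigcup_(i in [set: 'I_N]) [set z | Z i (w, z)]))).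
      apply: le_measure; rewrite ?inE.
      - exact: measurable_random_body (ltW t0).
      - apply: measurableU; first exact: measurable_cball.
        exact: fin_bigcup_measurable.
      - exact: parallel_body_sub.
    apply: le_trans (measureU2 _ _ _) _; first exact: measurable_cball.
      exact: fin_bigcup_measurable.
    by apply: leeD2l; exact: measure_finite_union.
  rewrite /volume_ratio -/VB /c /C; field.
  by rewrite !gt_eqF// ?exprn_gt0 ?ltr0n ?bin_gt0.
rewrite ge0_integralZl//; last by rewrite lee_fin ltW.
rewrite ge0_integralD//; last 2 first.
- by move=> w _; exact: sume_ge0.
- exact: emeasurable_sum.
rewrite integral_cst//.
rewrite [X in (_ * X + _)%E](_ : _ = 1%E); last exact: probability_setT.
rewrite mule1 ge0_integral_sum//.
have Fp i : (\int[P]_w F i w <= p%:E * lam n (cball 0 (t + 1)))%E.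
  rewrite /F (tonelli_sections P (lam n) (mZ i)).
  have mB : measurable (cball (0 : 'rV[R]_n) (t + 1)) by exact: measurable_cball.
  rewrite -[X in lam n X]setIT -integral_indic// -ge0_integralZl//; last first.
    by apply/measurable_EFinP; exact: measurable_indic.
  apply: ge0_le_integralT => z; first exact: measure_ge0.
  rewrite indicE; have [zB|zB] := boolP (z \in cball 0 (t + 1)); last first.
    rewrite mule0 (_ : [set w | _] = set0) ?measure0//.
    by apply/seteqP; split => // w [/= zB']; move/negP : zB; rewrite inE.
  rewrite mule1; have [z0|z0] := ltP 0 (enorm z); last first.
    rewrite (_ : [set w | _] = set0) ?measure0//.
    by apply/seteqP; split => // w [_ [/=]]; rewrite ltNge z0.
  apply: le_trans (prob_direction i r0 r2 z0).
  apply: le_measure; rewrite ?inE.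
  - have mp : measurable_fun setT (fun w : T => (w, z)) by exact: measurable_pair2.
    exact: (measurable_preimageT mp (mZ i)).
  - by apply: measurable_ler => //; exact: measurable_dot.
  - by move=> w [_ []].
apply: (@le_trans _ _ (c%:E * (lam n (cball 0 (t + r)) +
    \sum_(i < N) p%:E * lam n (cball 0 (t + 1))))%E).
  apply: lee_wpmul2l; first by rewrite lee_fin ltW.
  by apply: leeD2l; apply: lee_sum => i _; exact: Fp.
rewrite !lebesgue_row_cball// -EFinM sumEFin sumr_const card_ord -EFinD -EFinM.
rewrite lee_fin -[_ *+ N]mulr_natl le_eqVlt; apply/orP; left; apply/eqP.
by rewrite /c; field; rewrite !gt_eqF.
Qed.

Definition missed M (a : R) : set T :=
  \bigcup_(f in [set: {ffun 'I_n -> 'I_(2 * M).+1}])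
    \bigcap_(i in [set: 'I_N])
      X i @^-1` [set x | dot x (grid R f) < (1 - a) * enorm (grid R f)].

Lemma measurable_halfspace (g : 'rV[R]_n) (s : R) :
  measurable [set x | dot x g < s].
Proof.
rewrite (_ : [set _ | _] = ~` [set x | s <= dot x g]).
  by apply: measurableC; apply: measurable_ler => //; exact: measurable_dot.
by apply/seteqP; split => x /=; rewrite ltNge => /negP.
Qed.

Lemma measurable_missed M (a : R) : measurable (missed M a).
Proof.
apply: fin_bigcup_measurable => // f _; apply: fin_bigcap_measurable => // i _.
by apply: mpre; exact: measurable_halfspace.
Qed.

Lemma prob_all_missed (u : 'rV[R]_n) (a q : R) : 0 <= q ->
  (q%:E <= beta_law b (cap u (1 - a)))%E ->
  (P (\bigcap_(i in [set: 'I_N]) X i @^-1` (~` cap u (1 - a))) <=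
   (expR (- (N%:R * q)))%:E)%E.
Proof.
move=> q0 qcap; have mC := measurable_cap u (1 - a).
have mCC := measurableC mC.
have := indep [set: 'I_N]%SET (fun=> mCC).
rewrite (_ : [set` _] = [set: 'I_N]); last first.
  by apply/seteqP; split => i //= _; rewrite finset.in_setT.
move=> ->.
have one i : exists y : R, 0 <= y <= 1 - q /\ P (X i @^-1` (~` cap u (1 - a))) = y%:E.
  have Pfin : P (X i @^-1` (~` cap u (1 - a))) \is a fin_num.
    by apply: fin_num_measure; exact: mpre.
  exists (fine (P (X i @^-1` (~` cap u (1 - a))))); split; last by rewrite fineK.
  rewrite fine_ge0//= -lee_fin fineK// preimage_setC probability_setC; last exact: (mpre i mC).
  by rewrite EFinB; apply: leeB => //; apply: le_trans qcap _; rewrite -(prob_law i mC).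
have [y yP] := choice one.
rewrite (eq_bigr (fun i => (y i)%:E)) => [|i _]; last by have [_ ->] := yP i.
rewrite (eq_bigl xpredT) => [|i]; last by rewrite finset.in_setT.
rewrite prodEFin lee_fin; apply: (@le_trans _ _ (\prod_(i < N) (1 - q))).
  by apply: ler_prod => i _; have [] := yP i.
rewrite prodr_const card_ord -mulrN expRM_natl.
have [/andP[y0 y1] _] := yP (Ordinal N0).
apply: lerXn2r; rewrite ?nnegrE ?expR_ge0//; first exact: le_trans y1.
exact: expR_ge1Dx.
Qed.

(** Union bound over the grid. *)
Lemma prob_missed M (a : R) : 0 < a < 1 ->
  (P (missed M a) <= ((2 * M).+1%:R ^+ n *
    expR (- (N%:R * ((a / 8) ^+ n.+1 * (a / 8) `^ (Num.max b 0)))))%:E)%E.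
Proof.
move=> a01; have /andP[a0 a1] := a01.
set q := (a / 8) ^+ n.+1 * _; set e := expR _.
have q0 : 0 <= q by rewrite mulr_ge0 ?powR_ge0// exprn_ge0// divr_ge0// ltW.
apply: le_trans (measure_finite_union _ _) _ => [f|].
  apply: fin_bigcap_measurable => // i _.
  by apply: mpre; exact: measurable_halfspace.
apply: (@le_trans _ _ (\sum_(f : {ffun 'I_n -> 'I_(2 * M).+1}) e%:E)%E); last first.
  by rewrite sumEFin sumr_const card_ffun !card_ord -natrX mulr_natl.
apply: lee_sum => f _; set g := grid R f.
have [g0|g0] := ltP 0 (enorm g); last first.
  rewrite (_ : \bigcap_(_ in _) _ = set0) ?measure0 ?lee_fin ?expR_ge0//.
  have g0' : enorm g = 0 by apply: le_anti; rewrite g0 enorm_ge0.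
  apply/seteqP; split => // w /(_ (Ordinal N0) I) /=.
  by rewrite -/g g0' (enorm_eq0 g0') dot0r mulr0 ltxx.
pose u := (enorm g)^-1 *: g.
have u1 : dot u u = 1.
  by rewrite dotZl dotZr -sqr_enorm expr2 mulrA; field; rewrite gt_eqF.
have := prob_all_missed q0 (beta_law_cap_ge n0 law_total a01 u1).
congr (P _ <= _)%E; apply: eq_bigcapr => i _; congr (_ @^-1` _).
apply/seteqP; split => x; rewrite /cap/u/= dotZr ler_pdivlMl// mulrC.
  by move/negP; rewrite -ltNge.
by rewrite ltNge => /negP.
Qed.

Lemma good_event m (a : R) w : (0 < m)%N -> 0 < a < 1 ->
  ~ escape w -> ~ missed (n * m) a w ->
  cball 0 (1 - a - 2 * m%:R^-1) `<=` random_hull w.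
Proof.
move=> m0 /andP[a0 a1] nw mw; rewrite /random_hull conv_hullE.
have mR : 0 < m%:R :> R by rewrite ltr0n.
have nR : 0 < n%:R :> R by rewrite ltr0n.
have nm0 : (0 < n * m)%N by rewrite muln_gt0 n0.
apply: ball_sub_hull => //.
- by apply/andP; split; exact: ltW.
- by move=> i; apply: contrapT => Xiw; apply: nw; exists i.
move=> v v1; have v1' : enorm v <= 1 by rewrite v1.
have [f fv] := grid_approx nm0 v1'; exists (grid R f).
  apply: le_trans fv _; rewrite natrM le_eqVlt; apply/orP; left; apply/eqP.
  by field; rewrite !gt_eqF.
apply: contrapT => H; apply: mw; exists f => // i _ /=.
by rewrite ltNge; apply/negP => H'; apply: H; exists i.
Qed.

(** On the event that every direction of the grid is nearly reached, K
    contains the ball of radius 1 - delta and V_k(K) is within a factor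
    1 +- eta of V_k(B); the complementary event has probability at most tau. *)
Lemma expectation_near k m (delta eta : R) :
  (2 * k <= n)%N -> (0 < m)%N -> 0 < delta < 1 -> 4 / delta <= m%:R ->
  0 <= eta <= 1 ->
  (forall K : set 'rV[R]_n, (exists v, steiner_coefficients K v) ->
    (forall t, 0 <= t -> measurable [set x + t *: y | x in K & y in @eball R n]) ->
    cball 0 (1 - delta) `<=` K -> K `<=` @eball R n ->
    `|volume_ratio k K - 1| <= eta) ->
  let VB := intrinsic_volume k (@eball R n) in
  let tau := (2 * (n * m)).+1%:R ^+ n * expR (- (N%:R *
    ((delta / 16) ^+ n.+1 * (delta / 16) `^ (Num.max b 0)))) in
  ((VB * ((1 - eta) * (1 - tau)))%:E <=
   'E_P[fun w => intrinsic_volume k (random_hull w)] <=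
   (VB * (1 + eta + expR 1 * (2 ^ k * k`!)%:R * tau))%:E)%E.
Proof.
move=> kn m0 /andP[d0 d1] dm /andP[eta0 eta1] sandwich.
set VB := intrinsic_volume k _; set tau := _ * expR _.
have kn' : (k <= n)%N by lia.
have VB0 : 0 < VB by exact: intrinsic_volume_ball_gt0.
pose M := missed (n * m) (delta / 2).
have mM : measurable M by exact: measurable_missed.
have a01 : 0 < delta / 2 < 1 by apply/andP; split; lra.
have PM : (P M <= tau%:E)%E.
  apply: le_trans (prob_missed _ a01) _.
  by rewrite (_ : delta / 2 / 8 = delta / 16)//; field.
have mR : 0 < m%:R :> R by rewrite ltr0n.
have dm' : 2 * m%:R^-1 <= delta / 2.
  move: dm; rewrite ler_pdivrMr// => dm.
  by rewrite ler_pdivrMr// mulrC; lra.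
have good w : ~ escape w -> ~ M w -> `|volume_ratio k (random_hull w) - 1| <= eta.
  move=> nw Mw; apply: sandwich.
  - by rewrite /random_hull conv_hullE; exact: steiner_polytope.
  - by move=> t; exact: measurable_random_body.
  - move=> z; rewrite /cball/= => zd; apply: (good_event m0 a01 nw Mw).
    by rewrite /cball/=; lra.
  - exact: hull_sub_ball.
have VE w : intrinsic_volume k (random_hull w) = VB * volume_ratio k (random_hull w).
  by rewrite /volume_ratio -/VB; field; rewrite gt_eqF.
have mesc := measurable_escape.
have mG : measurable (~` (escape `|` M)) by apply: measurableC; exact: measurableU.
have tau0 : 0 <= tau by rewrite mulr_ge0 ?expR_ge0// exprn_ge0.
rewrite unlock; apply/andP; split.
  apply: (@le_trans _ _ (\int[P]_w ((VB * (1 - eta))%:E *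
      (\1_(~` (escape `|` M)) w)%:E))%E).
    have c0 : 0 <= VB * (1 - eta) by rewrite mulr_ge0 ?subr_ge0// ltW.
    rewrite ge0_integralZl//; last first.
      by apply/measurable_EFinP; exact: measurable_indic.
    rewrite integral_indic// setIT mulrA EFinM; apply: lee_wpmul2l => //.
    have PC := probability_setC P (measurableU _ _ mesc mM).
    apply: (@le_trans _ _ (1 - P (escape `|` M))%E); last by rewrite -PC.
    rewrite EFinB; apply: leeB => //; apply: le_trans (measureU2 _ mesc mM) _.
    by have := PM; rewrite -[X in (X <= _)%E -> _]add0e -[in X in X -> _]escape_null.
  apply: ge0_le_integralT => w.
    by rewrite mule_ge0// lee_fin mulr_ge0 ?subr_ge0// ltW.
  rewrite -EFinM lee_fin indicE; have [Gw|_] := boolP (w \in _); last first.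
    by rewrite mulr0 intrinsic_volume_ge0.
  rewrite mulr1 VE ler_pM2l//; rewrite inE in Gw.
  have := good w (fun e => Gw (or_introl e)) (fun e => Gw (or_intror e)).
  by rewrite ler_norml => /andP[? _]; lra.
set c := expR 1 * _.
have c0 : 0 <= c by rewrite mulr_ge0 ?expR_ge0.
apply: (@le_trans _ _ (\int[P]_w ((VB * (1 + eta))%:E +
    (VB * c)%:E * (\1_M w)%:E))%E).
  have h1 : (0 <= (VB * (1 + eta))%:E)%E by rewrite lee_fin mulr_ge0 ?addr_ge0// ltW.
  have h2 : (0 <= (VB * c)%:E)%E by rewrite lee_fin mulr_ge0// ltW.
  apply: (ge0_integral_le_negligible mesc escape_null).
  - by move=> w; rewrite lee_fin intrinsic_volume_ge0.
  - apply: emeasurable_funD => //; apply: emeasurable_funM => //.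
    by apply/measurable_EFinP; exact: measurable_indic.
  - by move=> w; rewrite adde_ge0// mule_ge0// lee_fin.
  move=> w nw; rewrite -EFinM -EFinD lee_fin VE indicE -mulrA -mulrDr ler_pM2l//.
  have [Mw|Mw] := boolP (w \in M).
    apply: (@le_trans _ _ c); last by rewrite mulr1 lerDr addr_ge0.
    apply: volume_ratio_crude => //; first exact: hull_sub_ball.
    by move=> t; exact: measurable_random_body.
  rewrite mulr0 addr0; have Mw' : ~ M w by move: Mw => /negP; rewrite inE.
  by have := good w nw Mw'; rewrite ler_norml => /andP[_ ?]; lra.
have h1 : 0 <= VB * (1 + eta) by rewrite mulr_ge0 ?addr_ge0// ltW.
have h2 : 0 <= VB * c by rewrite mulr_ge0// ltW.
have mI : measurable_fun setT (fun w => (\1_M w : R)%:E).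
  by apply/measurable_EFinP; exact: measurable_indic.
rewrite ge0_integralD//; last 2 first.
- by move=> w _; rewrite mule_ge0.
- exact: measurable_funeM.
rewrite integral_cst// [X in (_ * X + _)%E](_ : _ = 1%E); last exact: probability_setT.
rewrite mule1 ge0_integralZl// integral_indic// setIT.
rewrite (_ : VB * (1 + eta + c * tau) = VB * (1 + eta) + VB * c * tau); last by ring.
by rewrite EFinD (EFinM (VB * c)); apply: leeD2l; apply: lee_wpmul2l.
Qed.

End random_polytope.

(** * The limits *)

Section growth.
Context {R : realType}.

Lemma cvg_ereal_within (u : nat -> \bar R) (l : R) :
  (forall e : R, 0 < e -> \forall n \near \oo, ((l - e)%:E <= u n <= (l + e)%:E)%E) ->
  u n @[n --> \oo] --> l%:E.
Proof.
move=> H; apply/fine_cvgP; split.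
  have := H 1 ltr01; apply: filterS => n /andP[].
  by case: (u n) => //=; rewrite ?leNye ?leye_eq.
apply/cvgrPdist_le => e e0; have := H e e0; apply: filterS => n /=.
case: (u n) => [s| |] /=; rewrite ?leye_eq ?andbF//.
by rewrite !lee_fin distrC => /andP[? ?]; rewrite ler_distl; apply/andP.
Qed.

Lemma ediv_le (E : \bar R) (v c : R) : 0 < v ->
  (E <= (v * c)%:E)%E -> (E / v%:E <= c%:E)%E.
Proof.
move=> v0 H; rewrite inver gt_eqF//.
have vi : (0 <= (v^-1)%:E)%E by rewrite lee_fin invr_ge0 ltW.
by apply: le_trans (lee_wpmul2r vi H) _; rewrite -EFinM mulrAC divff ?mul1r// gt_eqF.
Qed.

Lemma ediv_ge (E : \bar R) (v c : R) : 0 < v ->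
  ((v * c)%:E <= E)%E -> (c%:E <= E / v%:E)%E.
Proof.
move=> v0 H; rewrite inver gt_eqF//.
have vi : (0 <= (v^-1)%:E)%E by rewrite lee_fin invr_ge0 ltW.
by apply: le_trans (lee_wpmul2r vi H); rewrite -EFinM mulrAC divff ?mul1r// gt_eqF.
Qed.

(** The parameter of the beta distribution that is the image of the given one
    under an orthogonal projection onto a k-dimensional subspace. *)
Definition projected_beta (b : R) (n k : nat) : R := b + (n%:R - k%:R) / 2.

Lemma projected_beta_large (beta : nat -> R) (k : nat) (A : R) :
  (forall n, -1 < beta n) -> \forall n \near \oo, A <= projected_beta (beta n) n k.
Proof.
move=> hb; have := nbhs_infty_ger (2 * (A + 1) + k%:R).
apply: filterS => n nA; rewrite /projected_beta; have := hb n.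
by lra.
Qed.

Lemma exp_log_large (x : nat -> R) (c A : R) : 0 < c ->
  (forall B, \forall n \near \oo, B <= x n) ->
  \forall n \near \oo, A <= expR (c * ln (x n)).
Proof.
move=> c0 hx; have := hx (expR (A / c)); apply: filterS => n xA.
have x0 : 0 < x n by apply: lt_le_trans xA; exact: expR_gt0.
have : A / c <= ln (x n) by rewrite -(expRK (A / c)) ler_ln// posrE expR_gt0.
rewrite ler_pdivrMr// mulrC => H.
by apply: le_trans H _; have := expR_ge1Dx (c * ln (x n)); lra.
Qed.

(** With r = 1 / y and t = n r the two powers of the expectation bound are at
    most e t^n and exp(y) t^n. The number of points and the probability of a
    cap contribute exp(A) and exp(- A y), and A + y - A y <= 0 because
    (A - 1) (y - 1) >= 1. *)
Lemma upper_bound_small n k N (b y A : R) : (0 < n)%N -> (2 * k <= n)%N ->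
  (1 <= k)%N -> 2 <= y -> 2 <= A ->
  projected_beta b n k = A * y ^+ 3 -> N%:R <= expR A ->
  ((n%:R / y + y^-1) ^+ n +
      N%:R * (expR (- (y^-1 ^+ 2 * (Num.max b 0 + n%:R / 2))) * (n%:R / y + 1) ^+ n)) /
     ('C(n, k)%:R * (n%:R / y) ^+ (n - k)) <= (2 ^ k * k`!)%:R * (expR 1 + 1) / y.
Proof.
move=> n0 kn k1 y2 A2 xE NA; set r := y^-1; set t := n%:R * r.
have y0 : 0 < y by lra.
have r0 : 0 < r by rewrite invr_gt0.
have nR : 0 < n%:R :> R by rewrite ltr0n.
have t0 : 0 < t by rewrite mulr_gt0.
have kn' : (k <= n)%N by lia.
have tn0 : 0 < t ^+ n by rewrite exprn_gt0.
have e1 : (t + r) ^+ n <= t ^+ n * expR 1.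
  have -> : t + r = t * (1 + 1 / n%:R) by rewrite /t; field; rewrite gt_eqF.
  by rewrite exprMn ler_pM2l// exprn_le_expR.
have e2 : (t + 1) ^+ n <= t ^+ n * expR y.
  have -> : t + 1 = t * (1 + y / n%:R) by rewrite /t /r; field; rewrite !gt_eqF.
  by rewrite exprMn ler_pM2l// exprn_le_expR// ltW.
set p := expR (- _).
have pN : N%:R * p * expR y <= 1.
  apply: (@le_trans _ _ (expR A * p * expR y)).
    by rewrite ler_pM2r ?expR_gt0// ler_pM2r ?expR_gt0.
  rewrite /p -!expRD -[leRHS]expR0 ler_expR.
  have xm : A * y ^+ 3 <= Num.max b 0 + n%:R / 2.
    rewrite -xE /projected_beta; have : b <= Num.max b 0 by rewrite le_max lexx.
    have : 0 <= k%:R :> R by [].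
    lra.
  have : r ^+ 2 * (A * y ^+ 3) <= r ^+ 2 * (Num.max b 0 + n%:R / 2).
    by rewrite ler_pM2l// exprn_gt0.
  have -> : r ^+ 2 * (A * y ^+ 3) = A * y by rewrite /r; field; rewrite gt_eqF.
  move: (r ^+ 2 * _) => q; nra.
have e3 : N%:R * (p * (t + 1) ^+ n) <= t ^+ n.
  apply: (@le_trans _ _ (N%:R * (p * (t ^+ n * expR y)))).
    by rewrite ler_wpM2l// ler_pM2l// expR_gt0.
  have -> : N%:R * (p * (t ^+ n * expR y)) = t ^+ n * (N%:R * p * expR y) by ring.
  by rewrite ler_piMr// ltW.
have C0 : 0 < 'C(n, k)%:R :> R by rewrite ltr0n bin_gt0.
have tk : 0 < t ^+ (n - k) by rewrite exprn_gt0.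
rewrite ler_pdivrMr ?mulr_gt0//.
apply: (@le_trans _ _ (t ^+ n * (expR 1 + 1))).
  by rewrite mulrDr mulr1; exact: lerD.
have Ck := bin_lowerR (R := R) n0 kn.
set D := (2 ^ k * k`!)%:R in Ck *.
have -> : t ^+ n = t ^+ (n - k) * t ^+ k by rewrite -exprD subnK.
have -> : D * (expR 1 + 1) * r * ('C(n, k)%:R * t ^+ (n - k)) =
    t ^+ (n - k) * (D * 'C(n, k)%:R * r) * (expR 1 + 1) by ring.
rewrite ler_pM2r ?addr_gt0 ?expR_gt0// ler_pM2l//.
rewrite /t exprMn; apply: (@le_trans _ _ (n%:R ^+ k * r)).
  rewrite ler_pM2l ?exprn_gt0// -[leRHS]expr1; apply: ler_wiXn2l => //; first exact: ltW.
  by rewrite invf_le1//; lra.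
rewrite ler_pM2r//.
have nk0 : 0 < n%:R ^+ k :> R by rewrite exprn_gt0.
by move: Ck; rewrite mulrAC ler_pdivlMr// mul1r mulrC.
Qed.

Lemma expR_cube (x : R) : 0 <= x -> x ^+ 3 / 27 <= expR x.
Proof.
move=> x0; have -> : x = 3%:R * (x / 3) by field.
rewrite expRM_natl; have := expR_ge1Dx (x / 3) => H.
apply: (@le_trans _ _ ((x / 3) ^+ 3)).
  by rewrite le_eqVlt; apply/orP; left; apply/eqP; field.
apply: lerXn2r; rewrite ?nnegrE ?expR_ge0 ?divr_ge0//.
by lra.
Qed.

(** A direction of the net is missed with probability at most exp(- N q),
    where q = exp(- O(x)) and hence N q >= exp(x); the net has exp(O(x^2))
    elements. *)
Lemma net_bound_small n k N m (b delta y x : R) : -1 < b -> 0 < delta < 1 ->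
  x = projected_beta b n k -> expR (x * y) <= N%:R ->
  1 <= x -> - ln (delta / 16) * (k%:R + 5) + 1 <= y ->
  27 * (2 * m%:R * (k%:R + 4) ^+ 2 + 1) <= x ->
  (2 * (n * m)).+1%:R ^+ n * expR (- (N%:R *
    ((delta / 16) ^+ n.+1 * (delta / 16) `^ (Num.max b 0)))) <= expR (- x).
Proof.
move=> b1 /andP[d0 d1] xE xN x1.
set L := - ln (delta / 16); set c := 2 * m%:R * (k%:R + 4) ^+ 2 => yL cx.
have d16 : 0 < delta / 16 by lra.
have L0 : 0 < L by rewrite oppr_gt0 ln_lt0//; apply/andP; split; lra.
have dE : delta / 16 = expR (- L) by rewrite opprK lnK.
have k0 : 0 <= k%:R :> R by [].
have n0 : 0 <= n%:R :> R by [].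
have m0 : 0 <= m%:R :> R by [].
have nmax : n%:R + 1 + Num.max b 0 <= (k%:R + 5) * x.
  have : n%:R + 1 + Num.max b 0 <= 2 * x + k%:R + 3.
    by rewrite xE /projected_beta; case: (leP b 0) => ?; lra.
  nra.
have nx : n%:R <= (k%:R + 4) * x.
  have : n%:R <= 2 * x + k%:R + 2 by rewrite xE /projected_beta; lra.
  nra.
have qE : (delta / 16) ^+ n.+1 * (delta / 16) `^ (Num.max b 0) =
    expR (- (L * (n%:R + 1 + Num.max b 0))).
  rewrite dE -expRM -expRM_natl -expRD -natr1; congr expR; ring.
have Nq : expR x <= N%:R * ((delta / 16) ^+ n.+1 * (delta / 16) `^ (Num.max b 0)).
  rewrite qE; apply: (@le_trans _ _ (expR (x * y) * expR (- (L * (n%:R + 1 + Num.max b 0))))).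
    rewrite -expRD ler_expR.
    have : L * (n%:R + 1 + Num.max b 0) <= L * ((k%:R + 5) * x) by rewrite ler_pM2l.
    have : x * (L * (k%:R + 5) + 1) <= x * y by rewrite ler_pM2l//; lra.
    lra.
  by rewrite ler_pM2r ?expR_gt0.
have card : (2 * (n * m)).+1%:R ^+ n <= expR (c * x ^+ 2).
  apply: (@le_trans _ _ (expR (2 * (n%:R * m%:R)) ^+ n)).
    apply: lerXn2r; rewrite ?nnegrE ?expR_ge0//.
    by rewrite -natr1 natrM natrM addrC; exact: expR_ge1Dx.
  rewrite -expRM_natl ler_expR.
  have -> : n%:R * (2 * (n%:R * m%:R)) = 2 * m%:R * n%:R ^+ 2 :> R by ring.
  rewrite /c -[leRHS]mulrA -exprMn; apply: ler_wpM2l; first by rewrite mulr_ge0.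
  by apply: lerXn2r; rewrite ?nnegrE// mulr_ge0//; lra.
apply: (@le_trans _ _ (expR (c * x ^+ 2) * expR (- expR x))).
  by apply: ler_pM; rewrite ?exprn_ge0 ?expR_ge0// ler_expR lerN2.
rewrite -expRD ler_expR.
have x0 : 0 <= x by lra.
have := expR_cube x0.
have : x ^+ 2 * (27 * (c + 1)) <= x ^+ 2 * x by rewrite ler_wpM2l// sqr_ge0.
have : x <= x ^+ 2 by rewrite expr2 ler_peMr.
rewrite exprSr; lra.
Qed.

End growth.

Unset Implicit Arguments.

Theorem theorem1p4 (R : realType) (eps : R) (k : nat)
    (beta : nat -> R) (N : nat -> nat)
    (d : nat -> measure_display) (T : forall n, measurableType (d n))
    (P : forall n, probability (T n) R)
    (X : forall n, 'I_(N n) -> {RV (P n) >-> 'rV[R]_n})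
    (heps : 0 < eps < 1) (hk : (1 <= k)%N)
    (hbeta : forall n, -1 < beta n) (hN : forall n, (n < N n)%N)
    (hlaw : forall n (i : 'I_(N n)) (A : set 'rV[R]_n), measurable A ->
      distribution (P n) (X n i) A = beta_law (beta n) A)
    (hindep : forall n, mutually_independent (X n)) :
  let ratio (n : nat) : \bar R :=
    ('E_(P n)[fun w => intrinsic_volume k (conv_hull (range (fun i => X n i w)))]
     / (intrinsic_volume k (@eball R n))%:E)%E in
  ((\forall n \near \oo,
      expR (expR ((1 + eps) * ln (beta n + (n%:R - k%:R) / 2))) <= (N n)%:R) ->
    ratio n @[n --> \oo] --> 1%E) /\
  ((\forall n \near \oo,
      (N n)%:R <= expR (expR ((1 - eps) * ln (beta n + (n%:R - k%:R) / 2)))) ->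
    ratio n @[n --> \oo] --> 0%E).
Proof.
move=> ratio; have /andP[eps0 eps1] := heps.
pose x n := projected_beta (beta n) n k.
have xlarge B : \forall n \near \oo, B <= x n by exact: projected_beta_large.
have powlarge B : \forall n \near \oo, B <= expR (eps * ln (x n)).
  exact: exp_log_large.
have powlarge3 B : \forall n \near \oo, B <= expR (eps / 3 * ln (x n)).
  by apply: exp_log_large => //; lra.
have powlarge1 B : \forall n \near \oo, B <= expR ((1 - eps) * ln (x n)).
  by apply: exp_log_large => //; lra.
have lnxK n : 1 <= x n -> expR (ln (x n)) = x n.
  by move=> x1; rewrite lnK// posrE; lra.
have nlarge : \forall n \near \oo, (0 < n)%N /\ (2 * k <= n)%N.
  near=> n; split; near: n; [exact: nbhs_infty_gt|exact: nbhs_infty_ge].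
split=> hNn; apply: cvg_ereal_within => e e0.
- pose eta := Num.min 1 (e / 2).
  have eta0 : 0 < eta by rewrite lt_min ltr01 divr_gt0.
  have eta1 : eta <= 1 by rewrite /eta ge_min lexx.
  have etae : eta <= e / 2 by rewrite /eta ge_min lexx orbT.
  have [delta d01 sandwich] := volume_ratio_sandwich k eta0.
  pose m := (Num.truncn (4 / delta)).+1.
  have md : 4 / delta <= m%:R by exact/ltW/truncnS_gt.
  pose C : R := expR 1 * (2 ^ k * k`!)%:R.
  have C0 : 0 <= C by rewrite mulr_ge0 ?expR_ge0.
  pose L := - ln (delta / 16); pose c : R := 2 * m%:R * (k%:R + 4) ^+ 2.
  near=> n.
  have [n0 kn] : (0 < n)%N /\ (2 * k <= n)%N by near: n.
  have kn' : (k <= n)%N by lia.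
  have x1 : 1 <= x n by near: n; exact: xlarge.
  have xc : 27 * (c + 1) <= x n by near: n; exact: xlarge.
  have xe : (C + 1) * 2 / e <= x n by near: n; exact: xlarge.
  pose y := expR (eps * ln (x n)).
  have yL : L * (k%:R + 5) + 1 <= y.
    by rewrite /y; near: n; exact: powlarge.
  have xN : expR (x n * y) <= (N n)%:R.
    suff -> : x n * y = expR ((1 + eps) * ln (x n)) by near: n.
    rewrite (_ : (1 + eps) * ln (x n) = ln (x n) + eps * ln (x n)); last by ring.
    by rewrite expRD lnxK.
  set tau := (2 * (n * m)).+1%:R ^+ n * expR (- ((N n)%:R *
    ((delta / 16) ^+ n.+1 * (delta / 16) `^ (Num.max (beta n) 0)))).
  have tau_le : tau <= expR (- x n).
    exact: net_bound_small (hbeta n) d01 erefl xN x1 yL xc.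
  have tau0 : 0 <= tau by rewrite mulr_ge0 ?expR_ge0// exprn_ge0.
  have tauC : (C + 1) * tau <= e / 2.
    apply: (@le_trans _ _ ((C + 1) / x n)).
      rewrite ler_wpM2l ?addr_ge0//; apply: le_trans tau_le _.
      rewrite expRN lef_pV2 ?posrE ?expR_gt0//; last by lra.
      by have := expR_ge1Dx (x n); lra.
    rewrite ler_pdivrMr; last by lra.
    by move: xe; rewrite ler_pdivrMr//; lra.
  have et0 : 0 <= eta * tau by rewrite mulr_ge0// ltW.
  have Ct0 : 0 <= C * tau by rewrite mulr_ge0.
  have eta01 : 0 <= eta <= 1 by rewrite ltW.
  have := expectation_near n0 (hN n) (hlaw n) (hindep n) kn
    (isT : (0 < m)%N) d01 md eta01 (fun K => sandwich n K n0 kn).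
  rewrite /= -/tau => /andP[lower upper]; have VB0 := intrinsic_volume_ball_gt0 (R := R) kn'.
  apply/andP; split.
    apply: le_trans (ediv_ge VB0 lower); rewrite lee_fin.
    by lra.
  apply: le_trans (ediv_le VB0 _) _.
    by rewrite -addrA in upper; exact: upper.
  by rewrite lee_fin -/C; lra.
- pose D : R := (2 ^ k * k`!)%:R * (expR 1 + 1).
  near=> n.
  have [n0 kn] : (0 < n)%N /\ (2 * k <= n)%N by near: n.
  have kn' : (k <= n)%N by lia.
  have x1 : 1 <= x n by near: n; exact: xlarge.
  pose y := expR (eps / 3 * ln (x n)); pose A := expR ((1 - eps) * ln (x n)).
  have y2 : 2 <= y by rewrite /y; near: n; exact: powlarge3.
  have yD : D / e <= y by rewrite /y; near: n; exact: powlarge3.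
  have A2 : 2 <= A by rewrite /A; near: n; exact: powlarge1.
  have y0 : 0 < y by exact: expR_gt0.
  have xAy : x n = A * y ^+ 3.
    rewrite -(lnxK n x1) /A /y -expRM_natl -expRD; congr expR; by field.
  have NA : (N n)%:R <= expR A by rewrite /A /x; near: n.
  have r0 : 0 < y^-1 by rewrite invr_gt0.
  have r2 : y^-1 ^+ 2 <= 2^-1.
    rewrite exprVn lef_pV2 ?posrE ?exprn_gt0//; nra.
  have t0 : 0 < n%:R * y^-1 by rewrite mulr_gt0// ltr0n.
  have := expectation_upper n0 (hN n) (hlaw n) kn' t0 r0 r2.
  have small := upper_bound_small n0 kn hk y2 A2 xAy NA.
  have VB0 := intrinsic_volume_ball_gt0 (R := R) kn'.
  move=> /(ediv_le VB0) upper.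
  rewrite sub0r add0r; apply/andP; split.
    apply: (@le_trans _ _ 0%E); first by rewrite lee_fin oppr_le0 ltW.
    rewrite /ratio inver gt_eqF// mule_ge0 ?lee_fin ?invr_ge0 ?(ltW VB0)//.
    by rewrite unlock; apply: integral_ge0 => w _; rewrite lee_fin intrinsic_volume_ge0.
  apply: le_trans upper _; rewrite lee_fin; apply: le_trans small _.
  by move: yD; rewrite -/D ler_pdivrMr// ler_pdivrMr// mulrC.
Unshelve. all: by end_near.
Qed.
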